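(* Let $k$ be an algebraically closed field of positive characteristic $p$, let $\mathcal{H}:=\mathrm{Hom}(\mathrm{SL}(2,k),\mathrm{SL}(4,k))/\!\sim$ be the set of equivalence classes of homomorphisms of algebraic groups $\mathrm{SL}(2,k)\to\mathrm{SL}(4,k)$, and let $S_{(\nu)^\sharp}\subseteq \mathcal{H}$ be the set of classes of homomorphisms of the form $(\nu)^\sharp$. Let $\Lambda_1=\{(e_1,e_2)\in\mathbb{Z}^2\mid e_2>e_1\ge 0\}$, $\Lambda_2=\{e\in\mathbb{Z}\mid e\ge 0\}$, $\Lambda_3=\{(e_2,e_3)\in\mathbb{Z}^2\mid e_2\ge e_3\ge 0\}$, $\Lambda_4=\{I_4\}$. (1) If $p=2$, then $\mathcal{H}$ is the disjoint union $$\mathcal{H}=S_{(\mathrm{IV})^\sharp}\sqcup S_{(\mathrm{V})^\sharp}\sqcup S_{(\mathrm{XI})^\sharp}\sqcup S_{(\mathrm{XV})^\sharp}\sqcup S_{(\mathrm{XIX})^\sharp}\sqcup S_{(\mathrm{XXIV})^\sharp}\sqcup S_{(\mathrm{XXVI})^\sharp},$$ and sending parameters to classes gives bijections of $\Lambda_1$ with $S_{(\mathrm{IV})^\sharp}$, of $\Lambda_2$ with each of $S_{(\mathrm{V})^\sharp}, S_{(\mathrm{XI})^\sharp}, S_{(\mathrm{XIX})^\sharp}, S_{(\mathrm{XXIV})^\sharp}$, of $\Lambda_3$ with $S_{(\mathrm{XV})^\sharp}$, and of $\Lambda_4$ with $S_{(\mathrm{XXVI})^\sharp}$; hence $\mathcal{H}\cong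 \Lambda_1\sqcup(\Lambda_2\sqcup\Lambda_2\sqcup\Lambda_2\sqcup\Lambda_2)\sqcup\Lambda_3\sqcup\Lambda_4$. (2) If $p=3$, then $\mathcal{H}$ is the disjoint union $$\mathcal{H}=S_{(\mathrm{II})^\sharp}\sqcup S_{(\mathrm{IV})^\sharp}\sqcup S_{(\mathrm{VII})^\sharp}\sqcup S_{(\mathrm{IX})^\sharp}\sqcup S_{(\mathrm{XV})^\sharp}\sqcup S_{(\mathrm{XXIV})^\sharp}\sqcup S_{(\mathrm{XXVI})^\sharp},$$ and sending parameters to classes gives bijections of $\Lambda_1$ with $S_{(\mathrm{IV})^\sharp}$, of $\Lambda_2$ with each of $S_{(\mathrm{II})^\sharp}, S_{(\mathrm{VII})^\sharp}, S_{(\mathrm{IX})^\sharp}, S_{(\mathrm{XXIV})^\sharp}$, of $\Lambda_3$ with $S_{(\mathrm{XV})^\sharp}$, and of $\Lambda_4$ with $S_{(\mathrm{XXVI})^\sharp}$; hence $\mathcal{H}\cong \Lambda_1\sqcup(\Lambda_2\sqcup\Lambda_2\sqcup\Lambda_2\sqcup\Lambda_2)\sqcup\Lambda_3\sqcup\Lambda_4$. (3) If $p\ge 5$, then $\mathcal{H}$ is the disjoint union $$\mathcal{H}=S_{(\mathrm{I})^\sharp}\sqcup S_{(\mathrm{IV})^\sharp}\sqcup S_{(\mathrm{IX})^\sharp}\sqcup S_{(\mathrm{XV})^\sharp}\sqcup S_{(\mathrm{XXIV})^\sharp}\sqcup S_{(\mathrm{XXVI})^\sharp},$$ and sending parameters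 to classes gives bijections of $\Lambda_1$ with $S_{(\mathrm{IV})^\sharp}$, of $\Lambda_2$ with each of $S_{(\mathrm{I})^\sharp}, S_{(\mathrm{IX})^\sharp}, S_{(\mathrm{XXIV})^\sharp}$, of $\Lambda_3$ with $S_{(\mathrm{XV})^\sharp}$, and of $\Lambda_4$ with $S_{(\mathrm{XXVI})^\sharp}$; hence $\mathcal{H}\cong \Lambda_1\sqcup(\Lambda_2\sqcup\Lambda_2\sqcup\Lambda_2)\sqcup\Lambda_3\sqcup\Lambda_4$.
   Context: Two homomorphisms $\sigma_1,\sigma_2$ from $\mathrm{SL}(2,k)$ to $\mathrm{SL}(4,k)$ are equivalent ($\sigma_1\sim\sigma_2$) if there is $P\in\mathrm{GL}(4,k)$ with $P^{-1}\sigma_1(A)P=\sigma_2(A)$ for all $A\in\mathrm{SL}(2,k)$. A homomorphism has the form $(\nu)^\sharp$ if it is one of the following homomorphisms, given by their value at $\begin{pmatrix} a & b \\ c & d \end{pmatrix}$ (the parameters are the displayed subscripts; each form is defined only in the indicated characteristics). $\oplus$ denotes the block-diagonal matrix. $(\mathrm{I})^\sharp$: $p\ge5$, $e_1\ge0$, $q=p^{e_1}$, $\sigma_{(\mathrm{I})^\sharp,e_1}$: $$\begin{pmatrix} a^{3q} & a^{2q}b^q & a^qb^{2q} & b^{3q} \\ 3a^{2q}c^q & a^q(a^qd^q+2b^qc^q) & b^q(2a^qd^q+b^qc^q) & 3b^{2q}d^q \\ 3a^qc^{2q} & c^q(2a^qd^q+b^qc^q) & d^q(a^qd^q+2b^qc^q)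 & 3b^qd^{2q} \\ c^{3q} & c^{2q}d^q & c^qd^{2q} & d^{3q} \end{pmatrix}.$$ $(\mathrm{II})^\sharp$: $p=3$, $e_1\ge0$, $q=p^{e_1}$, $\sigma_{(\mathrm{II})^\sharp,e_1}$: $$\begin{pmatrix} a^{3q} & b^{3q} & a^{2q}b^q & \frac12a^qb^{2q} \\ c^{3q} & d^{3q} & c^{2q}d^q & \frac12c^qd^{2q} \\ 0 & 0 & a^q & b^q \\ 0 & 0 & c^q & d^q \end{pmatrix}.$$ $(\mathrm{IV})^\sharp$: any $p$, $e_2>e_1\ge0$, $\sigma_{(\mathrm{IV})^\sharp,(e_1,e_2)}$: the Kronecker product $\begin{pmatrix} a^{p^{e_2}} & b^{p^{e_2}} \\ c^{p^{e_2}} & d^{p^{e_2}} \end{pmatrix}\otimes\begin{pmatrix} a^{p^{e_1}} & b^{p^{e_1}} \\ c^{p^{e_1}} & d^{p^{e_1}} \end{pmatrix}$, i.e. the block matrix whose blocks are $a^{p^{e_2}}X,\ b^{p^{e_2}}X;\ c^{p^{e_2}}X,\ d^{p^{e_2}}X$ with $X$ the second factor. $(\mathrm{V})^\sharp$: $p=2$, $e_1\ge0$, $q=p^{e_1}$, $\sigma_{(\mathrm{V})^\sharp,e_1}$: $$\begin{pmatrix} 1 & 0 & 0 & 0 \\ a^qb^q & a^{2q} & b^{2q} & 0 \\ c^qd^q & c^{2q} & d^{2q} & 0 \\ b^qc^q & a^qc^q & b^qd^q & 1 \end{pmatrix}.$$ $(\mathrm{VII})^\sharp$: $p=3$, $e_1\ge0$,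 $q=p^{e_1}$, $\sigma_{(\mathrm{VII})^\sharp,e_1}$: $$\begin{pmatrix} a^q & b^q & \frac12a^{2q}c^q & \frac12b^{2q}d^q \\ c^q & d^q & a^qc^{2q} & b^qd^{2q} \\ 0 & 0 & a^{3q} & b^{3q} \\ 0 & 0 & c^{3q} & d^{3q} \end{pmatrix}.$$ $(\mathrm{IX})^\sharp$: $p\ge3$, $e_1\ge0$, $q=p^{e_1}$, $\sigma_{(\mathrm{IX})^\sharp,e_1}$: $$\begin{pmatrix} a^{2q} & a^qb^q & b^{2q} \\ 2a^qc^q & a^qd^q+b^qc^q & 2b^qd^q \\ c^{2q} & c^qd^q & d^{2q} \end{pmatrix}\oplus(1).$$ $(\mathrm{XI})^\sharp$: $p=2$, $e_1\ge0$, $q=p^{e_1}$, $\sigma_{(\mathrm{XI})^\sharp,e_1}$: $$\begin{pmatrix} a^{2q} & b^{2q} & a^qb^q \\ c^{2q} & d^{2q} & c^qd^q \\ 0 & 0 & 1 \end{pmatrix}\oplus(1).$$ $(\mathrm{XV})^\sharp$: any $p$, $e_2\ge e_3\ge0$, $\sigma_{(\mathrm{XV})^\sharp,(e_2,e_3)}$: $$\begin{pmatrix} a^{p^{e_2}} & b^{p^{e_2}} \\ c^{p^{e_2}} & d^{p^{e_2}} \end{pmatrix}\oplus\begin{pmatrix} a^{p^{e_3}} & b^{p^{e_3}} \\ c^{p^{e_3}} & d^{p^{e_3}} \end{pmatrix}.$$ $(\mathrm{XIX})^\sharp$: $p=2$, $e_1\ge0$, $q=p^{e_1}$, $\sigma_{(\mathrm{XIX})^\sharp,e_1}$: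 $$\begin{pmatrix} a^{2q} & b^{2q} & 0 \\ c^{2q} & d^{2q} & 0 \\ a^qc^q & b^qd^q & 1 \end{pmatrix}\oplus(1).$$ $(\mathrm{XXIV})^\sharp$: any $p$, $e_2\ge0$, $\sigma_{(\mathrm{XXIV})^\sharp,e_2}$: $$\begin{pmatrix} a^{p^{e_2}} & b^{p^{e_2}} \\ c^{p^{e_2}} & d^{p^{e_2}} \end{pmatrix}\oplus(1)\oplus(1).$$ $(\mathrm{XXVI})^\sharp$: any $p$, $\sigma_{(\mathrm{XXVI})^\sharp}$: constant $I_4$. *)

(* Defs.v *)
From HB Require Import structures.
From mathcomp Require Import all_boot all_order all_algebra.
From mathcomp Require Import mpoly ring.
From mathcomp Require Import boolp classical_sets functions cardinality.

Set Implicit Arguments.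
Unset Strict Implicit.
Unset Printing Implicit Defensive.

Import GRing.Theory.
Local Open Scope classical_set_scope.
Local Open Scope ring_scope.

Section SpecialLinear.
Variables (k : fieldType) (n : nat).

Definition SL := {A : 'M[k]_n | \det A == 1}.

HB.instance Definition _ := SubType.on SL.
HB.instance Definition _ := Choice.on SL.

Implicit Types A B : SL.

Lemma SL_det A : \det (val A) = 1.
Proof. exact/eqP/(valP A). Qed.

Lemma SL_unit A : val A \in unitmx.
Proof. by rewrite unitmxE SL_det unitr1. Qed.

Fact SL_one_subproof : \det (1%:M : 'M[k]_n) == 1.
Proof. by rewrite det1. Qed.

Fact SL_mul_subproof A B : \det (val A *m val B) == 1.
Proof. by rewrite det_mulmx !SL_det mulr1. Qed.

Fact SL_inv_subproof A : \det (invmx (val A)) == 1.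
Proof. by rewrite det_inv SL_det invr1. Qed.

Definition SL_one : SL := Sub 1%:M SL_one_subproof.
Definition SL_mul A B : SL := Sub (val A *m val B) (SL_mul_subproof A B).
Definition SL_inv A : SL := Sub (invmx (val A)) (SL_inv_subproof A).

Fact SL_mulA : associative SL_mul.
Proof. by move=> A B C; apply: val_inj; rewrite /= mulmxA. Qed.
Fact SL_mul1 : left_id SL_one SL_mul.
Proof. by move=> A; apply: val_inj; rewrite /= mul1mx. Qed.
Fact SL_1mul : right_id SL_one SL_mul.
Proof. by move=> A; apply: val_inj; rewrite /= mulmx1. Qed.
Fact SL_mulV : left_inverse SL_one SL_inv SL_mul.
Proof. by move=> A; apply: val_inj; rewrite /= mulVmx ?SL_unit. Qed.
Fact SL_Vmul : right_inverse SL_one SL_inv SL_mul.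
Proof. by move=> A; apply: val_inj; rewrite /= mulmxV ?SL_unit. Qed.

HB.instance Definition _ :=
  isGroup.Build SL SL_mulA SL_mul1 SL_1mul SL_mulV SL_Vmul.

(* SL is closed in the affine space of matrices, so over an algebraically
   closed field its regular functions are the restrictions of polynomials in
   the matrix entries. *)
Definition regular (f : SL -> k) :=
  exists P : {mpoly k[n * n]}, forall A, f A = P.@[mxvec (val A) 0].

Lemma regular_const c : regular (fun=> c).
Proof. by exists c%:MP => A; rewrite mevalC. Qed.

Lemma regular_entry i j : regular (fun A => val A i j).
Proof. by exists 'X_(mxvec_index i j) => A; rewrite mevalXU mxvecE. Qed.

Lemma regularD f g : regular f -> regular g -> regular (fun A => f A + g A).
Proof. by move=> [P fP] [Q gQ]; exists (P + Q) => A; rewrite mevalD fP gQ. Qed.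

Lemma regularM f g : regular f -> regular g -> regular (fun A => f A * g A).
Proof. by move=> [P fP] [Q gQ]; exists (P * Q) => A; rewrite mevalM fP gQ. Qed.

Lemma regularX f q : regular f -> regular (fun A => f A ^+ q).
Proof. by move=> [P fP]; exists (P ^+ q) => A; rewrite rmorphXn /= fP. Qed.

End SpecialLinear.

Record alg_hom (k : fieldType) (m n : nat) := AlgHom {
  alg_hom_fun :> SL k m -> SL k n;
  alg_homM : {morph alg_hom_fun : A B / (A * B)%g};
  alg_hom_regular : forall i j, regular (fun A => val (alg_hom_fun A) i j)
}.

Section Equivalence.
Variables (k : fieldType) (m n : nat).
Implicit Types s t u : alg_hom k m n.

Definition equivalent s t :=
  exists2 P : 'M[k]_n, P \in unitmx &
    forall A, invmx P *m val (s A) *m P = val (t A).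

Lemma equivalent_refl s : equivalent s s.
Proof.
by exists 1%:M; [exact: unitmx1 | move=> A; rewrite invmx1 mul1mx mulmx1].
Qed.

Lemma equivalent_sym s t : equivalent s t -> equivalent t s.
Proof.
move=> [P Pu st]; exists (invmx P); first by rewrite unitmx_inv.
by move=> A; rewrite -st invmxK !mulmxA mulmxV // mul1mx mulmxK.
Qed.

Lemma equivalent_trans s t u :
  equivalent s t -> equivalent t u -> equivalent s u.
Proof.
move=> [P Pu st] [Q Qu tu]; have PQu: P *m Q \in unitmx by rewrite unitmx_mul Pu.
exists (P *m Q) => // A; rewrite -tu -st !mulmxA.
suff -> : invmx (P *m Q) = invmx Q *m invmx P by [].
by apply: (can_inj (mulKmx PQu)); rewrite mulmxV // mulmxA mulmxK ?mulmxV.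
Qed.

Definition alg_hom_class s : set (alg_hom k m n) := [set t | equivalent s t].

Definition alg_hom_classes : set (set (alg_hom k m n)) := range alg_hom_class.

Lemma eq_alg_hom_class s t :
  (alg_hom_class s = alg_hom_class t) <-> equivalent s t.
Proof.
split=> [st|st].
  have : alg_hom_class t t := equivalent_refl t.
  by rewrite -st.
apply/seteqP; split=> u /= su.
  exact: equivalent_trans (equivalent_sym st) su.
exact: equivalent_trans st su.
Qed.

End Equivalence.

Arguments alg_hom_classes : clear implicits.

Section Forms.
Variable k : fieldType.
Implicit Types (q : nat) (A B : 'M[k]_2).

Definition mx_of_rows m n (rows : seq (seq k)) : 'M[k]_(m, n) :=
  \matrix_(i, j) (nth [::] rows i)`_j.

Definition frob_mx q A : 'M[k]_2 := map_mx (fun x => x ^+ q) A.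

Definition form_I q A : 'M[k]_4 :=
  let a := A 0 0 in let b := A 0 1 in let c := A 1 0 in let d := A 1 1 in
  mx_of_rows 4 4
    [:: [:: a ^+ (3 * q); a ^+ (2 * q) * b ^+ q;
            a ^+ q * b ^+ (2 * q); b ^+ (3 * q)];
        [:: 3 * a ^+ (2 * q) * c ^+ q;
            a ^+ q * (a ^+ q * d ^+ q + 2 * b ^+ q * c ^+ q);
            b ^+ q * (2 * a ^+ q * d ^+ q + b ^+ q * c ^+ q);
            3 * b ^+ (2 * q) * d ^+ q];
        [:: 3 * a ^+ q * c ^+ (2 * q);
            c ^+ q * (2 * a ^+ q * d ^+ q + b ^+ q * c ^+ q);
            d ^+ q * (a ^+ q * d ^+ q + 2 * b ^+ q * c ^+ q);
            3 * b ^+ q * d ^+ (2 * q)];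
        [:: c ^+ (3 * q); c ^+ (2 * q) * d ^+ q;
            c ^+ q * d ^+ (2 * q); d ^+ (3 * q)]].

Definition form_II q A : 'M[k]_4 :=
  let a := A 0 0 in let b := A 0 1 in let c := A 1 0 in let d := A 1 1 in
  mx_of_rows 4 4
    [:: [:: a ^+ (3 * q); b ^+ (3 * q); a ^+ (2 * q) * b ^+ q;
            2^-1 * a ^+ q * b ^+ (2 * q)];
        [:: c ^+ (3 * q); d ^+ (3 * q); c ^+ (2 * q) * d ^+ q;
            2^-1 * c ^+ q * d ^+ (2 * q)];
        [:: 0; 0; a ^+ q; b ^+ q];
        [:: 0; 0; c ^+ q; d ^+ q]].

Definition form_IV q2 q1 A : 'M[k]_(2 + 2) :=
  let a := A 0 0 in let b := A 0 1 in let c := A 1 0 in let d := A 1 1 in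
  let X := frob_mx q1 A in
  block_mx (a ^+ q2 *: X) (b ^+ q2 *: X) (c ^+ q2 *: X) (d ^+ q2 *: X).

Definition form_V q A : 'M[k]_4 :=
  let a := A 0 0 in let b := A 0 1 in let c := A 1 0 in let d := A 1 1 in
  mx_of_rows 4 4
    [:: [:: 1; 0; 0; 0];
        [:: a ^+ q * b ^+ q; a ^+ (2 * q); b ^+ (2 * q); 0];
        [:: c ^+ q * d ^+ q; c ^+ (2 * q); d ^+ (2 * q); 0];
        [:: b ^+ q * c ^+ q; a ^+ q * c ^+ q; b ^+ q * d ^+ q; 1]].

Definition form_VII q A : 'M[k]_4 :=
  let a := A 0 0 in let b := A 0 1 in let c := A 1 0 in let d := A 1 1 in
  mx_of_rows 4 4
    [:: [:: a ^+ q; b ^+ q; 2^-1 * a ^+ (2 * q) * c ^+ q;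
            2^-1 * b ^+ (2 * q) * d ^+ q];
        [:: c ^+ q; d ^+ q; a ^+ q * c ^+ (2 * q); b ^+ q * d ^+ (2 * q)];
        [:: 0; 0; a ^+ (3 * q); b ^+ (3 * q)];
        [:: 0; 0; c ^+ (3 * q); d ^+ (3 * q)]].

Definition block_IX q A : 'M[k]_3 :=
  let a := A 0 0 in let b := A 0 1 in let c := A 1 0 in let d := A 1 1 in
  mx_of_rows 3 3
    [:: [:: a ^+ (2 * q); a ^+ q * b ^+ q; b ^+ (2 * q)];
        [:: 2 * a ^+ q * c ^+ q; a ^+ q * d ^+ q + b ^+ q * c ^+ q;
            2 * b ^+ q * d ^+ q];
        [:: c ^+ (2 * q); c ^+ q * d ^+ q; d ^+ (2 * q)]].

Definition form_IX q A : 'M[k]_(3 + 1) := block_mx (block_IX q A) 0 0 1%:M.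

Definition block_XI q A : 'M[k]_3 :=
  let a := A 0 0 in let b := A 0 1 in let c := A 1 0 in let d := A 1 1 in
  mx_of_rows 3 3
    [:: [:: a ^+ (2 * q); b ^+ (2 * q); a ^+ q * b ^+ q];
        [:: c ^+ (2 * q); d ^+ (2 * q); c ^+ q * d ^+ q];
        [:: 0; 0; 1]].

Definition form_XI q A : 'M[k]_(3 + 1) := block_mx (block_XI q A) 0 0 1%:M.

Definition form_XV q2 q3 A : 'M[k]_(2 + 2) :=
  block_mx (frob_mx q2 A) 0 0 (frob_mx q3 A).

Definition block_XIX q A : 'M[k]_3 :=
  let a := A 0 0 in let b := A 0 1 in let c := A 1 0 in let d := A 1 1 in
  mx_of_rows 3 3
    [:: [:: a ^+ (2 * q); b ^+ (2 * q); 0];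
        [:: c ^+ (2 * q); d ^+ (2 * q); 0];
        [:: a ^+ q * c ^+ q; b ^+ q * d ^+ q; 1]].

Definition form_XIX q A : 'M[k]_(3 + 1) := block_mx (block_XIX q A) 0 0 1%:M.

Definition form_XXIV q A : 'M[k]_(2 + 2) := block_mx (frob_mx q A) 0 0 1%:M.

Definition form_XXVI A : 'M[k]_4 := 1%:M.

End Forms.

Section IsHom.
Variable k : fieldType.
Implicit Types (q : nat) (A B : 'M[k]_2).

Definition is_hom n (f : 'M[k]_2 -> 'M[k]_n) :=
  (forall A, \det A = 1 -> \det (f A) = 1) /\
  (forall A B, \det A = 1 -> \det B = 1 -> f (A *m B) = f A *m f B).

Definition is_reg n (f : 'M[k]_2 -> 'M[k]_n) :=
  forall i j, regular (fun A : SL k 2 => f (val A) i j).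

Section Make.
Variables (n : nat) (f : 'M[k]_2 -> 'M[k]_n) (fH : is_hom f) (fR : is_reg f).

Fact mk_alg_hom_det (A : SL k 2) : \det (f (val A)) == 1.
Proof. by apply/eqP/fH.1/SL_det. Qed.

Definition mk_alg_hom_fun (A : SL k 2) : SL k n :=
  Sub (f (val A)) (mk_alg_hom_det A).

Fact mk_alg_homM : {morph mk_alg_hom_fun : A B / (A * B)%g}.
Proof. by move=> A B; apply: val_inj; rewrite /= fH.2 // SL_det. Qed.

Definition mk_alg_hom : alg_hom k 2 n := @AlgHom k 2 n _ mk_alg_homM fR.

Lemma mk_alg_homE (A : SL k 2) : val (mk_alg_hom A) = f (val A).
Proof. by []. Qed.

End Make.

Lemma det_mx2 A : \det A = A 0 0 * A 1 1 - A 0 1 * A 1 0.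
Proof.
rewrite (expand_det_row _ 0) !big_ord_recl big_ord0 /cofactor !det_mx11 !mxE /=.
have -> : lift 0 0 = 1 :> 'I_2 by apply: val_inj.
have -> : lift 1 0 = 0 :> 'I_2 by apply: val_inj.
by rewrite expr0 expr1; ring.
Qed.

Lemma mulmx2E A B i j : (A *m B) i j = A i 0 * B 0 j + A i 1 * B 1 j.
Proof.
rewrite mxE !big_ord_recl big_ord0 addr0.
by have -> : lift 0 0 = 1 :> 'I_2 by apply: val_inj.
Qed.

Lemma det_rows3 a1 a2 a3 b1 b2 b3 c1 c2 c3 :
  \det (@mx_of_rows k 3 3 [:: [:: a1; a2; a3]; [:: b1; b2; b3]; [:: c1; c2; c3]])
  = a1 * (b2 * c3 - b3 * c2) - a2 * (b1 * c3 - b3 * c1)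
    + a3 * (b1 * c2 - b2 * c1).
Proof.
rewrite (expand_det_row _ 0) !big_ord_recl big_ord0 /cofactor !det_mx2 !mxE /=.
by rewrite /bump /=; ring.
Qed.

Lemma det_rows4 a1 a2 a3 a4 b1 b2 b3 b4 c1 c2 c3 c4 d1 d2 d3 d4 :
  \det (@mx_of_rows k 4 4 [:: [:: a1; a2; a3; a4]; [:: b1; b2; b3; b4];
                             [:: c1; c2; c3; c4]; [:: d1; d2; d3; d4]]) =
    a1 * (b2 * (c3 * d4 - c4 * d3) - b3 * (c2 * d4 - c4 * d2)
          + b4 * (c2 * d3 - c3 * d2))
  - a2 * (b1 * (c3 * d4 - c4 * d3) - b3 * (c1 * d4 - c4 * d1)
          + b4 * (c1 * d3 - c3 * d1))
  + a3 * (b1 * (c2 * d4 - c4 * d2) - b2 * (c1 * d4 - c4 * d1)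
          + b4 * (c1 * d2 - c2 * d1))
  - a4 * (b1 * (c2 * d3 - c3 * d2) - b2 * (c1 * d3 - c3 * d1)
          + b3 * (c1 * d2 - c2 * d1)).
Proof.
rewrite (expand_det_row _ 0) !big_ord_recl big_ord0 /cofactor !mxE /=.
rewrite !(expand_det_row (_ : 'M_3) ord0) !big_ord_recl !big_ord0.
by rewrite /cofactor !det_mx2 !mxE /= /bump /=; ring.
Qed.

Lemma mul_rows3 a1 a2 a3 b1 b2 b3 c1 c2 c3 x1 x2 x3 y1 y2 y3 z1 z2 z3 :
  @mx_of_rows k 3 3 [:: [:: a1; a2; a3]; [:: b1; b2; b3]; [:: c1; c2; c3]] *m
  @mx_of_rows k 3 3 [:: [:: x1; x2; x3]; [:: y1; y2; y3]; [:: z1; z2; z3]] =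
  @mx_of_rows k 3 3
   [seq [:: r`_0 * x1 + r`_1 * y1 + r`_2 * z1;
            r`_0 * x2 + r`_1 * y2 + r`_2 * z2;
            r`_0 * x3 + r`_1 * y3 + r`_2 * z3]
      | r : seq k <- [:: [:: a1; a2; a3]; [:: b1; b2; b3]; [:: c1; c2; c3]]].
Proof.
apply/matrixP => i j; rewrite !mxE !big_ord_recl big_ord0 !mxE.
by case: i => [[|[|[|[]]]] //= _]; case: j => [[|[|[|[]]]] //= _];
  rewrite addr0 addrA.
Qed.

Lemma mul_rows4 a1 a2 a3 a4 b1 b2 b3 b4 c1 c2 c3 c4 d1 d2 d3 d4
                x1 x2 x3 x4 y1 y2 y3 y4 z1 z2 z3 z4 t1 t2 t3 t4 :
  @mx_of_rows k 4 4 [:: [:: a1; a2; a3; a4]; [:: b1; b2; b3; b4];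
                      [:: c1; c2; c3; c4]; [:: d1; d2; d3; d4]] *m
  @mx_of_rows k 4 4 [:: [:: x1; x2; x3; x4]; [:: y1; y2; y3; y4];
                      [:: z1; z2; z3; z4]; [:: t1; t2; t3; t4]] =
  @mx_of_rows k 4 4
   [seq [:: r`_0 * x1 + r`_1 * y1 + r`_2 * z1 + r`_3 * t1;
            r`_0 * x2 + r`_1 * y2 + r`_2 * z2 + r`_3 * t2;
            r`_0 * x3 + r`_1 * y3 + r`_2 * z3 + r`_3 * t3;
            r`_0 * x4 + r`_1 * y4 + r`_2 * z4 + r`_3 * t4]
      | r : seq k <- [:: [:: a1; a2; a3; a4]; [:: b1; b2; b3; b4];
                      [:: c1; c2; c3; c4]; [:: d1; d2; d3; d4]]].
Proof.
apply/matrixP => i j; rewrite !mxE !big_ord_recl big_ord0 !mxE.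
by case: i => [[|[|[|[|[]]]]] //= _]; case: j => [[|[|[|[|[]]]]] //= _];
  rewrite addr0 !addrA.
Qed.

End IsHom.

Section FormsRegular.
Variable k : fieldType.
Implicit Types (q e : nat) (A B : 'M[k]_2).

Lemma is_hom_ext n (f g : 'M[k]_2 -> 'M[k]_n) : f =1 g -> is_hom f -> is_hom g.
Proof.
move=> fg [fd fM]; split=> [A dA|A B dA dB]; first by rewrite -fg fd.
by rewrite -!fg fM.
Qed.

Lemma is_hom_block m n (f : 'M[k]_2 -> 'M[k]_m) (g : 'M[k]_2 -> 'M[k]_n) :
  is_hom f -> is_hom g -> is_hom (fun A => block_mx (f A) 0 0 (g A)).
Proof.
move=> [fd fM] [gd gM]; split=> [A dA|A B dA dB].
  by rewrite det_ublock fd ?gd ?mulr1.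
by rewrite mulmx_block !mulmx0 !mul0mx !addr0 !add0r fM ?gM.
Qed.

Lemma is_hom_const n : is_hom (fun _ => 1%:M : 'M[k]_n).
Proof. by split=> [A _|A B _ _]; rewrite ?det1 ?mul1mx. Qed.

Section Frobenius.
Variables (p : nat) (hp : p \in [pchar k]).

Lemma exprD_frob e (x y : k) : (x + y) ^+ (p ^ e) = x ^+ (p ^ e) + y ^+ (p ^ e).
Proof.
by apply: exprDn_pchar; rewrite pnatX pnatE ?hp //; exact: pcharf_prime hp.
Qed.

Lemma is_hom_frob e : is_hom (@frob_mx k (p ^ e)).
Proof.
have frobM A B : frob_mx (p ^ e) (A *m B) = frob_mx (p ^ e) A *m frob_mx (p ^ e) B.
  by apply/matrixP => i j; rewrite mulmx2E mxE mulmx2E exprD_frob !exprMn !mxE.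
split=> [A dA|A B _ _]; last exact: frobM.
rewrite det_mx2 !mxE -!exprMn.
apply: (addIr ((A 0 1 * A 1 0) ^+ (p ^ e))).
rewrite subrK -[in RHS](expr1n _ (p ^ e)) -exprD_frob; congr (_ ^+ _).
by rewrite -dA det_mx2 subrK.
Qed.

Lemma is_hom_twist n e (f : nat -> 'M[k]_2 -> 'M[k]_n) :
    (forall q A, f q A = f 1%N (frob_mx q A)) -> is_hom (f 1%N) ->
  is_hom (f (p ^ e)%N).
Proof.
move=> ft [fd fM]; have [gd gM] := is_hom_frob e.
by split=> [A dA|A B dA dB]; rewrite !(ft (p ^ e)%N) ?gM ?fM ?fd ?gd.
Qed.

End Frobenius.

Lemma regular_ext (f g : SL k 2 -> k) : (forall A : SL k 2, g A = f A) -> regular f -> regular g.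
Proof. by move=> fg [P fP]; exists P => A; rewrite fg. Qed.

Lemma is_reg_block m n (f1 : 'M[k]_2 -> 'M[k]_m) (f4 : 'M[k]_2 -> 'M[k]_n)
    (f2 : 'M[k]_2 -> 'M[k]_(m, n)) (f3 : 'M[k]_2 -> 'M[k]_(n, m)) :
    is_reg f1 -> (forall i j, regular (fun A : SL k 2 => f2 (val A) i j)) ->
    (forall i j, regular (fun A : SL k 2 => f3 (val A) i j)) -> is_reg f4 ->
  is_reg (fun A => block_mx (f1 A) (f2 A) (f3 A) (f4 A)).
Proof.
move=> r1 r2 r3 r4 i j.
case: (split_ordP i) => i' ->; case: (split_ordP j) => j' ->.
- by apply: regular_ext (r1 i' j') => A; rewrite block_mxEul.
- by apply: regular_ext (r2 i' j') => A; rewrite block_mxEur.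
- by apply: regular_ext (r3 i' j') => A; rewrite block_mxEdl.
- by apply: regular_ext (r4 i' j') => A; rewrite block_mxEdr.
Qed.

Lemma is_reg_const n (M : 'M[k]_n) : is_reg (fun=> M).
Proof. by move=> i j; exact: regular_const. Qed.

Ltac reg := repeat first [exact: regular_const | exact: regular_entry
  | apply: regularX | apply: regularD | apply: regularM].
Ltac reg_rows := let i := fresh in let j := fresh in
  move=> i j;
  case: i => [[|[|[|[|[]]]]] //= ?]; case: j => [[|[|[|[|[]]]]] //= ?];
  (eapply regular_ext; [by move=> ?; rewrite mxE /=; reflexivity | reg]).

Lemma is_reg_frob q : is_reg (@frob_mx k q).
Proof.
move=> i j; eapply regular_ext; [by move=> A; rewrite mxE; reflexivity | reg].
Qed.

Lemma form_I_twist q A : form_I q A = form_I 1 (frob_mx q A).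
Proof. by rewrite /form_I !mxE !(mulnC _ q) !muln1 !exprM !expr1. Qed.
Lemma form_II_twist q A : form_II q A = form_II 1 (frob_mx q A).
Proof. by rewrite /form_II !mxE !(mulnC _ q) !muln1 !exprM !expr1. Qed.
Lemma form_V_twist q A : form_V q A = form_V 1 (frob_mx q A).
Proof. by rewrite /form_V !mxE !(mulnC _ q) !muln1 !exprM !expr1. Qed.
Lemma form_VII_twist q A : form_VII q A = form_VII 1 (frob_mx q A).
Proof. by rewrite /form_VII !mxE !(mulnC _ q) !muln1 !exprM !expr1. Qed.
Lemma block_IX_twist q A : block_IX q A = block_IX 1 (frob_mx q A).
Proof. by rewrite /block_IX !mxE !(mulnC _ q) !muln1 !exprM !expr1. Qed.
Lemma block_XI_twist q A : block_XI q A = block_XI 1 (frob_mx q A).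
Proof. by rewrite /block_XI !mxE !(mulnC _ q) !muln1 !exprM !expr1. Qed.
Lemma block_XIX_twist q A : block_XIX q A = block_XIX 1 (frob_mx q A).
Proof. by rewrite /block_XIX !mxE !(mulnC _ q) !muln1 !exprM !expr1. Qed.

Lemma form_I_reg q : is_reg (@form_I k q). Proof. by reg_rows. Qed.
Lemma form_II_reg q : is_reg (@form_II k q). Proof. by reg_rows. Qed.
Lemma form_V_reg q : is_reg (@form_V k q). Proof. by reg_rows. Qed.
Lemma form_VII_reg q : is_reg (@form_VII k q). Proof. by reg_rows. Qed.
Lemma block_IX_reg q : is_reg (@block_IX k q). Proof. by reg_rows. Qed.
Lemma block_XI_reg q : is_reg (@block_XI k q). Proof. by reg_rows. Qed.
Lemma block_XIX_reg q : is_reg (@block_XIX k q). Proof. by reg_rows. Qed.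

Lemma is_reg_oplus1 (f : 'M[k]_2 -> 'M[k]_3) :
  is_reg f -> is_reg (fun A => block_mx (f A) 0 0 1%:M : 'M_(3 + 1)).
Proof. by move=> fr; apply: is_reg_block => // i j; exact: regular_const. Qed.
Lemma form_IX_reg q : is_reg (@form_IX k q).
Proof. exact/is_reg_oplus1/block_IX_reg. Qed.
Lemma form_XI_reg q : is_reg (@form_XI k q).
Proof. exact/is_reg_oplus1/block_XI_reg. Qed.
Lemma form_XIX_reg q : is_reg (@form_XIX k q).
Proof. exact/is_reg_oplus1/block_XIX_reg. Qed.
Lemma form_XXIV_reg q : is_reg (@form_XXIV k q).
Proof.
by apply: is_reg_block => [|i j|i j|i j]; first exact: is_reg_frob;
   exact: regular_const.
Qed.
Lemma form_XV_reg q2 q3 : is_reg (@form_XV k q2 q3).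
Proof.
by apply: is_reg_block => [|i j|i j|]; [exact: is_reg_frob
  |exact: regular_const|exact: regular_const|exact: is_reg_frob].
Qed.
Lemma form_IV_reg q2 q1 : is_reg (@form_IV k q2 q1).
Proof.
apply: is_reg_block => i j;
  (eapply regular_ext; [by move=> A; rewrite !mxE; reflexivity | reg]).
Qed.
Lemma form_XXVI_reg : is_reg (@form_XXVI k).
Proof. exact: is_reg_const. Qed.
End FormsRegular.

Section FormsIsHom.
Variable k : fieldType.
Implicit Types (q e : nat) (A B : 'M[k]_2).

Ltac entries A := move: (A 0 0) (A 0 1) (A 1 0) (A 1 1).

(* Proves an equation from an explicit expression E for the difference of its
   two sides, E being 0 by the hypotheses h1, h2, h3. *)
Ltac by_diff E h1 h2 h3 :=
  apply/subr0_eq; transitivity E; [ring | rewrite ?h1 ?h2 ?h3; ring].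

Lemma form_IV_hom (p : nat) (hp : p \in [pchar k]) e2 e1 :
  is_hom (@form_IV k (p ^ e2) (p ^ e1)).
Proof.
have [fd2 fM2] := is_hom_frob hp e2; have [fd1 fM1] := is_hom_frob hp e1.
have E A : form_IV (p ^ e2) (p ^ e1) A =
    block_mx (frob_mx (p ^ e2) A 0 0)%:M (frob_mx (p ^ e2) A 0 1)%:M
             (frob_mx (p ^ e2) A 1 0)%:M (frob_mx (p ^ e2) A 1 1)%:M
    *m block_mx (frob_mx (p ^ e1) A) 0 0 (frob_mx (p ^ e1) A).
  by rewrite mulmx_block !mulmx0 !addr0 !add0r !mul_scalar_mx /form_IV !mxE.
have detE (M : 'M[k]_2) :
    \det (block_mx (M 0 0)%:M (M 0 1)%:M (M 1 0)%:M (M 1 1)%:M : 'M_(2 + 2))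
    = (\det M) ^+ 2.
  rewrite (_ : block_mx _ _ _ _ = mx_of_rows (2 + 2) (2 + 2)
    [:: [:: M 0 0; 0; M 0 1; 0]; [:: 0; M 0 0; 0; M 0 1];
        [:: M 1 0; 0; M 1 1; 0]; [:: 0; M 1 0; 0; M 1 1]]); last first.
    apply/matrixP => i j.
    case: (split_ordP i) => i' ->; case: (split_ordP j) => j' ->;
    rewrite ?block_mxEul ?block_mxEur ?block_mxEdl ?block_mxEdr !mxE;
    by case: i' => [[|[|[]]] //= ?]; case: j' => [[|[|[]]] //= ?].
  by rewrite det_rows4 det_mx2; ring.
split=> [A dA|A B dA dB].
  by rewrite E det_mulmx detE det_ublock fd1 ?fd2 // !mulr1 expr1n.
rewrite /form_IV mulmx_block -!scalemxAl -!scalemxAr !scalerA -!scalerDl -fM1 //.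
have fE i j : (A *m B) i j ^+ (p ^ e2) =
    A i 0 ^+ (p ^ e2) * B 0 j ^+ (p ^ e2) + A i 1 ^+ (p ^ e2) * B 1 j ^+ (p ^ e2).
  by rewrite mulmx2E (exprD_frob hp) !exprMn.
by rewrite !fE.
Qed.

Lemma form_XV_hom (p : nat) (hp : p \in [pchar k]) e2 e3 :
  is_hom (@form_XV k (p ^ e2) (p ^ e3)).
Proof. exact: is_hom_block (is_hom_frob hp e2) (is_hom_frob hp e3). Qed.

Lemma form_XXIV_hom (p : nat) (hp : p \in [pchar k]) e :
  is_hom (@form_XXIV k (p ^ e)).
Proof. exact: is_hom_block (is_hom_frob hp e) (is_hom_const _ _). Qed.

Lemma form_XXVI_hom : is_hom (@form_XXVI k).
Proof. exact: is_hom_const. Qed.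

Lemma form_I_hom1 : is_hom (@form_I k 1).
Proof.
split=> [A|A B _ _].
  rewrite det_mx2 /form_I det_rows4.
  entries A => a b c d dA.
  by transitivity ((a * d - b * c) ^+ 6); [ring | rewrite dA expr1n].
rewrite /form_I mul_rows4 !mulmx2E /=.
entries A => a b c d; entries B => x y z w.
by congr (mx_of_rows _ _ _); do ?[congr (_ :: _)]; ring.
Qed.

Lemma block_IX_hom1 : is_hom (@block_IX k 1).
Proof.
split=> [A|A B _ _].
  rewrite det_mx2 /block_IX det_rows3.
  entries A => a b c d dA.
  by transitivity ((a * d - b * c) ^+ 3); [ring | rewrite dA expr1n].
rewrite /block_IX mul_rows3 !mulmx2E /=.
entries A => a b c d; entries B => x y z w.
by congr (mx_of_rows _ _ _); do ?[congr (_ :: _)]; ring.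
Qed.

Lemma form_IX_hom (p : nat) (hp : p \in [pchar k]) e :
  is_hom (@form_IX k (p ^ e)).
Proof.
have h := is_hom_twist hp e (@block_IX_twist k) block_IX_hom1.
exact: is_hom_block h (is_hom_const _ _).
Qed.

Section Char2.
Hypothesis h2 : 2 = 0 :> k.

Lemma form_V_hom1 : is_hom (@form_V k 1).
Proof.
split=> [A|A B].
  rewrite det_mx2 /form_V det_rows4.
  entries A => a b c d dA.
  transitivity ((a * d - b * c) * (a * d - b * c + 2 * (b * c))); first by ring.
  by rewrite dA h2; ring.
rewrite !det_mx2 /form_V mul_rows4 !mulmx2E /=.
entries A => a b c d; entries B => x y z w.
move=> /eqP; rewrite -subr_eq0 => /eqP dA /eqP; rewrite -subr_eq0 => /eqP dB.
congr (mx_of_rows _ _ _); congr [:: [:: _; _; _; _]; [:: _; _; _; _];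
  [:: _; _; _; _]; [:: _; _; _; _]]; try by ring.
- by_diff (a * b * ((x * w - y * z - 1) + 2 * (z * y))) h2 dA dB.
- by_diff (2 * (a * x * b * z)) h2 dA dB.
- by_diff (2 * (a * y * b * w)) h2 dA dB.
- by_diff (c * d * ((x * w - y * z - 1) + 2 * (z * y))) h2 dA dB.
- by_diff (2 * (c * x * d * z)) h2 dA dB.
- by_diff (2 * (c * y * d * w)) h2 dA dB.
- by_diff (y * z * (a * d - b * c - 1) + b * c * (x * w - y * z - 1)
           + 2 * (b * c * y * z)) h2 dA dB.
- by_diff (x * z * ((a * d - b * c - 1) + 2 * (b * c))) h2 dA dB.
- by_diff (y * w * ((a * d - b * c - 1) + 2 * (b * c))) h2 dA dB.
Qed.

Lemma block_XI_hom1 : is_hom (@block_XI k 1).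
Proof.
split=> [A|A B].
  rewrite det_mx2 /block_XI det_rows3.
  entries A => a b c d dA.
  transitivity ((a * d - b * c) * (a * d - b * c + 2 * (b * c))); first by ring.
  by rewrite dA h2; ring.
rewrite !det_mx2 /block_XI mul_rows3 !mulmx2E /=.
entries A => a b c d; entries B => x y z w.
move=> /eqP; rewrite -subr_eq0 => /eqP dA /eqP; rewrite -subr_eq0 => /eqP dB.
congr (mx_of_rows _ _ _); congr [:: [:: _; _; _]; [:: _; _; _];
  [:: _; _; _]]; try by ring.
- by_diff (2 * (a * x * b * z)) h2 dA dB.
- by_diff (2 * (a * y * b * w)) h2 dA dB.
- by_diff (a * b * ((x * w - y * z - 1) + 2 * (z * y))) h2 dA dB.
- by_diff (2 * (c * x * d * z)) h2 dA dB.
- by_diff (2 * (c * y * d * w)) h2 dA dB.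
- by_diff (c * d * ((x * w - y * z - 1) + 2 * (z * y))) h2 dA dB.
Qed.

Lemma form_XI_hom (p : nat) (hp : p \in [pchar k]) e :
  is_hom (@form_XI k (p ^ e)).
Proof.
have h := is_hom_twist hp e (@block_XI_twist k) block_XI_hom1.
exact: is_hom_block h (is_hom_const _ _).
Qed.

Lemma block_XIX_hom1 : is_hom (@block_XIX k 1).
Proof.
split=> [A|A B].
  rewrite det_mx2 /block_XIX det_rows3.
  entries A => a b c d dA.
  transitivity ((a * d - b * c) * (a * d - b * c + 2 * (b * c))); first by ring.
  by rewrite dA h2; ring.
rewrite !det_mx2 /block_XIX mul_rows3 !mulmx2E /=.
entries A => a b c d; entries B => x y z w.
move=> /eqP; rewrite -subr_eq0 => /eqP dA /eqP; rewrite -subr_eq0 => /eqP dB.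
congr (mx_of_rows _ _ _); congr [:: [:: _; _; _]; [:: _; _; _];
  [:: _; _; _]]; try by ring.
- by_diff (2 * (a * x * b * z)) h2 dA dB.
- by_diff (2 * (a * y * b * w)) h2 dA dB.
- by_diff (2 * (c * x * d * z)) h2 dA dB.
- by_diff (2 * (c * y * d * w)) h2 dA dB.
- by_diff (x * z * ((a * d - b * c - 1) + 2 * (b * c))) h2 dA dB.
- by_diff (y * w * ((a * d - b * c - 1) + 2 * (b * c))) h2 dA dB.
Qed.

Lemma form_XIX_hom (p : nat) (hp : p \in [pchar k]) e :
  is_hom (@form_XIX k (p ^ e)).
Proof.
have h := is_hom_twist hp e (@block_XIX_twist k) block_XIX_hom1.
exact: is_hom_block h (is_hom_const _ _).
Qed.

End Char2.

Section Char3.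
Hypothesis h3 : 3 = 0 :> k.

Lemma half_char3 : 2^-1 = - 1 :> k.
Proof.
have m2 : 2 = - 1 :> k by apply/subr0_eq; rewrite -h3; ring.
by rewrite m2 invrN1.
Qed.

Lemma form_II_hom1 : is_hom (@form_II k 1).
Proof.
split=> [A|A B].
  rewrite det_mx2 /form_II half_char3 det_rows4.
  entries A => a b c d dA.
  transitivity ((a * d - b * c)^+ 2 * ((a * d - b * c) ^+ 2 + 3 * (a * b * c * d))).
    by ring.
  by rewrite dA h3; ring.
rewrite !det_mx2 /form_II half_char3 mul_rows4 !mulmx2E /=.
entries A => a b c d; entries B => x y z w.
move=> /eqP; rewrite -subr_eq0 => /eqP dA /eqP; rewrite -subr_eq0 => /eqP dB.
congr (mx_of_rows _ _ _); congr [:: [:: _; _; _; _]; [:: _; _; _; _];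
  [:: _; _; _; _]; [:: _; _; _; _]]; try by ring.
- by_diff (3 * (a ^+ 2 * x ^+ 2 * b * z + a * x * b ^+ 2 * z ^+ 2)) h3 dA dB.
- by_diff (3 * (a ^+ 2 * y ^+ 2 * b * w + a * y * b ^+ 2 * w ^+ 2)) h3 dA dB.
- by_diff (a ^+ 2 * b * x * ((x * w - y * z - 1) + 3 * (y * z))
           + a * b ^+ 2 * z * (3 * (x * w) - (x * w - y * z - 1))) h3 dA dB.
- by_diff (a ^+ 2 * b * y * ((x * w - y * z - 1) - 3 * (x * w))
           - a * b ^+ 2 * w * ((x * w - y * z - 1) + 3 * (y * z))) h3 dA dB.
- by_diff (3 * (c ^+ 2 * x ^+ 2 * d * z + c * x * d ^+ 2 * z ^+ 2)) h3 dA dB.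
- by_diff (3 * (c ^+ 2 * y ^+ 2 * d * w + c * y * d ^+ 2 * w ^+ 2)) h3 dA dB.
- by_diff (c ^+ 2 * d * x * ((x * w - y * z - 1) + 3 * (y * z))
           + c * d ^+ 2 * z * (3 * (x * w) - (x * w - y * z - 1))) h3 dA dB.
- by_diff (c ^+ 2 * d * y * ((x * w - y * z - 1) - 3 * (x * w))
           - c * d ^+ 2 * w * ((x * w - y * z - 1) + 3 * (y * z))) h3 dA dB.
Qed.

Lemma form_VII_hom1 : is_hom (@form_VII k 1).
Proof.
split=> [A|A B].
  rewrite det_mx2 /form_VII half_char3 det_rows4.
  entries A => a b c d dA.
  transitivity ((a * d - b * c)^+ 2 * ((a * d - b * c) ^+ 2 + 3 * (a * b * c * d))).
    by ring.
  by rewrite dA h3; ring.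
rewrite !det_mx2 /form_VII half_char3 mul_rows4 !mulmx2E /=.
entries A => a b c d; entries B => x y z w.
move=> /eqP; rewrite -subr_eq0 => /eqP dA /eqP; rewrite -subr_eq0 => /eqP dB.
congr (mx_of_rows _ _ _); congr [:: [:: _; _; _; _]; [:: _; _; _; _];
  [:: _; _; _; _]; [:: _; _; _; _]]; try by ring.
- by_diff (b * x * z ^+ 2 * ((a * d - b * c - 1) - 3 * (a * d))
           - a * x ^+ 2 * z * ((a * d - b * c - 1) + 3 * (b * c))) h3 dA dB.
- by_diff (b * y * w ^+ 2 * ((a * d - b * c - 1) - 3 * (a * d))
           - a * y ^+ 2 * w * ((a * d - b * c - 1) + 3 * (b * c))) h3 dA dB.
- by_diff (c * x ^+ 2 * z * (3 * (a * d) - (a * d - b * c - 1))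
           + d * x * z ^+ 2 * ((a * d - b * c - 1) + 3 * (b * c))) h3 dA dB.
- by_diff (c * y ^+ 2 * w * (3 * (a * d) - (a * d - b * c - 1))
           + d * y * w ^+ 2 * ((a * d - b * c - 1) + 3 * (b * c))) h3 dA dB.
- by_diff (3 * (a ^+ 2 * x ^+ 2 * b * z + a * x * b ^+ 2 * z ^+ 2)) h3 dA dB.
- by_diff (3 * (a ^+ 2 * y ^+ 2 * b * w + a * y * b ^+ 2 * w ^+ 2)) h3 dA dB.
- by_diff (3 * (c ^+ 2 * x ^+ 2 * d * z + c * x * d ^+ 2 * z ^+ 2)) h3 dA dB.
- by_diff (3 * (c ^+ 2 * y ^+ 2 * d * w + c * y * d ^+ 2 * w ^+ 2)) h3 dA dB.
Qed.

End Char3.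

End FormsIsHom.

Definition Lambda1 : set (nat * nat) := [set e | (e.1 < e.2)%N].
Definition Lambda2 : set nat := [set: nat].
(* the pairs (e2, e3) with e2 >= e3 *)
Definition Lambda3 : set (nat * nat) := [set e | (e.2 <= e.1)%N].
Definition Lambda4 (k : fieldType) : set 'M[k]_4 := [set 1%:M].
Arguments Lambda4 : clear implicits.

Section Sigma.
Variables (k : fieldType) (p : nat) (hp : p \in [pchar k]).
Implicit Types (e : nat) (ee : nat * nat).

Fact eq0_pchar n : p = n -> n%:R = 0 :> k.
Proof. by move=> <-; exact: pcharf0 hp. Qed.

(* sigma_I and sigma_IX are homomorphisms in every positive characteristic; the
   other restrictions on the characteristic are needed to define the
   homomorphism and appear as arguments. *)
Definition sigma_I e : alg_hom k 2 4 :=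
  mk_alg_hom (is_hom_twist hp e (@form_I_twist k) (form_I_hom1 k))
    (@form_I_reg k (p ^ e)).

Definition sigma_II (p3 : p = 3%N) e : alg_hom k 2 4 :=
  mk_alg_hom
    (is_hom_twist hp e (@form_II_twist k) (form_II_hom1 (eq0_pchar p3)))
    (@form_II_reg k (p ^ e)).

Definition sigma_IV ee : alg_hom k 2 4 :=
  let: (e1, e2) := ee in
  mk_alg_hom (form_IV_hom hp e2 e1) (@form_IV_reg k (p ^ e2) (p ^ e1)).

Definition sigma_V (p2 : p = 2%N) e : alg_hom k 2 4 :=
  mk_alg_hom (is_hom_twist hp e (@form_V_twist k) (form_V_hom1 (eq0_pchar p2)))
    (@form_V_reg k (p ^ e)).

Definition sigma_VII (p3 : p = 3%N) e : alg_hom k 2 4 :=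
  mk_alg_hom
    (is_hom_twist hp e (@form_VII_twist k) (form_VII_hom1 (eq0_pchar p3)))
    (@form_VII_reg k (p ^ e)).

Definition sigma_IX e : alg_hom k 2 4 :=
  mk_alg_hom (form_IX_hom hp e) (@form_IX_reg k (p ^ e)).

Definition sigma_XI (p2 : p = 2%N) e : alg_hom k 2 4 :=
  mk_alg_hom (form_XI_hom (eq0_pchar p2) hp e) (@form_XI_reg k (p ^ e)).

Definition sigma_XV ee : alg_hom k 2 4 :=
  let: (e2, e3) := ee in
  mk_alg_hom (form_XV_hom hp e2 e3) (@form_XV_reg k (p ^ e2) (p ^ e3)).

Definition sigma_XIX (p2 : p = 2%N) e : alg_hom k 2 4 :=
  mk_alg_hom (form_XIX_hom (eq0_pchar p2) hp e) (@form_XIX_reg k (p ^ e)).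

Definition sigma_XXIV e : alg_hom k 2 4 :=
  mk_alg_hom (form_XXIV_hom hp e) (@form_XXIV_reg k (p ^ e)).

Definition sigma_XXVI : alg_hom k 2 4 :=
  mk_alg_hom (form_XXVI_hom k) (form_XXVI_reg k).

Definition cl_I e := alg_hom_class (sigma_I e).
Definition cl_II p3 e := alg_hom_class (sigma_II p3 e).
Definition cl_IV ee := alg_hom_class (sigma_IV ee).
Definition cl_V p2 e := alg_hom_class (sigma_V p2 e).
Definition cl_VII p3 e := alg_hom_class (sigma_VII p3 e).
Definition cl_IX e := alg_hom_class (sigma_IX e).
Definition cl_XI p2 e := alg_hom_class (sigma_XI p2 e).
Definition cl_XV ee := alg_hom_class (sigma_XV ee).
Definition cl_XIX p2 e := alg_hom_class (sigma_XIX p2 e).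
Definition cl_XXIV e := alg_hom_class (sigma_XXIV e).
Definition cl_XXVI (_ : 'M[k]_4) := alg_hom_class sigma_XXVI.

Definition S_I : set (set (alg_hom k 2 4)) := cl_I @` Lambda2.
Definition S_II p3 : set (set (alg_hom k 2 4)) := cl_II p3 @` Lambda2.
Definition S_IV : set (set (alg_hom k 2 4)) := cl_IV @` Lambda1.
Definition S_V p2 : set (set (alg_hom k 2 4)) := cl_V p2 @` Lambda2.
Definition S_VII p3 : set (set (alg_hom k 2 4)) := cl_VII p3 @` Lambda2.
Definition S_IX : set (set (alg_hom k 2 4)) := cl_IX @` Lambda2.
Definition S_XI p2 : set (set (alg_hom k 2 4)) := cl_XI p2 @` Lambda2.
Definition S_XV : set (set (alg_hom k 2 4)) := cl_XV @` Lambda3.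
Definition S_XIX p2 : set (set (alg_hom k 2 4)) := cl_XIX p2 @` Lambda2.
Definition S_XXIV : set (set (alg_hom k 2 4)) := cl_XXIV @` Lambda2.
Definition S_XXVI : set (set (alg_hom k 2 4)) := cl_XXVI @` Lambda4 k.

End Sigma.

Arguments sigma_XXVI : clear implicits.
Arguments cl_XXVI : clear implicits.
Arguments S_XXVI : clear implicits.

Definition disjoint_union T (A : set T) (s : seq (set T)) :=
  cover `I_(size s) (nth set0 s) = A /\ trivIset `I_(size s) (nth set0 s).

(* Main.v *)
(* A homomorphism restricted to the diagonal torus is diagonalisable with
   integral weights, symmetric under the Weyl group, so in dimension 4 they are
   m >= n >= -n >= -m.  In a weight basis the images of [[1,x],[0,1]] and
   [[1,0],[y,1]] have monomial entries, so they are known from x = y = 1.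
   Comparing the two decompositions of
     [[1,0],[1,1]] [[1,x],[0,1]]
       = [[1,x/d],[0,1]] diag(1/d,d) [[1,0],[1/d,1]],   d = 1 + x,
   gives polynomial identities between these entries.  On the lowest weight
   the identity expresses (1 + X)^m as a sum of at most four monomials whose
   exponents are dictated by the weights; hence m is 0, q, 2q, 3q or q1 + q2
   with q, q1, q2 powers of p, and in the last cases n is determined as well.
   For each shape the remaining identities determine the homomorphism up to a
   change of basis, which is given explicitly.  Inequivalence of the forms
   follows from their weights and, when these agree, from identities satisfied
   by the unipotent elements in one form and not in the other. *)
Require Import Defs.
From HB Require Import structures.
From mathcomp Require Import all_boot all_order all_algebra.
From mathcomp Require Import fingroup perm.
From mathcomp Require Import mpoly ring zify.
From mathcomp Require Import boolp classical_sets functions cardinality.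

Set Implicit Arguments.
Unset Strict Implicit.
Unset Printing Implicit Defensive.

Import GRing.Theory.
Local Open Scope classical_set_scope.
Local Open Scope ring_scope.

(** * Polynomials and generators of SL(2, k) *)

(** In characteristic p neither complete reducibility nor the Lie algebra helps: nontrivial
    Frobenius twists have zero differential, and nonsplit modules occur (II and VII for p = 3; V, XI
    and XIX for p = 2) whose weights are also those of some XV or XXIV. The big cell identity takes
    the place of commutator relations, and its strength comes from two facts. In the entry at
    weights a and b, every nonzero term on the decomposed side carries the same power of d = 1 + x,
    with exponent -(a + b)/2, so the identity becomes polynomial. At an extreme weight, a row or
    column of a unipotent element is that of the identity, so one side shrinks to a single term and
    a power of 1 + X equals a short sum. Powers of p appear because C(m, r) vanishes modulo p for
    most r only if the base p digits of m are few and small. The values at x = y = 1 suffice because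
    conjugation by diag(t, 1/t) scales x by t^2 and k contains all square roots. *)

Section Polynomials.
Variable k : closedFieldType.

(** Otherwise its product with the monic polynomial with roots [s] would be nonzero and would have a
    non-root. In the applications [s] holds 0 or -1, where [torus] or the big cell identity carries
    no information. *)
Lemma poly_eq0_cofinite (p : {poly k}) (s : seq k) :
  (forall x, x \notin s -> p.[x] = 0) -> p = 0.
Proof.
move=> p0; apply/eqP/negP => /negP pn0.
have: p * \prod_(a <- s) ('X - a%:P) != 0.
  by rewrite mulf_neq0 // prodf_seq_neq0; apply/allP => a _; rewrite polyXsubC_eq0.
case/closed_nonrootP => x; rewrite rootM negb_or root_prod_XsubC => /andP[px xs].
by case/negP: px; rewrite rootE p0.
Qed.

Lemma poly_eq_cofinite (p q : {poly k}) (s : seq k) :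
  (forall x, x \notin s -> p.[x] = q.[x]) -> p = q.
Proof.
move=> pq; apply/eqP; rewrite -subr_eq0; apply/eqP/(@poly_eq0_cofinite _ s) => x xs.
by rewrite hornerD hornerN pq ?subrr.
Qed.

Lemma expr_inj_forall (m n : nat) :
  (forall t : k, t != 0 -> t ^+ m = t ^+ n) -> m = n.
Proof.
move=> mn; have: 'X^m = 'X^n :> {poly k}.
  by apply: (@poly_eq_cofinite _ _ [:: 0]) => x; rewrite inE !hornerXn => /mn.
by move/(congr1 (fun p : {poly k} => size p)); rewrite !size_polyXn => -[].
Qed.

Lemma exprz_inj_forall (m n : int) :
  (forall t : k, t != 0 -> t ^ m = t ^ n) -> m = n.
Proof.
move=> mn.
(* Multiplication by [t ^ N] makes both exponents nonnegative. *)
pose N := (absz m + absz n)%N.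
have mn' (t : k) : t != 0 -> t ^+ absz (m + N) = t ^+ absz (n + N).
  move=> t0; rewrite !exprnP.
  rewrite (_ : Posz (absz (m + N)) = m + N); last by rewrite /N; lia.
  rewrite (_ : Posz (absz (n + N)) = n + N); last by rewrite /N; lia.
  by rewrite !expfzDr // mn.
by have := expr_inj_forall mn'; rewrite /N; lia.
Qed.

End Polynomials.

Section Curves.
Variables (k : fieldType) (n : nat).

(* [C] stands for a class of functions on a curve [c], such as the polynomial
   or the Laurent polynomial ones. *)
Lemma regular_curve (X : Type) (C : (X -> k) -> Prop) (c : X -> SL k n) (f : SL k n -> k) :
    (forall a, C (fun=> a)) ->
    (forall g h, C g -> C h -> C (fun x => g x + h x)) ->
    (forall g h, C g -> C h -> C (fun x => g x * h x)) ->
    (forall i j, C (fun x => val (c x) i j)) ->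
  regular f -> C (fun x => f (c x)).
Proof.
move=> Cc CD CM Ce [P fP].
have -> : (fun x => f (c x)) = (fun x => P.@[mxvec (val (c x)) 0]).
  by apply: funext => x; rewrite fP.
elim/mpolyind: P {f fP} => [|a m p _ _ IH].
  by rewrite (_ : (fun _ => _) = fun=> 0) //; apply: funext => x; rewrite meval0.
rewrite (_ : (fun _ => _) = (fun x => a * \prod_(i < n * n) mxvec (val (c x)) 0 i ^+ m i
   + p.@[mxvec (val (c x)) 0])); last first.
  by apply: funext => x; rewrite mevalD mevalZ mevalX.
apply: (CD _ _ _ IH); apply: (CM) => //.
have CX (g : X -> k) e : C g -> C (fun x => g x ^+ e).
  move=> Cg; elim: e => [|e IHe].
    by rewrite (_ : (fun _ => _) = fun=> 1) //; apply: funext => x; rewrite expr0.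
  rewrite (_ : (fun _ => _) = fun x => g x * g x ^+ e); first exact: CM.
  by apply: funext => x; rewrite exprS.
elim: (index_enum _) => [|i r IHr].
  by rewrite (_ : (fun _ => _) = fun=> 1) //; apply: funext => x; rewrite big_nil.
rewrite (_ : (fun _ => _) = fun x => mxvec (val (c x)) 0 i ^+ m i *
   \prod_(i <- r) mxvec (val (c x)) 0 i ^+ m i); last first.
  by apply: funext => x; rewrite big_cons.
apply: (CM) => //; apply: CX; case/mxvec_indexP: i => i j.
rewrite (_ : (fun _ => _) = fun x => val (c x) i j); first exact: Ce.
by apply: funext => x; rewrite mxvecE.
Qed.

End Curves.

Section Generators.
Variable k : fieldType.

Lemma SL2_det_rows (a b c d : k) : a * d - b * c = 1 ->
  \det (mx_of_rows 2 2 [:: [:: a; b]; [:: c; d]]) == 1.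
Proof. by move=> e; rewrite det_mx2 !mxE /= e. Qed.

Definition SL2_of (a b c d : k) (e : a * d - b * c = 1) : SL k 2 :=
  Sub (mx_of_rows 2 2 [:: [:: a; b]; [:: c; d]]) (SL2_det_rows e).

Fact upper_subproof (x : k) : 1 * 1 - x * 0 = 1. Proof. by ring. Qed.
Fact lower_subproof (x : k) : 1 * 1 - 0 * x = 1. Proof. by ring. Qed.

Definition upper x := SL2_of (upper_subproof x).
Definition lower x := SL2_of (lower_subproof x).

(* The junk value [torus 0] is the identity. *)
Definition torus (t : k) : SL k 2 :=
  insubd (SL_one k 2) (mx_of_rows 2 2 [:: [:: t; 0]; [:: 0; t^-1]]).

Lemma val_torus t : t != 0 -> val (torus t) = mx_of_rows 2 2 [:: [:: t; 0]; [:: 0; t^-1]].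
Proof. by move=> t0; rewrite val_insubd SL2_det_rows // mulfV // mul0r subr0. Qed.

Lemma mx2P (A B : 'M[k]_2) : A 0 0 = B 0 0 -> A 0 1 = B 0 1 -> A 1 0 = B 1 0 ->
  A 1 1 = B 1 1 -> A = B.
Proof.
move=> h00 h01 h10 h11; apply/matrixP => i j.
have ord2 (l : 'I_2) : l = 0 \/ l = 1.
  by case: l => -[|[|//]] h; [left | right]; apply: val_inj.
by case: (ord2 i) => ->; case: (ord2 j) => ->.
Qed.

Lemma SL2_eq (A B : SL k 2) : val A 0 0 = val B 0 0 -> val A 0 1 = val B 0 1 ->
  val A 1 0 = val B 1 0 -> val A 1 1 = val B 1 1 -> A = B.
Proof. by move=> *; apply: val_inj; apply: mx2P. Qed.

Lemma SL2M (A B : SL k 2) i j :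
  val (A * B)%g i j = val A i 0 * val B 0 j + val A i 1 * val B 1 j.
Proof. exact: mulmx2E. Qed.

Lemma upperD x y : upper (x + y) = (upper x * upper y)%g.
Proof. by apply: SL2_eq; rewrite SL2M !mxE /=; ring. Qed.

Lemma upper0 : upper 0 = 1%g.
Proof. by apply: SL2_eq; rewrite !mxE /=. Qed.

Lemma lower0 : lower 0 = 1%g.
Proof. by apply: SL2_eq; rewrite !mxE /=. Qed.

Lemma torus1 : torus 1 = 1%g.
Proof. by apply: SL2_eq; rewrite val_torus ?oner_eq0 // !mxE /= ?invr1. Qed.

Lemma torusM s t : s != 0 -> t != 0 -> torus (s * t) = (torus s * torus t)%g.
Proof.
move=> s0 t0; apply: SL2_eq; rewrite SL2M !val_torus ?mulf_neq0 // !mxE /=; field;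
by rewrite ?s0 ?t0.
Qed.

Lemma torus_upper t x : t != 0 ->
  (torus t * upper x)%g = (upper (t ^+ 2 * x) * torus t)%g.
Proof.
move=> t0; apply: SL2_eq; rewrite !SL2M !val_torus // !mxE /=; field; rewrite ?t0 ?oner_eq0 //.
Qed.

Lemma torus_lower t x : t != 0 ->
  (torus t * lower (t ^+ 2 * x))%g = (lower x * torus t)%g.
Proof.
move=> t0; apply: SL2_eq; rewrite !SL2M !val_torus // !mxE /=; field; rewrite ?t0 ?oner_eq0 //.
Qed.

Lemma lower_upper x : 1 + x != 0 ->
  (lower 1 * upper x)%g =
  (upper (x / (1 + x)) * torus (1 + x)^-1 * lower (1 + x)^-1)%g.
Proof.
move=> d0; apply: SL2_eq; rewrite !SL2M !val_torus ?invr_eq0 // !mxE /=; field; rewrite ?oner_eq0 ?invr_eq0 ?(addrC x) ?d0 //.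
Qed.

(** An element with lower left entry c != 0 is a product upper, lower, upper. If c = 0 then d != 0,
    and multiplication by [lower (- 1)] replaces c by -d. *)
Lemma SL2_generated (P : SL k 2 -> Prop) :
    (forall x, P (upper x)) -> (forall x, P (lower x)) ->
    (forall A B, P A -> P B -> P (A * B)%g) ->
  forall A, P A.
Proof.
move=> Pu Pl PM.
have Pc (A : SL k 2) : val A 1 0 != 0 -> P A.
  move=> c0; have dA := SL_det A; rewrite det_mx2 in dA.
  pose a := val A 0 0; pose c := val A 1 0; pose d := val A 1 1.
  have eA : A = (upper ((a - 1) / c) * lower c * upper ((d - 1) / c))%g.
    have eb : val A 0 1 = (a * d - 1) / c.
      by apply: (mulIf c0); rewrite mulfVK //; apply/eqP; rewrite eq_sym subr_eq addrC -subr_eq dA.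
    apply: SL2_eq; rewrite !SL2M !mxE /= ?eb -/a -/c -/d; field;
    by rewrite ?c0.
  by rewrite eA; apply: (PM); [apply: (PM)|].
move=> A; have [c0|] := eqVneq (val A 1 0) 0; last exact: Pc.
have -> : A = ((A * lower (- 1)) * lower 1)%g.
  by apply: SL2_eq; rewrite !SL2M !mxE /=; ring.
apply: (PM) => //; apply: Pc; rewrite SL2M !mxE /= c0 mul0r add0r mulrN1 oppr_eq0.
have := SL_det A; rewrite det_mx2 c0 mulr0 subr0.
by apply: contra_eq_neq => ->; rewrite mulr0 eq_sym oner_neq0.
Qed.

End Generators.

(** * Weight bases *)

Section Conjugation.
Variables (k : fieldType) (m n : nat) (s : alg_hom k m n) (P : 'M[k]_n) (Pu : P \in unitmx).

Lemma regular_sum (I : Type) (r : seq I) (f : I -> SL k m -> k) :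
  (forall i, regular (f i)) -> regular (fun A => \sum_(i <- r) f i A).
Proof.
move=> fr; elim: r => [|i r IH].
  rewrite (_ : (fun _ => _) = fun=> 0); first exact: regular_const.
  by apply: funext => A; rewrite big_nil.
rewrite (_ : (fun _ => _) = fun A => f i A + \sum_(j <- r) f j A).
  exact: regularD.
by apply: funext => A; rewrite big_cons.
Qed.

Fact conj_hom_det (A : SL k m) : \det (invmx P *m val (s A) *m P) == 1.
Proof.
by rewrite !det_mulmx SL_det mulr1 det_inv mulVf // -unitfE -unitmxE.
Qed.

Definition conj_hom_fun A : SL k n := Sub (invmx P *m val (s A) *m P) (conj_hom_det A).

Fact conj_homM : {morph conj_hom_fun : A B / (A * B)%g}.
Proof.
move=> A B; apply: val_inj; rewrite /= alg_homM /=.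
by rewrite !mulmxA (mulmxK Pu).
Qed.

Fact conj_hom_regular i j : regular (fun A => val (conj_hom_fun A) i j).
Proof.
rewrite (_ : (fun _ => _) = fun A =>
    \sum_l (\sum_l' invmx P i l' * val (s A) l' l) * P l j); last first.
  by apply: funext => A; rewrite /= mxE; apply: eq_bigr => l _; rewrite mxE.
apply: regular_sum => l; apply: regularM (regular_const _ _); apply: regular_sum => l'.
exact: regularM (regular_const _ _) (alg_hom_regular _ _ _).
Qed.

Definition conj_hom := AlgHom conj_homM conj_hom_regular.

Lemma conj_homE A : val (conj_hom A) = invmx P *m val (s A) *m P.
Proof. by []. Qed.

Lemma equivalent_conj : equivalent s conj_hom.
Proof. by exists P. Qed.

End Conjugation.

Section HomTheory.
Variables (k : fieldType) (m n : nat) (s : alg_hom k m n).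

Lemma alg_homMx A B : val (s (A * B)%g) = val (s A) *m val (s B).
Proof. by rewrite alg_homM. Qed.

Lemma alg_hom1 : val (s 1%g) = 1%:M.
Proof.
have := alg_homMx 1%g 1%g; rewrite mulg1 => e.
by rewrite -[RHS](mulVmx (SL_unit (s 1%g))) [X in _ *m X]e mulKmx // SL_unit.
Qed.

End HomTheory.

Section Weights.
Variables (k : closedFieldType) (n : nat).

Definition has_weights (s : alg_hom k 2 n) (lam : 'I_n -> int) :=
  forall x, x != 0 -> val (s (torus x)) = diag_mx (\row_i x ^ lam i).

Lemma regular_torus (f : SL k 2 -> k) : regular f ->
  exists Np : nat * {poly k}, forall x, x != 0 -> x ^+ Np.1 * f (torus x) = Np.2.[x].
Proof.
(* Laurent polynomials, stored as a power of x that clears the denominator together with the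
   resulting numerator. *)
move=> fr; pose C (g : k -> k) :=
  exists Np : nat * {poly k}, forall x, x != 0 -> x ^+ Np.1 * g x = Np.2.[x].
apply: (@regular_curve _ _ _ C (@torus k) f _ _ _ _ fr).
- by move=> a; exists (0, a%:P) => x _; rewrite hornerC mul1r.
- move=> g h [[N p] /= gp] [[M q] /= hq].
  exists ((N + M)%N, p * 'X^M + q * 'X^N) => x x0 /=.
  rewrite hornerD !hornerM !hornerXn -gp // -hq // exprD; ring.
- move=> g h [[N p] /= gp] [[M q] /= hq].
  exists ((N + M)%N, p * q) => x x0 /=.
  by rewrite hornerM -gp // -hq // exprD; ring.
move=> i j; pose p : {poly k} := if i == j then if i == 0 then 'X^2 else 1 else 0.
exists (1, p) => x x0 /=; rewrite val_torus // !mxE {}/p expr1.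
case: i => -[|[|//]] hi; case: j => -[|[|//]] hj /=; rewrite ?mulr0 ?horner0 //.
  by rewrite hornerXn.
by rewrite mulfV // hornerC.
Qed.

Lemma mx_poly_eq0 a b D (A : 'I_D -> 'M[k]_(a, b)) :
  (forall x, x != 0 -> \sum_(r < D) x ^+ r *: A r = 0) -> forall r, A r = 0.
Proof.
move=> A0 r; apply/matrixP => i j; rewrite mxE.
have p0 : \sum_(q < D) A q i j *: 'X^q = 0 :> {poly k}.
  apply: (@poly_eq0_cofinite _ _ [:: 0]) => x; rewrite inE => x0.
  have := congr1 (fun M : 'M_(a, b) => M i j) (A0 x x0); rewrite summxE mxE => e.
  rewrite horner_sum -[RHS]e; apply: eq_bigr => q _.
  by rewrite hornerZ hornerXn mxE mulrC.
have := congr1 (fun p : {poly k} => p`_r) p0; rewrite coef0 coef_sum.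
rewrite (bigD1 r) //= big1 ?addr0 => [|q qr]; first by rewrite coefZ coefXn eqxx mulr1.
by rewrite coefZ coefXn [(r == q :> nat)]eq_sym (inj_eq val_inj) (negPf qr) mulr0.
Qed.

Lemma mx_poly_eq a b D (A B : 'I_D -> 'M[k]_(a, b)) :
  (forall x, x != 0 -> \sum_(r < D) x ^+ r *: A r = \sum_(r < D) x ^+ r *: B r) ->
  forall r, A r = B r.
Proof.
move=> AB r; apply/eqP; rewrite -subr_eq0; apply/eqP.
apply: (mx_poly_eq0 (A := fun r => A r - B r)) => x x0.
by under eq_bigr do rewrite scalerBr; rewrite sumrB AB ?subrr.
Qed.

Lemma torus_coefs (s : alg_hom k 2 n) :
  exists N D (E : 'I_D -> 'M[k]_n), forall x, x != 0 ->
    x ^+ N *: val (s (torus x)) = \sum_(r < D) x ^+ r *: E r.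
Proof.
have := fun ij : 'I_n * 'I_n => regular_torus (alg_hom_regular s ij.1 ij.2).
move/choice => [F Fs]; pose N := (\sum_ij (F ij).1)%N.
pose Q ij : {poly k} := (F ij).2 * 'X^(N - (F ij).1).
pose D := (\max_ij size (Q ij))%N.
exists N, D, (fun r => \matrix_(i, j) (Q (i, j))`_r) => x x0.
apply/matrixP => i j; rewrite mxE summxE.
have leN : ((F (i, j)).1 <= N)%N by rewrite /N (bigD1 (i, j)) //= leq_addr.
have -> : x ^+ N * val (s (torus x)) i j = (Q (i, j)).[x].
  by rewrite /Q hornerM hornerXn -Fs //= mulrAC -exprD subnKC.
have leD : (size (Q (i, j)) <= D)%N by rewrite /D (leq_bigmax (i, j)).
rewrite (horner_coef_wide _ leD); apply: eq_bigr => r _.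
by rewrite !mxE mulrC.
Qed.

End Weights.

Section WeightBasis.
Variables (k : closedFieldType) (n' : nat).
Let n := n'.+1.

Lemma idempotent_diagonalizable (A : 'M[k]_n) : A *m A = A -> diagonalizable A.
Proof.
move=> AA; apply/diagonalizableP; exists [:: 0; 1]; first by rewrite /= inE eq_sym oner_eq0.
apply: mxminpoly_min; rewrite big_cons big_seq1 subr0.
by rewrite rmorphM rmorphB /= horner_mx_X horner_mx_C mulrBr mulr1 -mulmxE AA subrr.
Qed.

(** Write x^N s(torus x) as a sum of x^r E_r. Comparing coefficients in s(torus x) s(torus y) =
    s(torus (x y)) shows that the E_r are orthogonal idempotents, and x = 1 shows that they sum to
    1. They are therefore simultaneously diagonalisable, and the image of E_r is the weight space of
    weight r - N. *)
Lemma has_weights_exists (s : alg_hom k 2 n) :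
  exists t lam, equivalent s t /\ has_weights t lam.
Proof.
have [N [D [E sE]]] := torus_coefs s.
have EE r q : E r *m E q = (r == q)%:R *: E r.
  move: r.
  suff H x : x != 0 -> forall r, E r *m (\sum_(q < D) x ^+ q *: E q) = x ^+ r *: E r.
    move=> r; move: q; apply: (@mx_poly_eq _ _ _ _ (fun q => E r *m E q)) => x x0.
    transitivity (E r *m (\sum_(q < D) x ^+ q *: E q)).
      by rewrite mulmx_sumr; apply: eq_bigr => q _; rewrite scalemxAr.
    rewrite H // (bigD1 r) //= eqxx scale1r big1 ?addr0 // => q qr.
    by rewrite eq_sym (negPf qr) scale0r scaler0.
  move=> x0; apply: mx_poly_eq => y y0.
  transitivity ((\sum_(r < D) y ^+ r *: E r) *m (\sum_(q < D) x ^+ q *: E q)).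
    by rewrite mulmx_suml; apply: eq_bigr => l _; rewrite scalemxAl.
  rewrite -!sE // -scalemxAl -scalemxAr scalerA -alg_homMx -torusM // -exprMn sE ?mulf_neq0 //.
  by apply: eq_bigr => r _; rewrite exprMn scalerA.
have E1 : \sum_(r < D) E r = 1%:M.
  have := sE 1 (oner_neq0 _); rewrite expr1n scale1r torus1 alg_hom1 => ->.
  by apply: eq_bigr => r _; rewrite expr1n scale1r.
have [P Pu /allP Pd] : codiagonalizable [seq E r | r <- enum 'I_D].
  apply/codiagonalizableP; split.
    by move=> _ _ /mapP[r _ ->] /mapP[q _ ->]; rewrite /comm_mx !EE;
      case: eqVneq => [->|]; rewrite // !scale0r.
  by move=> _ /mapP[r _ ->]; apply: idempotent_diagonalizable; rewrite EE eqxx scale1r.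
pose c r i := (P *m E r *m invmx P) i i.
have cE r : P *m E r *m invmx P = diag_mx (\row_i c r i).
  have /similar_diagPp d0 : similar_diag P (E r) by apply: Pd; rewrite map_f ?mem_enum.
  apply/matrixP => i j; rewrite [RHS]mxE [X in X *+ _]mxE.
  by case: eqVneq => [->//|ij]; rewrite -conjumx // d0 // (inj_eq val_inj).
have cM r q i : c r i * c q i = (r == q)%:R * c r i.
  have : P *m E r *m invmx P *m (P *m E q *m invmx P) = (r == q)%:R *: (P *m E r *m invmx P).
    by rewrite !mulmxA mulmxKV // -(mulmxA P) EE -scalemxAr -scalemxAl.
  rewrite !cE mulmx_diag => /(congr1 (fun M : 'M_n => M i i)).
  by rewrite !mxE eqxx.
have c1 i : \sum_(r < D) c r i = 1.
  rewrite /c -summxE -mulmx_suml -mulmx_sumr E1 mulmx1 mulmxV //.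
  by rewrite mxE eqxx.
(* For fixed [i] the numbers [c r i] sum to 1, so one is nonzero; being idempotent it is 1, and
   orthogonality kills the others. *)
have /choice[lam lamP] i : exists r, c r i = 1.
  have [r cr|/= c0] := pickP (fun r => c r i != 0).
    exists r; apply: (mulfI cr); have := cM r r i; rewrite eqxx mul1r mulr1; exact.
  by have := c1 i; rewrite big1 => [/eqP|r _]; [rewrite eq_sym oner_eq0 | exact/eqP/negbFE/c0].
pose Pi := invmx P; have Piu : Pi \in unitmx by rewrite unitmx_inv.
exists (conj_hom s Piu), (fun i => (lam i : nat)%:Z - N%:Z); split; first exact: equivalent_conj.
move=> x x0; rewrite conj_homE invmxK.
have xN0 : x ^+ N != 0 by rewrite expf_neq0.
have -> : val (s (torus x)) = (x ^+ N)^-1 *: \sum_(r < D) x ^+ r *: E r.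
  by rewrite -sE // scalerA mulVf // scale1r.
rewrite -scalemxAr -scalemxAl mulmx_sumr mulmx_suml.
under eq_bigr do rewrite -scalemxAr -scalemxAl cE.
apply/matrixP => i j; rewrite !mxE summxE.
case: (eqVneq i j) => [->|ij]; last first.
  by rewrite big1 ?mulr0 // => r _; rewrite !mxE (negPf ij) mulr0.
rewrite (bigD1 (lam j)) //= big1 ?addr0 => [|r rl].
  rewrite !mxE eqxx !mulr1n lamP mulr1 expfzDr // -exprnP mulrC.
  by rewrite exprnN.
have := cM r (lam j) j; rewrite lamP (negPf rl) mul0r mulr1 => cr0.
by rewrite !mxE eqxx cr0 mul0rn mulr0.
Qed.

End WeightBasis.

(** * Intertwiners and sorted weights *)

Section Intertwiners.
Variables (k : closedFieldType) (n : nat).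
Implicit Types (s t : alg_hom k 2 n) (lam mu : 'I_n -> int).

(** A nonzero entry [W i j] forces [lam i = mu j], and an invertible matrix has a nonzero term in
    its Leibniz expansion, which supplies the permutation. *)
Lemma weights_perm lam mu (W : 'M[k]_n) : W \in unitmx ->
    (forall x : k, x != 0 ->
      diag_mx (\row_i x ^ lam i) *m W = W *m diag_mx (\row_i x ^ mu i)) ->
  exists pi : 'S_n, forall i, lam i = mu (pi i).
Proof.
move=> Wu WT.
have W0 i j : W i j != 0 -> lam i = mu j.
  move=> wij; apply: (@exprz_inj_forall k) => x x0; apply: (mulIf wij).
  have := congr1 (fun M : 'M_n => M i j) (WT x x0).
  by rewrite mul_diag_mx mul_mx_diag !mxE => ->; rewrite mulrC.
have [pi /prodf_neq0 piP] : exists pi : 'S_n, \prod_i W i (pi i) != 0.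
  apply/existsP; apply: contraTT Wu => /existsPn H.
  rewrite unitmxE unitfE negbK /determinant big1 // => pi _.
  by have /negbNE/eqP -> := H pi; rewrite mulr0.
by exists pi => i; apply: W0; exact: piP.
Qed.

Lemma equivalent_weights s t lam mu : equivalent s t ->
  has_weights s lam -> has_weights t mu -> exists pi : 'S_n, forall i, lam i = mu (pi i).
Proof.
move=> [P Pu st] sl tm; apply: (weights_perm Pu) => x x0.
by rewrite -sl // -tm // -st !mulmxA mulmxV // mul1mx.
Qed.

(** Every unipotent generator with nonzero parameter y^2 is a conjugate of [upper 1] or [lower 1] by
    a torus element, and every element of k is a square. *)
Lemma equivalent_intertwiner s t (Q : 'M[k]_n) : Q \in unitmx ->
    (forall x, x != 0 -> val (s (torus x)) *m Q = Q *m val (t (torus x))) ->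
    val (s (upper 1)) *m Q = Q *m val (t (upper 1)) ->
    val (s (lower 1)) *m Q = Q *m val (t (lower 1)) ->
  equivalent s t.
Proof.
move=> Qu QT QU QL; exists Q => // A.
suff sQ : val (s A) *m Q = Q *m val (t A) by rewrite -mulmxA sQ mulmxA mulVmx ?mul1mx.
pose C A := val (s A) *m Q = Q *m val (t A); rewrite -/(C A).
have CM B D : C B -> C D -> C (B * D)%g.
  by move=> CB CD; rewrite /C !alg_homMx -mulmxA CD mulmxA CB mulmxA.
have sqrt (x : k) : exists y, x = y ^+ 2.
  have [y] := @solve_monicpoly k 2 (fun i => if i == 0%N then x else 0) isT.
  by rewrite !big_ord_recl big_ord0 /= mul0r !addr0 expr0 mulr1 => <-; exists y.
have C1 : C 1%g by rewrite /C !alg_hom1 mul1mx mulmx1.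
have uE (y : k) : y != 0 -> upper (y ^+ 2) = (torus y * upper 1 * torus y^-1)%g.
  by move=> y0; rewrite torus_upper // mulr1 -mulgA -torusM ?invr_eq0 // mulfV // torus1 mulg1.
have lE (y : k) : y != 0 -> lower (y ^+ 2) = (torus y^-1 * lower 1 * torus y)%g.
  move=> y0; rewrite -mulgA -torus_lower // mulgA -torusM ?invr_eq0 // mulVf // torus1 mul1g.
  by rewrite mulr1.
apply: SL2_generated (CM) A => x; have [y ->] := sqrt x; have [->|y0] := eqVneq y 0.
- by rewrite expr0n upper0.
- by rewrite uE //; apply: (CM); [apply: (CM)|]; rewrite /C ?QU // QT // invr_eq0.
- by rewrite expr0n lower0.
- by rewrite lE //; apply: (CM); [apply: (CM)|]; rewrite /C ?QL // QT // invr_eq0.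
Qed.

Lemma permuted_weights s lam (pi : 'S_n) : has_weights s lam ->
  exists2 t, equivalent s t & has_weights t (fun i => lam (pi i)).
Proof.
move=> sl; have Pu := unitmx_perm k (pi^-1)%g.
exists (conj_hom s Pu); first exact: equivalent_conj.
move=> x x0; rewrite conj_homE sl //.
apply: (can_inj (mulKmx Pu)); rewrite !mulmxA mulmxV // mul1mx.
apply/matrixP => i j; rewrite -row_permE -col_permE !mxE.
by rewrite -(inj_eq (@perm_inj _ pi) _ j) permKV.
Qed.

Lemma weights_symmetric s lam : has_weights s lam ->
  exists pi : 'S_n, forall i, lam i = - lam (pi i).
Proof.
(* The Weyl element [[0, 1], [-1, 0]], which inverts the torus. *)
move=> sl; pose w : SL k 2 := (upper 1 * lower (- 1) * upper 1)%g.
apply: (@weights_perm _ (fun i => - lam i) _ (SL_unit (s w))) => x x0.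
have -> : diag_mx (\row_i x ^ (- lam i)) = val (s (torus x^-1)).
  rewrite sl ?invr_eq0 //; congr diag_mx; apply/rowP => i.
  by rewrite !mxE -exprz_inv.
rewrite -sl // -!alg_homMx; congr (val (s _)).
by apply: SL2_eq; rewrite !SL2M !val_torus ?invr_eq0 // !mxE /= ?invrK; ring.
Qed.

End Intertwiners.

Notation o0 := (@Ordinal 4 0 isT).
Notation o1 := (@Ordinal 4 1 isT).
Notation o2 := (@Ordinal 4 2 isT).
Notation o3 := (@Ordinal 4 3 isT).

Lemma ord4_ind (P : 'I_4 -> Prop) : P o0 -> P o1 -> P o2 -> P o3 -> forall i, P i.
Proof.
by move=> ? ? ? ? [[|[|[|[|//]]]] h]; rewrite (bool_irrelevance h isT).
Qed.

Lemma sum4 (V : nmodType) (F : 'I_4 -> V) : \sum_i F i = F o0 + F o1 + F o2 + F o3.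
Proof.
rewrite !big_ord_recl big_ord0 addr0 !addrA.
by congr (F _ + F _ + F _ + F _); apply: val_inj.
Qed.

Section SortedWeights.
Variable k : closedFieldType.

(** The decreasing order makes the images of [upper 1] and [lower 1] upper and lower
    unitriangular. *)
Definition weights4 (m n : nat) (i : 'I_4) : int :=
  [:: Posz m; Posz n; - Posz n; - Posz m]`_i.

Lemma sorted_weights_exist (s : alg_hom k 2 4) : exists (m n : nat) t,
  [/\ (n <= m)%N, equivalent s t & has_weights t (weights4 m n)].
Proof.
have [s1 [lam [ss1 s1l]]] := has_weights_exists s.
pose T : 4.-tuple int := [tuple lam i | i < 4].
pose ge (a b : int) := (b <= a)%R.
have geT : total ge by move=> a b; rewrite /ge Order.TotalTheory.le_total.
have [pi piE] : exists pi : 'S_4, sort ge T = [tuple tnth T (pi i) | i < 4].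
  by apply/tuple_permP; rewrite perm_sort.
have := sort_sorted geT T; rewrite piE.
have [t s1t tl] := permuted_weights pi s1l.
have [rho rhoE] := weights_symmetric tl.
pose mu i := lam (pi i).
have -> : [tuple tnth T (pi i) | i < 4] = [tuple mu i | i < 4].
  by apply: eq_from_tnth => i; rewrite !tnth_mktuple.
have {}rhoE : forall i, mu i = - mu (rho i) := rhoE.
have {}tl : has_weights t mu := tl.
clearbody mu => {T piE}.
rewrite (_ : val _ = [:: mu o0; mu o1; mu o2; mu o3]); last first.
  by rewrite /= !enum_ordSl enum_ord0 /=; do ![congr (mu _ :: _); first exact: val_inj].
rewrite /= /ge => /and4P[l1 l2 l3 _].
have ub i : mu i <= mu o0 by elim/ord4_ind: i => //; lia.
have lb i : mu o3 <= mu i by elim/ord4_ind: i => //; lia.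
(* The sum of the weights is zero; since the largest is minus the smallest, the two middle ones are
   opposite as well. *)
have s0 : \sum_i mu i = - \sum_i mu i.
  by rewrite -sumrN [RHS](reindex_perm rho); apply: eq_bigr => i _; exact: rhoE.
rewrite !sum4 in s0.
have h0 : mu o0 = - mu o3.
  have := rhoE o0; have := rhoE o3; have := ub (rho o3); have := lb (rho o0); lia.
exists (absz (mu o0)), (absz (mu o1)), t; split.
- lia.
- exact: equivalent_trans ss1 s1t.
move=> x x0; rewrite tl //; congr diag_mx; apply/rowP; elim/ord4_ind; rewrite !mxE /weights4 /=;
 congr (x ^ _); lia.
Qed.

End SortedWeights.

(** * Graded entries and the big cell *)

Section Graded.
Variables (k : closedFieldType) (n : nat) (s : alg_hom k 2 n) (lam : 'I_n -> int).
Hypothesis sl : has_weights s lam.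

Let u := val (s (upper 1)).
Let v := val (s (lower 1)).

(** The exponent of x in an entry of a unipotent element. The rounding is harmless: an entry at
    weights of different parity is zero, by the second clause of [upper_graded] and
    [lower_graded]. *)
Definition gap (a b : int) : nat := (absz (a - b))./2.

Lemma regular_poly (c : k -> SL k 2) (p : 'I_2 -> 'I_2 -> {poly k}) (f : SL k 2 -> k) :
    (forall x i j, val (c x) i j = (p i j).[x]) -> regular f ->
  exists q : {poly k}, forall x, f (c x) = q.[x].
Proof.
move=> cp; apply: regular_curve (fun g => exists q : {poly k}, forall x, g x = q.[x]) _ _ _ _ _ _.
- by move=> a; exists a%:P => x; rewrite hornerC.
- by move=> g h [q gq] [r hr]; exists (q + r) => x; rewrite hornerD gq hr.
- by move=> g h [q gq] [r hr]; exists (q * r) => x; rewrite hornerM gq hr.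
- by move=> i j; exists (p i j) => x; rewrite cp.
Qed.

(** A nonzero coefficient of degree r forces a = b + 2 r, so at most one degree occurs. For a = b
    the polynomial is constant; evaluating it at 0 then shows that a unipotent element has the
    entries of the identity between equal weights. *)
Lemma homogeneous_monomial (p : {poly k}) (a b : int) :
    (forall t x, t != 0 -> t ^ a * p.[x] = p.[t ^+ 2 * x] * t ^ b) ->
  [/\ forall x, p.[x] = p.[1] * x ^+ gap a b,
      p.[1] != 0 -> a = b + (gap a b)%:Z *+ 2
    & a = b -> p.[1] = p.[0]].
Proof.
move=> ph.
have pr r : p`_r != 0 -> a = b + r%:Z *+ 2.
  move=> pr0; apply: (@exprz_inj_forall k) => t t0; apply: (mulIf pr0).
  have : t ^ a *: p = t ^ b *: \poly_(i < size p) (p`_i * (t ^+ 2) ^+ i).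
    apply: (@poly_eq_cofinite _ _ _ [::]) => x _.
    rewrite !hornerZ ph // mulrC horner_poly horner_coef; congr (_ * _).
    by apply: eq_bigr => i _; rewrite exprMn mulrA.
  move/(congr1 (fun q : {poly k} => q`_r)); rewrite !coefZ => ->.
  rewrite coef_poly; case: ltnP => [_|/leq_sizeP/(_ r (leqnn r)) pr00].
    rewrite expfzDr // -mulrA; congr (_ * _).
    rewrite mulrC -exprM exprnP. congr (_ ^ _ * _); lia.
  by rewrite pr00 eqxx in pr0.
have pE : p = p`_(gap a b) *: 'X^(gap a b).
  apply/polyP => r; rewrite coefZ coefXn.
  have [->|rg] := eqVneq r (gap a b); first by rewrite mulr1.
  rewrite mulr0; apply/eqP/negPn/negP => /pr ab; case/eqP: rg.
  by rewrite /gap ab; lia.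
have p1 : p.[1] = p`_(gap a b) by rewrite {1}pE hornerZ hornerXn expr1n mulr1.
split.
- by move=> x; rewrite p1 {1}pE hornerZ hornerXn.
- by rewrite p1; exact: pr.
- move=> ab; rewrite p1 {2}pE hornerZ hornerXn.
  by rewrite /gap ab subrr expr0 mulr1.
Qed.

Lemma regular_upper (f : SL k 2 -> k) : regular f ->
  exists q : {poly k}, forall x, f (upper x) = q.[x].
Proof.
apply: (@regular_poly _ (fun i j => if i == j then 1 else if i == 0 then 'X else 0)) => x i j.
rewrite !mxE; case: i => -[|[|//]] hi; case: j => -[|[|//]] hj;
by rewrite ?hornerC ?hornerX.
Qed.

Lemma regular_lower (f : SL k 2 -> k) : regular f ->
  exists q : {poly k}, forall x, f (lower x) = q.[x].
Proof.
apply: (@regular_poly _ (fun i j => if i == j then 1 else if i == 0 then 0 else 'X)) => x i j.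
rewrite !mxE; case: i => -[|[|//]] hi; case: j => -[|[|//]] hj;
by rewrite ?hornerC ?hornerX.
Qed.

Lemma torus_conj t A B : t != 0 -> (torus t * A)%g = (B * torus t)%g ->
  forall i j, t ^ lam i * val (s A) i j = val (s B) i j * t ^ lam j.
Proof.
move=> t0 /(congr1 (fun C => val (s C))); rewrite !alg_homMx sl // => e i j.
have := congr1 (fun M : 'M_n => M i j) e.
by rewrite mul_diag_mx mul_mx_diag !mxE.
Qed.

Lemma upper_graded i j :
  [/\ forall x, val (s (upper x)) i j = u i j * x ^+ gap (lam i) (lam j),
      u i j != 0 -> lam i = lam j + (gap (lam i) (lam j))%:Z *+ 2
    & lam i = lam j -> u i j = (i == j)%:R].
Proof.
have [p pE] := regular_upper (alg_hom_regular s i j).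
have [|p1 p2 p3] := @homogeneous_monomial p (lam i) (lam j).
  by move=> t x t0; rewrite -!pE; apply: torus_conj => //; exact: torus_upper.
split.
- by move=> x; rewrite /u !pE.
- by rewrite /u pE.
- by move=> /p3; rewrite /u -!pE upper0 alg_hom1 mxE.
Qed.

Lemma lower_graded i j :
  [/\ forall x, val (s (lower x)) i j = v i j * x ^+ gap (lam i) (lam j),
      v i j != 0 -> lam j = lam i + (gap (lam i) (lam j))%:Z *+ 2
    & lam i = lam j -> v i j = (i == j)%:R].
Proof.
have [p pE] := regular_lower (alg_hom_regular s i j).
(* The torus scales [lower] by the inverse square, so the two weights exchange their roles. *)
have [|p1 p2 p3] := @homogeneous_monomial p (lam j) (lam i).
  move=> t x t0; rewrite -!pE mulrC [RHS]mulrC; apply/esym.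
  by apply: torus_conj => //; exact: torus_lower.
have gC : gap (lam j) (lam i) = gap (lam i) (lam j) by rewrite /gap -opprB abszN.
rewrite gC in p1 p2; split.
- by move=> x; rewrite /v !pE.
- by rewrite /v pE.
- by move=> /esym/p3; rewrite /v -!pE lower0 alg_hom1 mxE.
Qed.

Lemma big_cell x i j : 1 + x != 0 ->
  \sum_l v i l * u l j * x ^+ gap (lam l) (lam j) =
  \sum_l u i l * v l j * x ^+ gap (lam i) (lam l)
          * (1 + x) ^ (- (lam l + gap (lam i) (lam l) + gap (lam l) (lam j))).
Proof.
move=> d0; have := congr1 (fun A => val (s A) i j) (lower_upper d0).
rewrite !alg_homMx sl ?invr_eq0 // -mulmxA mul_diag_mx !mxE => e.
transitivity (\sum_l v i l * val (s (upper x)) l j).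
  by apply: eq_bigr => l _; have [ue _ _] := upper_graded l j; rewrite ue mulrA.
rewrite e; apply: eq_bigr => l _; rewrite !mxE.
have [ue _ _] := upper_graded i l; have [ve _ _] := lower_graded l j.
rewrite ue (ve _).
rewrite exprMn !opprD !expfzDr // -!exprz_inv -!exprnP.
by ring.
Qed.

(** In a nonzero term [lam i] is [lam l] plus twice one gap and [lam j] is [lam l] plus twice the
    other. The exponent of 1 + x in [big_cell] is thus -(lam i + lam j)/2 for every l and can be
    factored out; its sign decides which side of the polynomial identity receives the power. *)
Lemma big_cell_neg i j : lam i + lam j <= 0 ->
  \sum_l (v i l * u l j) *: 'X^(gap (lam l) (lam j)) =
  (1 + 'X) ^+ (absz (lam i + lam j))./2 *
    \sum_l (u i l * v l j) *: 'X^(gap (lam i) (lam l)).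
Proof.
move=> lij; apply: (@poly_eq_cofinite _ _ _ [:: -1]) => x; rewrite inE => x1.
have d0 : 1 + x != 0 by rewrite addrC -[1]opprK subr_eq0.
rewrite hornerM !horner_exp !hornerD hornerX hornerC !horner_sum mulr_sumr.
transitivity (\sum_l v i l * u l j * x ^+ gap (lam l) (lam j)).
  by apply: eq_bigr => l _; rewrite hornerZ hornerXn.
rewrite big_cell //; apply: eq_bigr => l _; rewrite hornerZ hornerXn.
have [->|ul] := eqVneq (u i l) 0; first by rewrite !mul0r mulr0.
have [->|vl] := eqVneq (v l j) 0; first by rewrite mulr0 !mul0r mulr0.
have [_ /(_ ul) e1 _] := upper_graded i l.
have [_ /(_ vl) e2 _] := lower_graded l j.
rewrite [RHS]mulrC [(1 + x) ^+ _]exprnP; congr (_ * _ ^ _); lia.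
Qed.

Lemma big_cell_pos i j : 0 <= lam i + lam j ->
  (1 + 'X) ^+ (absz (lam i + lam j))./2 *
    (\sum_l (v i l * u l j) *: 'X^(gap (lam l) (lam j))) =
  \sum_l (u i l * v l j) *: 'X^(gap (lam i) (lam l)).
Proof.
move=> lij; apply: (@poly_eq_cofinite _ _ _ [:: -1]) => x; rewrite inE => x1.
have d0 : 1 + x != 0 by rewrite addrC -[1]opprK subr_eq0.
rewrite hornerM !horner_exp !hornerD hornerX hornerC !horner_sum.
have -> : \sum_l ((v i l * u l j) *: 'X^(gap (lam l) (lam j))).[x] =
    \sum_l v i l * u l j * x ^+ gap (lam l) (lam j).
  by apply: eq_bigr => l _; rewrite hornerZ hornerXn.
rewrite big_cell // mulr_sumr; apply: eq_bigr => l _; rewrite hornerZ hornerXn.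
have [->|ul] := eqVneq (u i l) 0; first by rewrite !mul0r mulr0.
have [->|vl] := eqVneq (v l j) 0; first by rewrite mulr0 !mul0r mulr0.
have [_ /(_ ul) e1 _] := upper_graded i l.
have [_ /(_ vl) e2 _] := lower_graded l j.
rewrite mulrCA [(1 + x) ^+ _]exprnP -expfzDr // (_ : Posz _ + _ = 0) ?expr0z ?mulr1 //; lia.
Qed.

End Graded.

(** * Relations between the extreme weights *)

Lemma coef_1DX_exp (R : comNzRingType) (M r : nat) :
  ((1 + 'X) ^+ M : {poly R})`_r = 'C(M, r)%:R.
Proof.
rewrite exprDn coef_sum.
under eq_bigr do rewrite expr1n mul1r coefMn coefXn.
have [rM|Mr] := ltnP r M.+1.
  rewrite (bigD1 (Ordinal rM)) //= eqxx big1 ?addr0 // => i ir.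
  by rewrite eq_sym -(inj_eq val_inj) /= in ir; rewrite (negPf ir) mul0rn.
rewrite bin_small // big1 // => i _.
by rewrite gtn_eqF ?mul0rn // (leq_trans (ltn_ord i)).
Qed.

Section BoundaryRelations.
Variables (k : closedFieldType) (N : nat) (s : alg_hom k 2 N) (lam : 'I_N -> int).
Hypothesis sl : has_weights s lam.
Local Notation u := (val (s (upper 1))).
Local Notation v := (val (s (lower 1))).

(** [upper] only connects a weight to smaller or equal ones, and equal weights give the entry of the
    identity. This and its three variants collapse one sum of the big cell identity to one term. *)
Lemma upper_row_min i l : (forall l, lam i <= lam l) -> u i l = (i == l)%:R.
Proof.
move=> imin; have [_ h1 h2] := upper_graded sl i l.
have [ui|ui] := eqVneq (u i l) 0; last by apply: h2; have := h1 ui; have := imin l; lia.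
by have [il|_] := eqVneq i l; rewrite ?ui //; have := h2 (congr1 lam il); rewrite ui il eqxx.
Qed.

Lemma lower_col_min l j : (forall l, lam j <= lam l) -> v l j = (l == j)%:R.
Proof.
move=> imin; have [_ h1 h2] := lower_graded sl l j.
have [ui|ui] := eqVneq (v l j) 0; last by apply: h2; have := h1 ui; have := imin l; lia.
by have [il|_] := eqVneq l j; rewrite ?ui //; have := h2 (congr1 lam il); rewrite ui il eqxx.
Qed.

Lemma upper_col_max l j : (forall l, lam l <= lam j) -> u l j = (l == j)%:R.
Proof.
move=> imin; have [_ h1 h2] := upper_graded sl l j.
have [ui|ui] := eqVneq (u l j) 0; last by apply: h2; have := h1 ui; have := imin l; lia.
by have [il|_] := eqVneq l j; rewrite ?ui //; have := h2 (congr1 lam il); rewrite ui il eqxx.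
Qed.

Lemma lower_row_max i l : (forall l, lam l <= lam i) -> v i l = (i == l)%:R.
Proof.
move=> imin; have [_ h1 h2] := lower_graded sl i l.
have [ui|ui] := eqVneq (v i l) 0; last by apply: h2; have := h1 ui; have := imin l; lia.
by have [il|_] := eqVneq i l; rewrite ?ui //; have := h2 (congr1 lam il); rewrite ui il eqxx.
Qed.

Lemma bottom_row i j : (forall l, lam i <= lam l) -> lam i + lam j <= 0 ->
  \sum_l (v i l * u l j) *: 'X^(gap (lam l) (lam j)) =
  v i j *: (1 + 'X) ^+ (absz (lam i + lam j))./2.
Proof.
move=> imin ij; rewrite (big_cell_neg sl ij) (bigD1 i) //= big1 ?addr0 => [|l li].
  by rewrite upper_row_min // eqxx mul1r /gap subrr expr0 -scalerAr mulr1.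
by rewrite upper_row_min // eq_sym (negPf li) mul0r scale0r.
Qed.

Lemma bottom_col i j : (forall l, lam j <= lam l) -> lam i + lam j <= 0 ->
  \sum_l (v i l * u l j) *: 'X^(gap (lam l) (lam j)) =
  u i j *: ((1 + 'X) ^+ (absz (lam i + lam j))./2 * 'X^(gap (lam i) (lam j))).
Proof.
move=> imin ij; rewrite (big_cell_neg sl ij) (bigD1 j) //= big1 ?addr0 => [|l li].
  by rewrite lower_col_min // eqxx mulr1 -scalerAr.
by rewrite lower_col_min // (negPf li) mulr0 scale0r.
Qed.

Lemma top_row i j : (forall l, lam l <= lam i) -> 0 <= lam i + lam j ->
  \sum_l (u i l * v l j) *: 'X^(gap (lam i) (lam l)) =
  u i j *: ((1 + 'X) ^+ (absz (lam i + lam j))./2 * 'X^(gap (lam i) (lam j))).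
Proof.
move=> imin ij; rewrite -(big_cell_pos sl ij) (bigD1 i) //= big1 ?addr0 => [|l li].
  by rewrite lower_row_max // eqxx mul1r -scalerAr.
by rewrite lower_row_max // eq_sym (negPf li) mul0r scale0r.
Qed.

Lemma top_col i j : (forall l, lam l <= lam j) -> 0 <= lam i + lam j ->
  \sum_l (u i l * v l j) *: 'X^(gap (lam i) (lam l)) =
  v i j *: (1 + 'X) ^+ (absz (lam i + lam j))./2.
Proof.
move=> imin ij; rewrite -(big_cell_pos sl ij) (bigD1 j) //= big1 ?addr0 => [|l li].
  by rewrite upper_col_max // eqxx mulr1 /gap subrr expr0 -scalerAr mulr1.
by rewrite upper_col_max // (negPf li) mulr0 scale0r.
Qed.

End BoundaryRelations.

Definition upper4 (k : fieldType) (x01 x02 x03 x12 x13 x23 : k) : 'M[k]_4 :=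
  mx_of_rows 4 4 [:: [:: 1; x01; x02; x03]; [:: 0; 1; x12; x13];
                     [:: 0; 0; 1; x23]; [:: 0; 0; 0; 1]].
Definition lower4 (k : fieldType) (x10 x20 x30 x21 x31 x32 : k) : 'M[k]_4 :=
  mx_of_rows 4 4 [:: [:: 1; 0; 0; 0]; [:: x10; 1; 0; 0];
                     [:: x20; x21; 1; 0]; [:: x30; x31; x32; 1]].

Section Four.
Variables (k : closedFieldType) (s : alg_hom k 2 4) (m n : nat).
Hypotheses (nm : (n <= m)%N) (sl : has_weights s (weights4 m n)).
Local Notation u := (val (s (upper 1))).
Local Notation v := (val (s (lower 1))).
Local Notation g := (m - n)./2.
Local Notation h := (m + n)./2.

Lemma weights4_min l : weights4 m n o3 <= weights4 m n l.
Proof. by elim/ord4_ind: l; rewrite /weights4 /=; lia. Qed.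

Lemma weights4_max l : weights4 m n l <= weights4 m n o0.
Proof. by elim/ord4_ind: l; rewrite /weights4 /=; lia. Qed.

Lemma upper_diag i : u i i = 1.
Proof. by have [_ _ /(_ erefl)] := upper_graded sl i i; rewrite eqxx. Qed.

Lemma lower_diag i : v i i = 1.
Proof. by have [_ _ /(_ erefl)] := lower_graded sl i i; rewrite eqxx. Qed.

Lemma upper_below (i j : 'I_4) : (j < i)%N -> u i j = 0.
Proof.
move=> ji; have [_ h1 h2] := upper_graded sl i j; apply/eqP/negPn/negP => uij.
have e : weights4 m n i = weights4 m n j.
  move: ji (h1 uij); elim/ord4_ind: i {h1 h2 uij} => //; elim/ord4_ind: j => // _;
  rewrite /weights4 /=; lia.
by move: uij ji; rewrite h2 //; have [->|] := eqVneq i j; rewrite ?ltnn ?eqxx.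
Qed.

Lemma lower_above (i j : 'I_4) : (i < j)%N -> v i j = 0.
Proof.
move=> ji; have [_ h1 h2] := lower_graded sl i j; apply/eqP/negPn/negP => uij.
have e : weights4 m n i = weights4 m n j.
  move: ji (h1 uij); elim/ord4_ind: i {h1 h2 uij} => //; elim/ord4_ind: j => // _;
  rewrite /weights4 /=; lia.
by move: uij ji; rewrite h2 //; have [->|] := eqVneq i j; rewrite ?ltnn ?eqxx.
Qed.

Lemma upper4E : u = upper4 (u o0 o1) (u o0 o2) (u o0 o3) (u o1 o2) (u o1 o3) (u o2 o3).
Proof.
by apply/matrixP => i j; elim/ord4_ind: i; elim/ord4_ind: j;
  rewrite [RHS]mxE /=; first [done | by rewrite upper_diag | by rewrite upper_below].
Qed.

Lemma lower4E : v = lower4 (v o1 o0) (v o2 o0) (v o3 o0) (v o2 o1) (v o3 o1) (v o3 o2).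
Proof.
by apply/matrixP => i j; elim/ord4_ind: i; elim/ord4_ind: j;
  rewrite [RHS]mxE /=; first [done | by rewrite lower_diag | by rewrite lower_above].
Qed.

Ltac weights_lia := rewrite /gap /weights4 /=; lia.

Lemma gap01 : gap (weights4 m n o0) (weights4 m n o1) = g. Proof. weights_lia. Qed.
Lemma gap02 : gap (weights4 m n o0) (weights4 m n o2) = h. Proof. weights_lia. Qed.
Lemma gap03 : gap (weights4 m n o0) (weights4 m n o3) = m. Proof. weights_lia. Qed.
Lemma gap12 : gap (weights4 m n o1) (weights4 m n o2) = n. Proof. weights_lia. Qed.
Lemma gap13 : gap (weights4 m n o1) (weights4 m n o3) = h. Proof. weights_lia. Qed.
Lemma gap23 : gap (weights4 m n o2) (weights4 m n o3) = g. Proof. weights_lia. Qed.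
Lemma gapii i : gap (weights4 m n i) (weights4 m n i) = 0%N.
Proof. by rewrite /gap subrr. Qed.
Let gaps := (gap01, gap02, gap03, gap12, gap13, gap23, gapii).

Let u10 : u o1 o0 = 0. Proof. exact: upper_below. Qed.
Let u20 : u o2 o0 = 0. Proof. exact: upper_below. Qed.
Let u30 : u o3 o0 = 0. Proof. exact: upper_below. Qed.
Let u21 : u o2 o1 = 0. Proof. exact: upper_below. Qed.
Let u31 : u o3 o1 = 0. Proof. exact: upper_below. Qed.
Let u32 : u o3 o2 = 0. Proof. exact: upper_below. Qed.
Let v01 : v o0 o1 = 0. Proof. exact: lower_above. Qed.
Let v02 : v o0 o2 = 0. Proof. exact: lower_above. Qed.
Let v03 : v o0 o3 = 0. Proof. exact: lower_above. Qed.
Let v12 : v o1 o2 = 0. Proof. exact: lower_above. Qed.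
Let v13 : v o1 o3 = 0. Proof. exact: lower_above. Qed.
Let v23 : v o2 o3 = 0. Proof. exact: lower_above. Qed.
Let zeros := (u10, u20, u30, u21, u31, u32, v01, v02, v03, v12, v13, v23,
  upper_diag, lower_diag, mulr1, mul1r, mulr0, mul0r, scale0r, addr0, add0r).

(* [relij] is the (i, j) entry of the big cell identity. *)
Lemma rel31 : (v o3 o0 * u o0 o1) *: 'X^g + v o3 o1 *: 1 = v o3 o1 *: (1 + 'X) ^+ g.
Proof.
have := @bottom_row _ _ _ _ sl o3 o1 weights4_min.
rewrite sum4 !gaps !zeros expr0 => ->; last by weights_lia.
by congr (_ *: _ ^+ _); weights_lia.
Qed.

Lemma rel32 : (v o3 o0 * u o0 o2) *: 'X^h + (v o3 o1 * u o1 o2) *: 'X^n + v o3 o2 *: 1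
  = v o3 o2 *: (1 + 'X) ^+ h.
Proof.
have := @bottom_row _ _ _ _ sl o3 o2 weights4_min.
rewrite sum4 !gaps !zeros expr0 => ->; last by weights_lia.
by congr (_ *: _ ^+ _); weights_lia.
Qed.

Lemma rel33 : (v o3 o0 * u o0 o3) *: 'X^m + (v o3 o1 * u o1 o3) *: 'X^h +
  (v o3 o2 * u o2 o3) *: 'X^g + 1 = (1 + 'X) ^+ m.
Proof.
have := @bottom_row _ _ _ _ sl o3 o3 weights4_min.
rewrite sum4 !gaps !zeros expr0 !scale1r => ->; last by weights_lia.
by congr (_ ^+ _); weights_lia.
Qed.

Lemma rel13 : (v o1 o0 * u o0 o3) *: 'X^m + u o1 o3 *: 'X^h =
  u o1 o3 *: ((1 + 'X) ^+ g * 'X^h).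
Proof.
have := @bottom_col _ _ _ _ sl o1 o3 weights4_min.
rewrite sum4 !gaps !zeros => ->; last by weights_lia.
by congr (_ *: (_ ^+ _ * _)); weights_lia.
Qed.

Lemma rel23 : (v o2 o0 * u o0 o3) *: 'X^m + (v o2 o1 * u o1 o3) *: 'X^h +
  u o2 o3 *: 'X^g = u o2 o3 *: ((1 + 'X) ^+ h * 'X^g).
Proof.
have := @bottom_col _ _ _ _ sl o2 o3 weights4_min.
rewrite sum4 !gaps !zeros => ->; last by weights_lia.
by congr (_ *: (_ ^+ _ * _)); weights_lia.
Qed.

Lemma rel01 : u o0 o1 *: 'X^g + (u o0 o2 * v o2 o1) *: 'X^h +
  (u o0 o3 * v o3 o1) *: 'X^m = u o0 o1 *: ((1 + 'X) ^+ h * 'X^g).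
Proof.
have := @top_row _ _ _ _ sl o0 o1 weights4_max.
rewrite sum4 !gaps !zeros => ->; last by weights_lia.
by congr (_ *: (_ ^+ _ * _)); weights_lia.
Qed.

Lemma rel10 : v o1 o0 *: 1 + (u o1 o2 * v o2 o0) *: 'X^n +
  (u o1 o3 * v o3 o0) *: 'X^h = v o1 o0 *: (1 + 'X) ^+ h.
Proof.
have := @top_col _ _ _ _ sl o1 o0 weights4_max.
rewrite sum4 !gaps !zeros expr0 => ->; last by weights_lia.
by congr (_ *: _ ^+ _); weights_lia.
Qed.

(** The weight -n need not be extreme, so two terms survive on the right. This relation controls the
    middle entries [u o1 o2] and [v o2 o1]. *)
Lemma rel22 : (v o2 o0 * u o0 o2) *: 'X^h + (v o2 o1 * u o1 o2) *: 'X^n + 1 =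
  (1 + 'X) ^+ n * (1 + (u o2 o3 * v o3 o2) *: 'X^g).
Proof.
have := @big_cell_neg _ _ _ _ sl o2 o2.
rewrite !sum4 !gaps !zeros expr0 !scale1r => ->; last by weights_lia.
by congr (_ ^+ _ * _); weights_lia.
Qed.

End Four.

(** * Sparse binomials modulo p *)

Section Binomials.
Variables (k : fieldType) (p : nat) (hp : p \in [pchar k]).

Let p_prime : prime p := pcharf_prime hp.

Lemma natr_neq0 (x : nat) : (x%:R != 0 :> k) = ~~ (p %| x)%N.
Proof. by rewrite (dvdn_pcharf hp). Qed.

Lemma exp_1DX_frob e M :
  (1 + 'X) ^+ (p ^ e * M) = \sum_(i < M.+1) 'X^(p ^ e * i) *+ 'C(M, i) :> {poly k}.
Proof.
rewrite exprM; have hpp : p \in [pchar {poly k}] by rewrite pchar_poly.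
rewrite exprDn_pchar; last first.
  by rewrite pnatX pnatE ?hpp.
rewrite expr1n exprDn; apply: eq_bigr => i _.
by rewrite expr1n mul1r exprM.
Qed.

(** Coefficients of (1 + X)^(q M) = (1 + X^q)^M with q = p^e; the degrees not divisible by q are
    treated next. *)
Lemma bin_pexp e M i : 'C(p ^ e * M, p ^ e * i)%:R = 'C(M, i)%:R :> k.
Proof.
rewrite -coef_1DX_exp exp_1DX_frob coef_sum.
under eq_bigr do rewrite coefMn coefXn eqn_pmul2l ?expn_gt0 ?prime_gt0 //.
have [iM|Mi] := ltnP i M.+1.
  rewrite (bigD1 (Ordinal iM)) //= eqxx big1 ?addr0 // => j ij.
  by rewrite eq_sym -(inj_eq val_inj) /= in ij; rewrite (negPf ij) mul0rn.
rewrite bin_small // big1 // => j _.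
by rewrite gtn_eqF ?mul0rn // (leq_trans (ltn_ord j)).
Qed.

Lemma bin_pexp_ndvd e M r : ~~ (p ^ e %| r)%N -> 'C(p ^ e * M, r)%:R = 0 :> k.
Proof.
move=> qr; rewrite -coef_1DX_exp exp_1DX_frob coef_sum big1 // => i _.
rewrite coefMn coefXn; case: eqP => [ri|]; last by rewrite mul0rn.
by case/negP: qr; rewrite ri dvdn_mulr.
Qed.

Lemma bin_pexp_mid e r : (0 < r < p ^ e)%N -> 'C(p ^ e, r)%:R = 0 :> k.
Proof.
move=> /andP[r0 rq]; rewrite -[(p ^ e)%N]muln1 bin_pexp_ndvd //.
by apply: contraL rq => /(dvdn_leq r0); rewrite leqNgt.
Qed.

Lemma pexp_decomp x : (0 < x)%N -> exists e y, x = (p ^ e * y)%N /\ ~~ (p %| y)%N.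
Proof.
move=> x0; have [y py ->] := pfactor_coprime p_prime x0.
by exists (logn p x), y; rewrite mulnC -prime_coprime.
Qed.

(** If x = p^e y with y prime to p and y > 1, then C(x, p^e) = y is nonzero modulo p. *)
Lemma pexp_1DX x : (0 < x)%N -> (forall r, (0 < r < x)%N -> 'C(x, r)%:R = 0 :> k) ->
  exists e, x = (p ^ e)%N.
Proof.
move=> x0 xr; have [e [y [xE py]]] := pexp_decomp x0; exists e.
have q0 : (0 < p ^ e)%N by rewrite expn_gt0 prime_gt0.
have [lt|] := ltnP (p ^ e) x; last by move: xE x0; case: y {py} => [|[|y]]; nia.
have := xr (p ^ e)%N; rewrite q0 lt => /(_ isT)/eqP.
rewrite xE -[X in 'C(_, X)]muln1 bin_pexp bin1.
by have := natr_neq0 y; rewrite py => /negPf->.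
Qed.

(** Put m = q m' with q the p-part of m. If m' > 1 then C(m, q) = m' is nonzero, hence n = m - 2 q
    and the only exponents left are 0, q, m - q and m. One further nonvanishing binomial coefficient
    then pins down m'. *)
Lemma highest_weight_cases (m n : nat) : (0 < m)%N -> (n <= m)%N ->
    (forall r, 'C(m, r)%:R != 0 :> k ->
      [\/ r = 0%N, r = m, (2 * r + n = m)%N | (2 * r = m + n)%N]) ->
  [\/ exists e, m = (p ^ e)%N,
      exists e, [/\ m = (2 * p ^ e)%N, n = 0%N & p != 2%N],
      exists e, [/\ m = (3 * p ^ e)%N, n = (p ^ e)%N & (5 <= p)%N]
    | exists e1 e2, [/\ (e1 < e2)%N, m = (p ^ e2 + p ^ e1)%N & n = (p ^ e2 - p ^ e1)%N]].
Proof.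
move=> m0 nm H; have [e [m' [mE pm']]] := pexp_decomp m0.
set q := (p ^ e)%N in mE; have q0 : (0 < q)%N by rewrite expn_gt0 prime_gt0.
have p2 := prime_gt1 p_prime.
have Cq i : 'C(m, q * i)%:R = 'C(m', i)%:R :> k by rewrite mE bin_pexp.
have [|m'2] := leqP m' 1.
  case: m' pm' mE {Cq} => [|[|//]] _ mE _; first by move: m0; rewrite mE muln0.
  by constructor 1; exists e; rewrite mE muln1.
have nE : (n + 2 * q = m)%N.
  have [||||] := H (q * 1)%N; rewrite ?Cq ?bin1 ?natr_neq0 //; nia.
have [m'E|m'3] := eqVneq m' 2%N.
  constructor 2; exists e; split; rewrite ?mE ?m'E; [lia | lia |].
  by apply: contraNneq pm' => ->; rewrite m'E.
have [pm1|pm1] := boolP (p %| m'.-1)%N; last first.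
  (* Here p divides neither m' nor m' - 1, so the exponent 2 q occurs. It has to be m - q, which
     gives m' = 3, and p >= 5 since p divides neither 3 nor 2. *)
  have C2 : 'C(m', 2)%:R != 0 :> k.
    rewrite natr_neq0; 
    have e2 : ('C(m', 2) * 2 = m' * m'.-1)%N by have := mul_bin_diag m' 1; rewrite bin1; lia.
    apply: contraNN pm1 => /(dvdn_mulr 2); rewrite e2 Euclid_dvdM //.
    by rewrite (negPf pm').
  have m'E : m' = 3%N.
    have [||||] := H (q * 2)%N; rewrite ?Cq //; nia.
  constructor 3; exists e; split; rewrite ?mE ?m'E; try nia.
  case: (p) p_prime pm1 pm' p2 => [|[|[|[|[|//]]]]] //; rewrite m'E //.
have [|f [s [sE ps]]] := @pexp_decomp m'.-1; first by lia.
set Q := (p ^ f)%N in sE; have Q0 : (0 < Q)%N by rewrite expn_gt0 prime_gt0.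
have f0 : (0 < f)%N.
  by rewrite lt0n; apply: contraNneq ps => f0; move: pm1; rewrite sE /Q f0 expn0 mul1n.
have pQ : (p %| Q)%N by rewrite dvdn_exp.
have Q2 : (1 < Q)%N by apply: leq_trans p2 (dvdn_leq Q0 pQ).
(* By Pascal's rule: C(m' - 1, Q) = s modulo p, while C(m' - 1, Q - 1) vanishes because Q divides m'
   - 1 and not Q - 1. The exponent q Q has to be m - q, so m' = Q + 1. *)
have CQ : 'C(m', Q)%:R != 0 :> k.
  have -> : 'C(m', Q) = ('C(m'.-1, Q) + 'C(m'.-1, Q.-1))%N.
    by rewrite -[in LHS](prednK (ltnW m'2)) -[in LHS](prednK Q0) binS (prednK Q0).
  have Qn : ~~ (p ^ f %| Q.-1)%N.
    have Q1 : (0 < Q.-1)%N by lia.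
    have Q1Q : (Q.-1 < Q)%N by lia.
    by rewrite -/Q gtnNdvd.
  rewrite natrD sE (bin_pexp_ndvd _ Qn) addr0.
  by rewrite -{2}[Q]muln1 bin_pexp bin1 natr_neq0.
have Qm : (Q <= m'.-1)%N.
  by rewrite sE leq_pmulr // lt0n; apply: contraNneq ps => ->.
have qI a b : (q * a = q * b)%N -> a = b by move/eqP; rewrite eqn_pmul2l // => /eqP.
have QE : Q = m'.-1.
  have [|Q00|Qm'|e3|e4] := H (q * Q)%N; rewrite ?Cq //.
  - by nia.
  - by have := qI Q m'; rewrite Qm' mE => /(_ erefl); lia.
  - by have := qI Q 1%N; rewrite muln1 => /(_ _); lia.
  - by apply: qI; have := mE; rewrite -{1}(prednK (ltnW m'2)) mulnS; lia.
constructor 4; exists e, (e + f)%N; split; first by lia.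
- by rewrite mE expnD -/q -/Q QE -[in LHS](prednK (ltnW m'2)) mulnS addnC.
- rewrite expnD -/q -/Q QE.
  have -> : (q * m'.-1 - q = q * (m' - 2))%N by rewrite -{2}[q]muln1 -mulnBr; congr muln; lia.
  have e2 : (q * m' = q * (m' - 2) + q * 2)%N by rewrite -mulnDr; congr muln; lia.
  by lia.
Qed.

End Binomials.

(** * Values of the forms *)

Section FormValues.
Variables (k : closedFieldType) (p : nat) (hp : p \in [pchar k]).

Lemma pexp_gt0 e : (0 < p ^ e)%N.
Proof. by rewrite expn_gt0 prime_gt0 // (pcharf_prime hp). Qed.

Lemma block22_rows (A B C D : 'M[k]_2) : block_mx A B C D = mx_of_rows (2 + 2) (2 + 2)
  [:: [:: A 0 0; A 0 1; B 0 0; B 0 1]; [:: A 1 0; A 1 1; B 1 0; B 1 1];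
      [:: C 0 0; C 0 1; D 0 0; D 0 1]; [:: C 1 0; C 1 1; D 1 0; D 1 1]].
Proof.
apply/matrixP => i j.
case: (split_ordP i) => i' ->; case: (split_ordP j) => j' ->;
rewrite ?block_mxEul ?block_mxEur ?block_mxEdl ?block_mxEdr !mxE;
case: i' => [[|[|[]]] //= ?]; case: j' => [[|[|[]]] //= ?];
by congr (fun_of_matrix _ _ _); apply: val_inj.
Qed.

Lemma block31_rows (rows : seq (seq k)) (D : 'M[k]_1) :
  block_mx (mx_of_rows 3 3 rows) 0 0 D = mx_of_rows (3 + 1) (3 + 1)
  (let r (i j : nat) := (nth [::] rows i)`_j in
   [:: [:: r 0%N 0%N; r 0%N 1%N; r 0%N 2%N; 0]; [:: r 1%N 0%N; r 1%N 1%N; r 1%N 2%N; 0];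
       [:: r 2%N 0%N; r 2%N 1%N; r 2%N 2%N; 0]; [:: 0; 0; 0; D 0 0]]).
Proof.
apply/matrixP => i j.
case: (split_ordP i) => i' ->; case: (split_ordP j) => j' ->;
rewrite ?block_mxEul ?block_mxEur ?block_mxEdl ?block_mxEdr !mxE;
case: i' => [[|[|[|[]]]] //= ?]; case: j' => [[|[|[|[]]]] //= ?].
by congr (fun_of_matrix _ _ _); apply: val_inj.
Qed.

Lemma has_weights_rows (s : alg_hom k 2 4) (w0 w1 w2 w3 : int) :
    (forall x, x != 0 -> val (s (torus x)) = mx_of_rows 4 4
      [:: [:: x ^ w0; 0; 0; 0]; [:: 0; x ^ w1; 0; 0];
          [:: 0; 0; x ^ w2; 0]; [:: 0; 0; 0; x ^ w3]]) ->
  has_weights s (fun i => [:: w0; w1; w2; w3]`_i).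
Proof.
move=> sE x x0; rewrite sE //; apply/matrixP => i j.
by elim/ord4_ind: i; elim/ord4_ind: j; rewrite !mxE.
Qed.

Let expr0q e : 0 ^+ (p ^ e) = 0 :> k.
Proof. by case: (p ^ e)%N (pexp_gt0 e) => // q _; rewrite exprS mul0r. Qed.
Let expr02q e : 0 ^+ (2 * p ^ e) = 0 :> k.
Proof. by rewrite mulnC exprM expr0q ?expr0n. Qed.
Let expr03q e : 0 ^+ (3 * p ^ e) = 0 :> k.
Proof. by rewrite mulnC exprM expr0q ?expr0n. Qed.

Let simp := (expr0q, expr02q, expr03q, expr1n, mulr0, mul0r, mulr1, mul1r, addr0, add0r).

Ltac entries := congr (mx_of_rows _ _ [:: [:: _; _; _; _]; [:: _; _; _; _];
  [:: _; _; _; _]; [:: _; _; _; _]]).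

Let expN (x : k) e : x^-1 ^+ e = x ^ (- (e%:Z)).
Proof. by rewrite exprVn exprnN. Qed.

Let exprP (x : k) (q : nat) : x ^+ q = x ^ q%:Z.
Proof. by []. Qed.

Ltac weights := apply: has_weights_rows => x x0; rewrite mk_alg_homE val_torus //.
Ltac monomials := rewrite ?expN ?exprP -?expfzDr //; try (congr (_ ^ _); lia).

(** For this form and [sigma_IV] the weights come in decreasing order and already determine the
    class ([simple_unique]), so their values at [upper 1] and [lower 1] are not computed. *)
Lemma sigma_I_weights e : has_weights (sigma_I hp e) (weights4 (3 * p ^ e) (p ^ e)).
Proof.
weights; rewrite /form_I !mxE /= !simp; entries; by monomials.
Qed.

Lemma sigma_II_weights p3 e : let q := (p ^ e)%N%:Z in
  has_weights (sigma_II hp p3 e) (fun i => [:: q *+ 3; - q *+ 3; q; - q]`_i).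
Proof. weights; rewrite /form_II !mxE /= !simp; entries; by monomials. Qed.

Lemma sigma_II_upper p3 e : val (sigma_II hp p3 e (upper 1)) = mx_of_rows 4 4
  [:: [:: 1; 1; 1; 2^-1]; [:: 0; 1; 0; 0]; [:: 0; 0; 1; 1]; [:: 0; 0; 0; 1]].
Proof. by rewrite mk_alg_homE /form_II !mxE /= !simp. Qed.

Lemma sigma_II_lower p3 e : val (sigma_II hp p3 e (lower 1)) = mx_of_rows 4 4
  [:: [:: 1; 0; 0; 0]; [:: 1; 1; 1; 2^-1]; [:: 0; 0; 1; 0]; [:: 0; 0; 1; 1]].
Proof. by rewrite mk_alg_homE /form_II !mxE /= !simp. Qed.

Lemma sigma_VII_weights p3 e : let q := (p ^ e)%N%:Z in
  has_weights (sigma_VII hp p3 e) (fun i => [:: q; - q; q *+ 3; - q *+ 3]`_i).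
Proof. weights; rewrite /form_VII !mxE /= !simp; entries; by monomials. Qed.

Lemma sigma_VII_upper p3 e : val (sigma_VII hp p3 e (upper 1)) = mx_of_rows 4 4
  [:: [:: 1; 1; 0; 2^-1]; [:: 0; 1; 0; 1]; [:: 0; 0; 1; 1]; [:: 0; 0; 0; 1]].
Proof. by rewrite mk_alg_homE /form_VII !mxE /= !simp. Qed.

Lemma sigma_VII_lower p3 e : val (sigma_VII hp p3 e (lower 1)) = mx_of_rows 4 4
  [:: [:: 1; 0; 2^-1; 0]; [:: 1; 1; 1; 0]; [:: 0; 0; 1; 0]; [:: 0; 0; 1; 1]].
Proof. by rewrite mk_alg_homE /form_VII !mxE /= !simp. Qed.

Lemma sigma_V_weights p2 e : let q := (p ^ e)%N%:Z in
  has_weights (sigma_V hp p2 e) (fun i => [:: 0; q *+ 2; - q *+ 2; 0]`_i).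
Proof. weights; rewrite /form_V !mxE /= !simp; entries; by monomials. Qed.

Lemma sigma_V_upper p2 e : val (sigma_V hp p2 e (upper 1)) = mx_of_rows 4 4
  [:: [:: 1; 0; 0; 0]; [:: 1; 1; 1; 0]; [:: 0; 0; 1; 0]; [:: 0; 0; 1; 1]].
Proof. by rewrite mk_alg_homE /form_V !mxE /= !simp. Qed.

Lemma sigma_V_lower p2 e : val (sigma_V hp p2 e (lower 1)) = mx_of_rows 4 4
  [:: [:: 1; 0; 0; 0]; [:: 0; 1; 0; 0]; [:: 1; 1; 1; 0]; [:: 0; 1; 0; 1]].
Proof. by rewrite mk_alg_homE /form_V !mxE /= !simp. Qed.

Lemma sigma_IX_weights e : let q := (p ^ e)%N%:Z in
  has_weights (sigma_IX hp e) (fun i => [:: q *+ 2; 0; - q *+ 2; 0]`_i).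
Proof.
weights; rewrite /form_IX /block_IX block31_rows !mxE /= !simp; entries; by monomials.
Qed.

Lemma sigma_IX_upper e : val (sigma_IX hp e (upper 1)) = mx_of_rows 4 4
  [:: [:: 1; 1; 1; 0]; [:: 0; 1; 2; 0]; [:: 0; 0; 1; 0]; [:: 0; 0; 0; 1]].
Proof. by rewrite mk_alg_homE /form_IX /block_IX block31_rows !mxE /= !simp. Qed.

Lemma sigma_IX_lower e : val (sigma_IX hp e (lower 1)) = mx_of_rows 4 4
  [:: [:: 1; 0; 0; 0]; [:: 2; 1; 0; 0]; [:: 1; 1; 1; 0]; [:: 0; 0; 0; 1]].
Proof. by rewrite mk_alg_homE /form_IX /block_IX block31_rows !mxE /= !simp. Qed.

Lemma sigma_XI_weights p2 e : let q := (p ^ e)%N%:Z in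
  has_weights (sigma_XI hp p2 e) (fun i => [:: q *+ 2; - q *+ 2; 0; 0]`_i).
Proof.
weights; rewrite /form_XI /block_XI block31_rows !mxE /= !simp; entries; by monomials.
Qed.

Lemma sigma_XI_upper p2 e : val (sigma_XI hp p2 e (upper 1)) = mx_of_rows 4 4
  [:: [:: 1; 1; 1; 0]; [:: 0; 1; 0; 0]; [:: 0; 0; 1; 0]; [:: 0; 0; 0; 1]].
Proof. by rewrite mk_alg_homE /form_XI /block_XI block31_rows !mxE /= !simp. Qed.

Lemma sigma_XI_lower p2 e : val (sigma_XI hp p2 e (lower 1)) = mx_of_rows 4 4
  [:: [:: 1; 0; 0; 0]; [:: 1; 1; 1; 0]; [:: 0; 0; 1; 0]; [:: 0; 0; 0; 1]].
Proof. by rewrite mk_alg_homE /form_XI /block_XI block31_rows !mxE /= !simp. Qed.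

Lemma sigma_XIX_weights p2 e : let q := (p ^ e)%N%:Z in
  has_weights (sigma_XIX hp p2 e) (fun i => [:: q *+ 2; - q *+ 2; 0; 0]`_i).
Proof.
weights; rewrite /form_XIX /block_XIX block31_rows !mxE /= !simp; entries; by monomials.
Qed.

Lemma sigma_XIX_upper p2 e : val (sigma_XIX hp p2 e (upper 1)) = mx_of_rows 4 4
  [:: [:: 1; 1; 0; 0]; [:: 0; 1; 0; 0]; [:: 0; 1; 1; 0]; [:: 0; 0; 0; 1]].
Proof. by rewrite mk_alg_homE /form_XIX /block_XIX block31_rows !mxE /= !simp. Qed.

Lemma sigma_XIX_lower p2 e : val (sigma_XIX hp p2 e (lower 1)) = mx_of_rows 4 4
  [:: [:: 1; 0; 0; 0]; [:: 1; 1; 0; 0]; [:: 1; 0; 1; 0]; [:: 0; 0; 0; 1]].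
Proof. by rewrite mk_alg_homE /form_XIX /block_XIX block31_rows !mxE /= !simp. Qed.

Lemma sigma_XV_weights e2 e3 : let q2 := (p ^ e2)%N%:Z in let q3 := (p ^ e3)%N%:Z in
  has_weights (sigma_XV hp (e2, e3)) (fun i => [:: q2; - q2; q3; - q3]`_i).
Proof.
weights; rewrite /form_XV block22_rows !mxE /= !simp; entries; by monomials.
Qed.

Lemma sigma_XV_upper e2 e3 : val (sigma_XV hp (e2, e3) (upper 1)) = mx_of_rows 4 4
  [:: [:: 1; 1; 0; 0]; [:: 0; 1; 0; 0]; [:: 0; 0; 1; 1]; [:: 0; 0; 0; 1]].
Proof. by rewrite mk_alg_homE /form_XV block22_rows !mxE /= !simp. Qed.

Lemma sigma_XV_lower e2 e3 : val (sigma_XV hp (e2, e3) (lower 1)) = mx_of_rows 4 4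
  [:: [:: 1; 0; 0; 0]; [:: 1; 1; 0; 0]; [:: 0; 0; 1; 0]; [:: 0; 0; 1; 1]].
Proof. by rewrite mk_alg_homE /form_XV block22_rows !mxE /= !simp. Qed.

Lemma sigma_XXIV_weights e : let q := (p ^ e)%N%:Z in
  has_weights (sigma_XXIV hp e) (fun i => [:: q; - q; 0; 0]`_i).
Proof.
weights; rewrite /form_XXIV block22_rows !mxE /= !simp; entries; by monomials.
Qed.

Lemma sigma_XXIV_upper e : val (sigma_XXIV hp e (upper 1)) = mx_of_rows 4 4
  [:: [:: 1; 1; 0; 0]; [:: 0; 1; 0; 0]; [:: 0; 0; 1; 0]; [:: 0; 0; 0; 1]].
Proof. by rewrite mk_alg_homE /form_XXIV block22_rows !mxE /= !simp. Qed.

Lemma sigma_XXIV_lower e : val (sigma_XXIV hp e (lower 1)) = mx_of_rows 4 4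
  [:: [:: 1; 0; 0; 0]; [:: 1; 1; 0; 0]; [:: 0; 0; 1; 0]; [:: 0; 0; 0; 1]].
Proof. by rewrite mk_alg_homE /form_XXIV block22_rows !mxE /= !simp. Qed.

Lemma sigma_IV_weights e1 e2 : (e1 < e2)%N ->
  has_weights (sigma_IV hp (e1, e2)) (weights4 (p ^ e2 + p ^ e1) (p ^ e2 - p ^ e1)).
Proof.
move=> e12; have q12 : (p ^ e1 <= p ^ e2)%N.
  by rewrite leq_pexp2l ?(ltnW e12) ?prime_gt0 // (pcharf_prime hp).
weights; rewrite /form_IV block22_rows !mxE /= !simp; entries; by monomials.
Qed.

Lemma sigma_XXVI_weights : has_weights (sigma_XXVI k) (weights4 0 0).
Proof.
weights; rewrite /form_XXVI; apply/matrixP => i j; rewrite !mxE.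
by elim/ord4_ind: i; elim/ord4_ind: j.
Qed.

End FormValues.

Section Intertwiner4.
Variables (k : closedFieldType) (s t : alg_hom k 2 4) (lam mu : 'I_4 -> int) (Q : 'M[k]_4).
Hypotheses (sl : has_weights s lam) (tm : has_weights t mu).

Lemma torus_intertwiner : (forall i j, Q i j != 0 -> lam i = mu j) ->
  forall x, x != 0 -> val (s (torus x)) *m Q = Q *m val (t (torus x)).
Proof.
move=> Qlm x x0; rewrite sl // tm //; apply/matrixP => i j.
rewrite mul_diag_mx mul_mx_diag !mxE mulrC.
by have [->|/Qlm ->] := eqVneq (Q i j) 0; rewrite ?mul0r.
Qed.

End Intertwiner4.

(** * Coefficients of the big cell relations *)

Section Relations.
Variables (k : closedFieldType) (s : alg_hom k 2 4) (m n g : nat).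
Hypotheses (mE : m = (n + 2 * g)%N) (g0 : (0 < g)%N) (sl : has_weights s (weights4 m n)).
Local Notation u := (val (s (upper 1))).
Local Notation v := (val (s (lower 1))).
Local Notation h := (n + g)%N.

Let nm : (n <= m)%N. Proof. by lia. Qed.
Let gE : (m - n)./2 = g. Proof. by lia. Qed.
Let hE : (m + n)./2 = h. Proof. by lia. Qed.

Let coefs := (gE, hE, coefD, coefZ, coefXn, coef1, coef_1DX_exp, coefMXn, binn).

Ltac nats := repeat match goal with
  | |- context [if ?b then _ else _] =>
      first [rewrite (_ : b = false); last lia | rewrite (_ : b = true); last lia]
  | |- context [GRing.natmul 1 (nat_of_bool ?b)] =>
      first [rewrite (_ : b = false); last lia | rewrite (_ : b = true); last lia]
  end; rewrite /= ?mulr0 ?mulr1 ?addr0 ?add0r.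

Ltac coef_of rel r := have := congr1 (fun P : {poly k} => P`_r) rel;
  rewrite !coefs; nats.

(** This and the next relations are single coefficients of the [rel] identities. The condition g > 0
    keeps m apart from the smaller exponents, and n > 0, where assumed, separates n from 0 or g from
    h. *)
Lemma rel_v30u03 : v o3 o0 * u o0 o3 = 1.
Proof. by coef_of (rel33 nm sl) m. Qed.

Lemma rel_v31 : v o3 o1 = v o3 o0 * u o0 o1.
Proof. by coef_of (rel31 nm sl) g. Qed.

Lemma rel_v32 : v o3 o2 = v o3 o0 * u o0 o2.
Proof. by coef_of (rel32 nm sl) (n + g)%N. Qed.

Lemma rel_u13 : u o1 o3 = v o1 o0 * u o0 o3.
Proof. by coef_of (rel13 nm sl) m; rewrite (_ : m - h = g)%N ?binn ?mulr1 //; lia. Qed.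

Lemma rel_u23 : u o2 o3 = v o2 o0 * u o0 o3.
Proof. by coef_of (rel23 nm sl) m; rewrite (_ : m - g = h)%N ?binn ?mulr1 //; lia. Qed.

Lemma rel_v31u12 : (0 < n)%N -> v o3 o1 * u o1 o2 = v o3 o2 * 'C(h, n)%:R.
Proof. by move=> n0; coef_of (rel32 nm sl) n. Qed.

Lemma rel_v21u13 : (0 < n)%N -> v o2 o1 * u o1 o3 = u o2 o3 * 'C(h, n)%:R.
Proof. by move=> n0; coef_of (rel23 nm sl) (n + g)%N; rewrite addnK. Qed.

Lemma rel_u02v21 : (0 < n)%N -> u o0 o2 * v o2 o1 = u o0 o1 * 'C(h, n)%:R.
Proof. by move=> n0; coef_of (rel01 nm sl) (n + g)%N; rewrite addnK. Qed.

Lemma rel_u12v20 : (0 < n)%N -> u o1 o2 * v o2 o0 = v o1 o0 * 'C(h, n)%:R.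
Proof. by move=> n0; coef_of (rel10 nm sl) n. Qed.

Lemma rel_v31u13 : (0 < n)%N -> v o3 o1 * u o1 o3 = 'C(m, h)%:R.
Proof. by move=> n0; coef_of (rel33 nm sl) (n + g)%N. Qed.

Lemma rel_v32u23 : (0 < n)%N -> v o3 o2 * u o2 o3 = 'C(m, g)%:R.
Proof. by move=> n0; coef_of (rel33 nm sl) g. Qed.

Lemma rel_middle : n = 0%N -> v o3 o1 * u o1 o3 + v o3 o2 * u o2 o3 = 'C(m, g)%:R.
Proof. by move=> n0; coef_of (rel33 nm sl) g. Qed.

End Relations.

Section Parity.
Variables (k : closedFieldType) (s : alg_hom k 2 4) (m n : nat).
Hypotheses (nm : (n <= m)%N) (sl : has_weights s (weights4 m n)).
Local Notation u := (val (s (upper 1))).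
Local Notation v := (val (s (lower 1))).

Lemma upper_parity i j : u i j != 0 ->
  weights4 m n i = weights4 m n j + (gap (weights4 m n i) (weights4 m n j))%:Z *+ 2.
Proof. by have [_ h _] := upper_graded sl i j. Qed.

Lemma lower_parity i j : v i j != 0 ->
  weights4 m n j = weights4 m n i + (gap (weights4 m n i) (weights4 m n j))%:Z *+ 2.
Proof. by have [_ h _] := lower_graded sl i j. Qed.

Lemma odd_gap_upper i j : odd (absz (weights4 m n i - weights4 m n j)) -> u i j = 0.
Proof.
by move=> o; apply/eqP/negPn/negP => /upper_parity; move: o; rewrite /gap; lia.
Qed.

Lemma odd_gap_lower i j : odd (absz (weights4 m n i - weights4 m n j)) -> v i j = 0.
Proof.
by move=> o; apply/eqP/negPn/negP => /lower_parity; move: o; rewrite /gap; lia.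
Qed.

(** By [rel33] the power (1 + X)^m involves only the exponents 0, m, (m + n)/2 and (m - n)/2; a
    middle one that occurs comes from a nonzero entry, so the halving is exact. *)
Lemma weight_binomials (p : nat) (hp : p \in [pchar k]) : (0 < m)%N ->
  forall r, 'C(m, r)%:R != 0 :> k ->
      [\/ r = 0%N, r = m, (2 * r + n = m)%N | (2 * r = m + n)%N].
Proof.
move=> m0 r; rewrite -coef_1DX_exp -(rel33 nm sl) !(coefD, coefZ, coefXn, coef1).
have [->|r0] := eqVneq r 0%N; first by constructor 1.
have [->|rm] := eqVneq r m; first by constructor 2.
rewrite mulr0 addr0 add0r => nz.
have /orP[/andP[u13 rh]|/andP[u23 rg]] :
    (u o1 o3 != 0) && (r == (m + n)./2) || (u o2 o3 != 0) && (r == (m - n)./2).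
  apply: contraNT nz; rewrite negb_or !negb_and !negbK => /andP[].
  by do 2![case/orP => [/eqP->|/negPf->]]; rewrite ?(mulr0, mul0r, addr0).
- by constructor 4; have := upper_parity u13; rewrite /gap /weights4 /=; lia.
- by constructor 3; have := upper_parity u23; rewrite /gap /weights4 /=; lia.
Qed.

End Parity.

(** * Explicit intertwiners *)

Ltac entries4 := congr (mx_of_rows _ _ [:: [:: _; _; _; _]; [:: _; _; _; _];
  [:: _; _; _; _]; [:: _; _; _; _]]).

Section Cases.
Variables (k : closedFieldType) (p : nat) (hp : p \in [pchar k]).
Variables (s : alg_hom k 2 4).
Local Notation U := (val (s (upper 1))).
Local Notation V := (val (s (lower 1))).

(** Column j of [Q] is a weight vector on which [s] acts as [t] acts on the j-th basis vector. *)
Lemma equivalent_rows (t : alg_hom k 2 4) (lam mu : 'I_4 -> int) (Q : 'M[k]_4) :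
    has_weights s lam -> has_weights t mu ->
    (forall i j, Q i j != 0 -> lam i = mu j) ->
    U *m Q = Q *m val (t (upper 1)) -> V *m Q = Q *m val (t (lower 1)) ->
    \det Q != 0 ->
  equivalent t s.
Proof.
move=> sl tm Qw QU QV Q0; apply: equivalent_sym.
apply: (@equivalent_intertwiner _ _ _ _ Q) => //; first by rewrite unitmxE unitfE.
exact: torus_intertwiner Qw.
Qed.

Section Normal.
Variables (m n : nat) (a1 a2 d1 d2 x y mu nu : k).
Hypotheses (sl : has_weights s (weights4 m n)) (yx : y * x = 1)
  (UE : U = upper4 a1 a2 x mu (d1 * x) (d2 * x))
  (VE : V = lower4 d1 d2 y nu (y * a1) (y * a2)).

Let y0 : y != 0.
Proof. by apply: contraTneq isT => y0; have := yx; rewrite y0 mul0r => /eqP; rewrite eq_sym oner_eq0. Qed.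

Ltac weights_match := let i := fresh "i" in let j := fresh "j" in
  move=> i j; elim/ord4_ind: i; elim/ord4_ind: j; rewrite !mxE /= ?eqxx //;
  rewrite /weights4 /=; lia.
Ltac products := rewrite ?UE ?VE /upper4 /lower4 !mul_rows4 /=; entries4.

Ltac det_is e := match goal with |- is_true (?L != 0) =>
  let E := fresh in enough (E : L = e); [rewrite E {E} | rewrite det_rows4] end.

Lemma case_XXIV e : m = (p ^ e)%N -> n = 0%N -> a1 = 0 -> a2 = 0 -> d1 = 0 -> d2 = 0 ->
  mu = 0 -> nu = 0 -> equivalent (sigma_XXIV hp e) s.
Proof.
move=> mE n0 a10 a20 d10 d20 mu0 nu0.
(* The columns are e0, y e3, e1, e2. The factor y is needed because U e3 = e3 + x e0 and y x = 1. *)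
apply: (equivalent_rows (Q := mx_of_rows 4 4
  [:: [:: 1; 0; 0; 0]; [:: 0; 0; 1; 0]; [:: 0; 0; 0; 1]; [:: 0; y; 0; 0]])
  sl (sigma_XXIV_weights hp e)).
- weights_match.
- rewrite sigma_XXIV_upper; products; rewrite ?a10 ?a20 ?d10 ?d20 ?mu0 ?nu0; ring: yx.
- rewrite sigma_XXIV_lower; products; rewrite ?a10 ?a20 ?d10 ?d20 ?mu0 ?nu0; ring: yx.
- det_is (y); [by rewrite // | by ring].
Qed.

Lemma case_IX e : p != 2%N -> m = (2 * p ^ e)%N -> n = 0%N -> a1 * d1 + a2 * d2 = 2 ->
  mu = 0 -> nu = 0 -> equivalent (sigma_IX hp e) s.
Proof.
move=> p2 mE n0 ad mu0 nu0.
have h2 : (2 : k) != 0.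
  by rewrite -(dvdn_pcharf hp) dvdn_prime2 // (pcharf_prime hp).
have {}ad : a1 * d1 = 2 - a2 * d2 by rewrite -ad addrK.
(* The weight 0 plane splits into the line of (d1, d2), reached from e0 by V, and the kernel of (a1,
   a2), a trivial summand. They are independent since a1 d1 + a2 d2 = 2 is not 0. *)
apply: (equivalent_rows (Q := mx_of_rows 4 4
  [:: [:: 2; 0; 0; 0]; [:: 0; d1; 0; a2]; [:: 0; d2; 0; - a1]; [:: 0; 0; 2 * y; 0]])
  sl (sigma_IX_weights hp e)).
- weights_match.
- rewrite sigma_IX_upper; products; rewrite ?mu0 ?nu0; ring: yx ad.
- rewrite sigma_IX_lower; products; rewrite ?mu0 ?nu0; ring: yx ad.
- det_is (2 ^+ 3 * y); [by rewrite mulf_neq0 ?expf_neq0 | by ring: ad].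
Qed.

Lemma case_XI (p2 : p = 2%N) e : m = (2 * p ^ e)%N -> n = 0%N -> (a1 != 0) || (a2 != 0) ->
  d1 = 0 -> d2 = 0 -> mu = 0 -> nu = 0 -> equivalent (sigma_XI hp p2 e) s.
Proof.
move=> mE n0 a0 d10 d20 mu0 nu0.
have [w1 [w2 aw]] : exists w1 w2, a1 * w1 + a2 * w2 = 1.
  by case/orP: a0 => a0; [exists a1^-1, 0 | exists 0, a2^-1];
    rewrite mulfV // mulr0 ?addr0 ?add0r.
have {}aw : a1 * w1 = 1 - a2 * w2 by rewrite -aw addrK.
(* The kernel of (a1, a2) is the trivial summand; (w1, w2) is a complement on which the functional
   takes the value 1. *)
apply: (equivalent_rows (Q := mx_of_rows 4 4
  [:: [:: 1; 0; 0; 0]; [:: 0; 0; w1; a2]; [:: 0; 0; w2; - a1]; [:: 0; y; 0; 0]])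
  sl (sigma_XI_weights hp p2 e)).
- weights_match.
- rewrite sigma_XI_upper; products; rewrite ?d10 ?d20 ?mu0 ?nu0; ring: yx aw.
- rewrite sigma_XI_lower; products; rewrite ?d10 ?d20 ?mu0 ?nu0; ring: yx aw.
- det_is (- y); [by rewrite ?oppr_eq0 // | by ring: aw].
Qed.

Lemma case_XIX (p2 : p = 2%N) e : m = (2 * p ^ e)%N -> n = 0%N -> (d1 != 0) || (d2 != 0) ->
  a1 = 0 -> a2 = 0 -> mu = 0 -> nu = 0 -> equivalent (sigma_XIX hp p2 e) s.
Proof.
move=> mE n0 d0 a10 a20 mu0 nu0.
have [w1 [w2 dw]] : exists w1 w2, d1 * w1 + d2 * w2 = 1.
  by case/orP: d0 => d0; [exists d1^-1, 0 | exists 0, d2^-1];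
    rewrite mulfV // mulr0 ?addr0 ?add0r.
have {}dw : d1 * w1 = 1 - d2 * w2 by rewrite -dw addrK.
(* Now every vector of weight 0 is fixed; (d1, d2) is the one reached from e0 and (-w2, w1) is any
   complement. *)
apply: (equivalent_rows (Q := mx_of_rows 4 4
  [:: [:: 1; 0; 0; 0]; [:: 0; 0; d1; - w2]; [:: 0; 0; d2; w1]; [:: 0; y; 0; 0]])
  sl (sigma_XIX_weights hp p2 e)).
- weights_match.
- rewrite sigma_XIX_upper; products; rewrite ?a10 ?a20 ?mu0 ?nu0; ring: yx dw.
- rewrite sigma_XIX_lower; products; rewrite ?a10 ?a20 ?mu0 ?nu0; ring: yx dw.
- det_is (y); [by rewrite // | by ring: dw].
Qed.

Lemma case_V (p2 : p = 2%N) e : m = (2 * p ^ e)%N -> n = 0%N ->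
  (a1 != 0) || (a2 != 0) -> (d1 != 0) || (d2 != 0) -> a1 * d1 + a2 * d2 = 0 ->
  mu = 0 -> nu = 0 -> equivalent (sigma_V hp p2 e) s.
Proof.
move=> mE n0 a0 d0 ad mu0 nu0.
have [w1 [w2 aw]] : exists w1 w2, a1 * w1 + a2 * w2 = 1.
  by case/orP: a0 => a0; [exists a1^-1, 0 | exists 0, a2^-1];
    rewrite mulfV // mulr0 ?addr0 ?add0r.
have wd0 : w1 * d2 - w2 * d1 != 0.
  apply: contraTN d0 => /eqP wd.
  have -> : d1 = 0.
    transitivity (d1 * (a1 * w1 + a2 * w2)); first by rewrite aw mulr1.
    transitivity (w1 * (a1 * d1 + a2 * d2) - a2 * (w1 * d2 - w2 * d1)); first by ring.
    by rewrite ad wd !mulr0 subr0.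
  have -> : d2 = 0.
    transitivity (d2 * (a1 * w1 + a2 * w2)); first by rewrite aw mulr1.
    transitivity (w2 * (a1 * d1 + a2 * d2) + a1 * (w1 * d2 - w2 * d1)); first by ring.
    by rewrite ad wd !mulr0 addr0.
  by rewrite eqxx.
have {}aw : a1 * w1 = 1 - a2 * w2 by rewrite -aw addrK.
have {}ad : a1 * d1 = - (a2 * d2) by apply/eqP; rewrite -addr_eq0 ad.
(* Here (d1, d2) spans the kernel of (a1, a2), and (w1, w2), on which this functional is 1,
   completes it to a basis of the weight 0 plane. *)
apply: (equivalent_rows (Q := mx_of_rows 4 4
  [:: [:: 0; 1; 0; 0]; [:: w1; 0; 0; d1]; [:: w2; 0; 0; d2]; [:: 0; 0; y; 0]])
  sl (sigma_V_weights hp p2 e)).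
- weights_match.
- rewrite sigma_V_upper; products; rewrite ?mu0 ?nu0; first [by ring: ad | by ring: yx aw].
- rewrite sigma_V_lower; products; rewrite ?mu0 ?nu0; first [by ring: ad | by ring: yx aw].
- det_is (y * (w1 * d2 - w2 * d1)); [by rewrite ?mulf_neq0 // | by ring].
Qed.

Lemma case_XV e e' : m = (p ^ e)%N -> n = (p ^ e')%N -> a1 = 0 -> a2 = 0 -> d1 = 0 -> d2 = 0 ->
  mu * nu = 1 -> equivalent (sigma_XV hp (e, e')) s.
Proof.
move=> mE nE a10 a20 d10 d20 munu.
have mu0 : mu != 0 by apply: contra_eq_neq munu => ->; rewrite mul0r eq_sym oner_neq0.
apply: (equivalent_rows (Q := mx_of_rows 4 4
  [:: [:: 1; 0; 0; 0]; [:: 0; 0; mu; 0]; [:: 0; 0; 0; 1]; [:: 0; y; 0; 0]])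
  sl (sigma_XV_weights hp e e')).
- weights_match.
- rewrite sigma_XV_upper; products; rewrite ?a10 ?a20 ?d10 ?d20; ring: yx munu.
- rewrite sigma_XV_lower; products; rewrite ?a10 ?a20 ?d10 ?d20; ring: yx munu.
- det_is (y * mu); [by rewrite ?mulf_neq0 // | by ring].
Qed.

Lemma case_II (p3 : p = 3%N) e : m = (3 * p ^ e)%N -> n = (p ^ e)%N -> a2 != 0 ->
  d1 = 0 -> d2 = 0 -> mu * nu = 1 -> a1 * mu = - a2 -> equivalent (sigma_II hp p3 e) s.
Proof.
move=> mE nE a20 d10 d20 munu amu.
have half : 2^-1 = -1 :> k by apply: half_char3; exact: (eq0_pchar hp p3).
have mu0 : mu != 0 by apply: contra_eq_neq munu => ->; rewrite mul0r eq_sym oner_neq0.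
(* As d1 = d2 = 0, e0 and e3 span a submodule. The scalars are fixed by U (mu e1) = mu e1 - a2 e0,
   and 2^-1 = -1 accounts for the coefficient in U e2. *)
apply: (equivalent_rows (Q := mx_of_rows 4 4
  [:: [:: - a2; 0; 0; 0]; [:: 0; 0; mu; 0]; [:: 0; 0; 0; 1]; [:: 0; - a2 * y; 0; 0]])
  sl (sigma_II_weights hp p3 e)).
- weights_match.
- rewrite sigma_II_upper; products; rewrite ?d10 ?d20 ?half; first [by ring: yx munu | by ring: yx amu].
- rewrite sigma_II_lower; products; rewrite ?d10 ?d20 ?half; first [by ring: yx munu | by ring: yx amu].
- det_is (a2 ^+ 2 * y * mu); [by rewrite ?mulf_neq0 ?expf_neq0 // | by ring].
Qed.

Lemma case_VII (p3 : p = 3%N) e : m = (3 * p ^ e)%N -> n = (p ^ e)%N -> d1 != 0 -> d2 != 0 ->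
  a1 = 0 -> a2 = 0 -> nu * d1 = - d2 -> mu * d2 = - d1 -> mu * nu = 1 ->
  equivalent (sigma_VII hp p3 e) s.
Proof.
move=> mE nE d10 d20 a10 a20 nud mud munu.
have half : 2^-1 = -1 :> k by apply: half_char3; exact: (eq0_pchar hp p3).
(* As a1 = a2 = 0, e1 and e2 span a submodule. The scalars are read off V e0 = e0 + d1 e1 + d2 e2 +
   y e3, the sign of d1 coming from 2^-1 = -1. *)
apply: (equivalent_rows (Q := mx_of_rows 4 4
  [:: [:: 0; 0; 1; 0]; [:: - d1; 0; 0; 0]; [:: 0; d2; 0; 0]; [:: 0; 0; 0; y]])
  sl (sigma_VII_weights hp p3 e)).
- weights_match.
- rewrite sigma_VII_upper; products; rewrite ?a10 ?a20 ?half; first [by ring: yx nud | by ring: yx mud].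
- rewrite sigma_VII_lower; products; rewrite ?a10 ?a20 ?half; first [by ring: yx nud | by ring: yx mud].
- det_is (- (d1 * d2 * y)); [by rewrite ?oppr_eq0 ?mulf_neq0 // | by ring].
Qed.

End Normal.
End Cases.

(** * Simple and isotypic modules *)

Section Simple.
Variable k : closedFieldType.

(** When the two binomial coefficients are nonzero, so is the whole last row of [lower 1]. Rescaling
    the basis by it makes this row constant 1, and the relations then express every other entry by
    binomial coefficients of the weights alone. *)
Lemma simple_normal (s : alg_hom k 2 4) (m n g : nat) : (0 < n)%N -> (0 < g)%N ->
    m = (n + 2 * g)%N -> has_weights s (weights4 m n) ->
    'C(m, g)%:R != 0 :> k -> 'C(m, n + g)%:R != 0 :> k ->
  let cn : k := 'C(n + g, n)%:R in
  let cg : k := 'C(m, g)%:R in let ch : k := 'C(m, n + g)%:R in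
  exists D : 'M[k]_4, [/\ \det D != 0, forall i j, D i j != 0 -> i = j,
    D *m val (s (upper 1)) = upper4 1 1 1 cn ch cg *m D
  & D *m val (s (lower 1)) = lower4 ch cg 1 (cg * cn / ch) 1 1 *m D].
Proof.
move=> n0 g0 mE sl cg0 ch0 cn cg ch.
have nm : (n <= m)%N by lia.
rewrite (upper4E nm sl) (lower4E nm sl).
have := rel_v30u03 mE g0 sl; have := rel_v31 mE g0 sl; have := rel_v32 mE g0 sl.
have := rel_u13 mE g0 sl; have := rel_u23 mE g0 sl.
have := rel_v31u12 mE g0 sl n0; have := rel_v21u13 mE g0 sl n0.
have := rel_v31u13 mE g0 sl n0; have := rel_v32u23 mE g0 sl n0.
rewrite -/cn -/cg -/ch.
move: (val (s (upper 1))) (val (s (lower 1))) => u v.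
move: (u o0 o1) (u o0 o2) (u o0 o3) (u o1 o2) (u o1 o3) (u o2 o3) => u01 u02 u03 u12 u13 u23.
move: (v o1 o0) (v o2 o0) (v o3 o0) (v o2 o1) (v o3 o1) (v o3 o2) => v10 v20 v30 v21 v31 v32.
move=> e9 e8 e7 e6 e5 e4 e3 e2 e1.
have v310 : v31 != 0 by apply: contraNneq ch0 => v310; rewrite -/ch -e8 v310 mul0r.
have v320 : v32 != 0 by apply: contraNneq cg0 => v320; rewrite -/cg -e9 v320 mul0r.
have v300 : v30 != 0 by apply: contra_eq_neq e1 => ->; rewrite mul0r eq_sym oner_neq0.
exists (mx_of_rows 4 4 [:: [:: v30; 0; 0; 0]; [:: 0; v31; 0; 0]; [:: 0; 0; v32; 0]; [:: 0; 0; 0; 1]]).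
split.
- rewrite det_rows4.
  suff -> : forall a b c : k, a * (b * (c * 1 - 0 * 0) - 0 * (0 * 1 - 0 * 0) + 0 * (0 * 0 - c * 0))
    - 0 * (0 * (c * 1 - 0 * 0) - 0 * (0 * 1 - 0 * 0) + 0 * (0 * 0 - c * 0))
    + 0 * (0 * (0 * 1 - 0 * 0) - b * (0 * 1 - 0 * 0) + 0 * (0 * 0 - 0 * 0))
    - 0 * (0 * (0 * 0 - c * 0) - b * (0 * 0 - c * 0) + 0 * (0 * 0 - 0 * 0)) = a * b * c.
    by rewrite !mulf_neq0.
  by move=> *; ring.
- by move=> i j; elim/ord4_ind: i; elim/ord4_ind: j; rewrite mxE /= ?eqxx.
- rewrite /upper4 !mul_rows4 /=; entries4; try ring.
  + by rewrite e2; ring.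
  + by rewrite e3; ring.
  + by rewrite e1; ring.
  + by ring: e6.
  + by ring: e8.
  + by ring: e9.
- have v10E : v10 = v30 * u13 by rewrite e4 mulrCA e1 mulr1.
  have v20E : v20 = v30 * u23 by rewrite e5 mulrCA e1 mulr1.
  rewrite /lower4 !mul_rows4 /=; entries4; try ring.
  + by rewrite v10E; ring: e8.
  + by rewrite v20E; ring: e9.
  + have v21E : v32 * v21 = cg * cn / ch * v31; last by ring: v21E.
    have ch1 : ch != 0 := ch0.
    apply: (mulIf ch1); rewrite [RHS]mulrAC (mulfVK ch1) -{1}e8 -e9.
    transitivity (v32 * v31 * (v21 * u13)); first by ring.
    by rewrite e7; ring.
Qed.

Lemma simple_unique (s t : alg_hom k 2 4) (m n g : nat) : (0 < n)%N -> (0 < g)%N ->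
    m = (n + 2 * g)%N -> has_weights s (weights4 m n) -> has_weights t (weights4 m n) ->
    'C(m, g)%:R != 0 :> k -> 'C(m, n + g)%:R != 0 :> k ->
  equivalent s t.
Proof.
move=> n0 g0 mE sl tl cg0 ch0.
have [D [D0 Dd Du Dv]] := simple_normal n0 g0 mE sl cg0 ch0.
have [E [E0 Ed Eu Ev]] := simple_normal n0 g0 mE tl cg0 ch0.
have DU : D \in unitmx by rewrite unitmxE unitfE.
have EU : E \in unitmx by rewrite unitmxE unitfE.
have comm (M : 'M[k]_4) : (forall i j, M i j != 0 -> i = j) -> forall x : k,
    diag_mx (\row_i x ^ weights4 m n i) *m M = M *m diag_mx (\row_i x ^ weights4 m n i).
  move=> Md x; apply/matrixP => i j; rewrite mul_diag_mx mul_mx_diag !mxE mulrC.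
  by have [->|/Md ->] := eqVneq (M i j) 0; rewrite ?mul0r.
have inter (A B X : 'M[k]_4) : D *m A = X *m D -> E *m B = X *m E ->
    A *m (invmx D *m E) = invmx D *m E *m B.
  move=> DA EB; rewrite -[RHS]mulmxA EB -[A](mulKmx DU) DA !mulmxA.
  by rewrite mulmxK.
apply: (@equivalent_intertwiner _ _ _ _ (invmx D *m E)).
- by rewrite unitmx_mul unitmx_inv DU.
- by move=> x x0; rewrite sl // tl //; apply: inter; apply/esym; apply: comm.
- exact: inter Du Eu.
- exact: inter Dv Ev.
Qed.

End Simple.

(** * Two coinciding top weights and the trivial module *)

Section Degenerate.
Variables (k : closedFieldType) (p : nat) (hp : p \in [pchar k]) (s : alg_hom k 2 4).
Local Notation u := (val (s (upper 1))).
Local Notation v := (val (s (lower 1))).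

Lemma case_XXVI : has_weights s (weights4 0 0) -> equivalent (sigma_XXVI k) s.
Proof.
move=> sl; have w0 i j : weights4 0 0 i = weights4 0 0 j.
  by elim/ord4_ind: i; elim/ord4_ind: j.
have u1 : u = 1%:M.
  by apply/matrixP => i j; have [_ _ ->] := upper_graded sl i j; rewrite ?mxE.
have v1 : v = 1%:M.
  by apply/matrixP => i j; have [_ _ ->] := lower_graded sl i j; rewrite ?mxE.
apply: equivalent_sym; apply: (@equivalent_intertwiner _ _ _ _ 1%:M); first exact: unitmx1.
- by move=> x x0; rewrite sl // sigma_XXVI_weights // mul1mx mulmx1.
- by rewrite u1 mk_alg_homE.
- by rewrite v1 mk_alg_homE.
Qed.

(** The two weight spaces are planes, so [normal_form] does not apply. The relations say that the
    off-diagonal 2 x 2 blocks of [u] and [v] are mutually inverse; the columns of the block of [u],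
    paired with e2 and e3, split the module into two copies of the twisted standard module. *)
Lemma case_XV_diag e : has_weights s (weights4 (p ^ e) (p ^ e)) ->
  equivalent (sigma_XV hp (e, e)) s.
Proof.
set m := (p ^ e)%N => sl; have m0 : (0 < m)%N by exact: pexp_gt0 hp e.
have mm : (m <= m)%N by [].
have w01 : weights4 m m o0 = weights4 m m o1 by [].
have w23 : weights4 m m o2 = weights4 m m o3 by [].
have u01 : u o0 o1 = 0 by have [_ _ ->] := upper_graded sl o0 o1.
have u23 : u o2 o3 = 0 by have [_ _ ->] := upper_graded sl o2 o3.
have v10 : v o1 o0 = 0 by have [_ _ ->] := lower_graded sl o1 o0.
have v32 : v o3 o2 = 0 by have [_ _ ->] := lower_graded sl o3 o2.
have hE : (m + m)./2 = m by rewrite addnn doubleK.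
have coefs := (hE, u23, v32, coefD, coefZ, coefXn, coef1, coef_1DX_exp, coefMXn, binn,
  eqxx, ltnn, subnn, gtn_eqF m0, mul0r, mulr0, mulr1, add0r, addr0, coefC, coef0).
have e33 : v o3 o0 * u o0 o3 + v o3 o1 * u o1 o3 = 1.
  have := congr1 (fun P : {poly k} => P`_m) (rel33 mm sl).
  by rewrite hE u23 !mulr0 scale0r addr0 !coefs.
have e22 : v o2 o0 * u o0 o2 + v o2 o1 * u o1 o2 = 1.
  have := congr1 (fun P : {poly k} => P`_m) (rel22 mm sl).
  by rewrite hE u23 !mul0r scale0r addr0 mulr1 !coefs.
have e32 : v o3 o0 * u o0 o2 + v o3 o1 * u o1 o2 = 0.
  have := congr1 (fun P : {poly k} => P`_m) (rel32 mm sl).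
  by rewrite hE v32 !scale0r addr0 !coefs.
have e23 : v o2 o0 * u o0 o3 + v o2 o1 * u o1 o3 = 0.
  have := congr1 (fun P : {poly k} => P`_m) (rel23 mm sl).
  by rewrite hE u23 !scale0r addr0 !coefs.
have UE := upper4E mm sl; have VE := lower4E mm sl.
rewrite u01 u23 in UE; rewrite v10 v32 in VE.
move: UE VE e33 e22 e32 e23.
move: (u o0 o2) (u o0 o3) (u o1 o2) (u o1 o3) => u02 u03 u12 u13.
move: (v o2 o0) (v o2 o1) (v o3 o0) (v o3 o1) => v20 v21 v30 v31 UE VE e33 e22 e32 e23.
have d0 : u02 * u13 - u03 * u12 != 0.
  apply/eqP => d0; have /eqP : 1 = 0 :> k; last by rewrite oner_eq0.
  transitivity ((v20 * u02 + v21 * u12) * (v30 * u03 + v31 * u13)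
    - (v30 * u02 + v31 * u12) * (v20 * u03 + v21 * u13)).
    by rewrite e22 e33 e32; ring.
  transitivity ((v20 * v31 - v21 * v30) * (u02 * u13 - u03 * u12)); first by ring.
  by rewrite d0 mulr0.
apply: (equivalent_rows (Q := mx_of_rows 4 4
  [:: [:: u02; 0; u03; 0]; [:: u12; 0; u13; 0]; [:: 0; 1; 0; 0]; [:: 0; 0; 0; 1]])
  sl (sigma_XV_weights hp e e)).
- move=> i j; elim/ord4_ind: i; elim/ord4_ind: j; rewrite !mxE /= ?eqxx //.
- rewrite UE sigma_XV_upper /upper4 !mul_rows4 /=; entries4; ring.
- rewrite VE sigma_XV_lower /lower4 !mul_rows4 /=; entries4; try ring;
  rewrite ?(mulr0, mul0r, mulr1, mul1r, addr0, add0r) //.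
- rewrite det_rows4; apply: contraNneq d0 => d0; rewrite -oppr_eq0 -[X in _ == X]d0.
  by apply/eqP; ring.
Qed.

End Degenerate.

(** * Normal form *)

Section NormalForm.
Variables (k : closedFieldType) (s : alg_hom k 2 4) (m n : nat).
Hypotheses (nm : (n < m)%N) (sl : has_weights s (weights4 m n)).
Local Notation u := (val (s (upper 1))).
Local Notation v := (val (s (lower 1))).
Let nm' : (n <= m)%N := ltnW nm.

Lemma odd_gap_zero : odd (m - n) ->
  [/\ u o0 o1 = 0, u o0 o2 = 0, v o1 o0 = 0 & v o2 o0 = 0] /\
  [/\ u o1 o3 = 0, u o2 o3 = 0, v o3 o1 = 0 & v o3 o2 = 0].
Proof.
move=> o; have o' : odd (m + n) by move: o nm; lia.
have U i j : odd (absz (weights4 m n i - weights4 m n j)) -> u i j = 0.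
  exact: odd_gap_upper.
have V i j : odd (absz (weights4 m n i - weights4 m n j)) -> v i j = 0.
  exact: odd_gap_lower.
by split; split; (apply: U || apply: V); rewrite /weights4 /=; move: o o'; lia.
Qed.

Lemma even_gap : ~~ odd (m - n) -> exists2 g, (0 < g)%N & m = (n + 2 * g)%N.
Proof. by move=> o; exists (m - n)./2; move: o nm; lia. Qed.

(** The last column of [u] and the last row of [v] are determined by the first column of [v] and the
    first row of [u]. For m - n odd all entries linking the outer weights to the middle ones vanish
    by parity; otherwise these are the coefficient relations. *)
Lemma normal_form : let a1 := u o0 o1 in let a2 := u o0 o2 in let x := u o0 o3 in
  let d1 := v o1 o0 in let d2 := v o2 o0 in let y := v o3 o0 in
  [/\ y * x = 1, u = upper4 a1 a2 x (u o1 o2) (d1 * x) (d2 * x)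
    & v = lower4 d1 d2 y (v o2 o1) (y * a1) (y * a2)].
Proof.
move=> a1 a2 x d1 d2 y; have [o|/even_gap[g g0 mE]] := boolP (odd (m - n)).
  have [[z1 z2 z3 z4] [z5 z6 z7 z8]] := odd_gap_zero o; split.
  - have := congr1 (fun P : {poly k} => P`_m) (rel33 nm' sl).
    rewrite z5 z6 !mulr0 !scale0r !addr0 coefD coefZ coefXn eqxx mulr1 coef1.
    by rewrite gtn_eqF ?addr0 ?coef_1DX_exp ?binn // (leq_ltn_trans _ nm).
  - by rewrite {1}(upper4E nm' sl) z5 z6 /d1 /d2 z3 z4 !mul0r.
  - by rewrite {1}(lower4E nm' sl) z7 z8 /a1 /a2 z1 z2 !mulr0.
split; first exact: rel_v30u03 mE g0 sl.
- by rewrite {1}(upper4E nm' sl) (rel_u13 mE g0 sl) (rel_u23 mE g0 sl).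
- by rewrite {1}(lower4E nm' sl) (rel_v31 mE g0 sl) (rel_v32 mE g0 sl).
Qed.

End NormalForm.

(** * Additivity of the upper unipotent subgroup *)

Section UpperAdditivity.
Variables (k : closedFieldType) (s : alg_hom k 2 4) (m n g : nat).
Hypotheses (mE : m = (n + 2 * g)%N) (sl : has_weights s (weights4 m n)).
Local Notation u := (val (s (upper 1))).
Local Notation v := (val (s (lower 1))).

Let nm : (n <= m)%N. Proof. by lia. Qed.
Let gE : (m - n)./2 = g. Proof. by lia. Qed.
Let hE : (m + n)./2 = (n + g)%N. Proof. by lia. Qed.

Lemma upper_additive i j : u i j *: (1 + 'X) ^+ gap (weights4 m n i) (weights4 m n j) =
  \sum_l (u i l * u l j) *: 'X^(gap (weights4 m n l) (weights4 m n j)).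
Proof.
apply: (@poly_eq_cofinite _ _ _ [::]) => y _; rewrite hornerZ horner_exp hornerD hornerX hornerC.
have [<- _ _] := upper_graded sl i j; rewrite upperD alg_homMx mxE horner_sum.
apply: eq_bigr => l _; rewrite hornerZ hornerXn -mulrA.
by have [ue _ _] := upper_graded sl l j; rewrite (ue y).
Qed.

Lemma upper_additive02 : u o0 o2 *: (1 + 'X) ^+ (n + g) =
  u o0 o2 *: 'X^(n + g) + (u o0 o1 * u o1 o2) *: 'X^n + u o0 o2 *: 1.
Proof.
have := upper_additive o0 o2; rewrite sum4 gap02 // hE => ->.
rewrite (upper_diag sl) (upper_diag sl) (upper_below nm sl (i := o3)) //.
by rewrite gap12 // gapii expr0 mul1r !mulr1 mulr0 scale0r addr0.
Qed.

Lemma upper_additive13 : u o1 o3 *: (1 + 'X) ^+ (n + g) =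
  u o1 o3 *: 'X^(n + g) + (u o1 o2 * u o2 o3) *: 'X^g + u o1 o3 *: 1.
Proof.
have := upper_additive o1 o3; rewrite sum4 gap13 // hE => ->.
rewrite (upper_diag sl) (upper_diag sl) (upper_below nm sl (i := o1)) //.
by rewrite gap23 // gE gapii expr0 mul1r !mulr1 mul0r scale0r add0r.
Qed.

(* For u02 <> 0 the exponents of (1 + X)^(n + g) are 0, n and n + g, so the
   symmetry of the binomial coefficients forces n = g. *)
Lemma upper_additive_gap : (0 < n)%N -> (0 < g)%N -> 'C(n + g, n)%:R != 0 :> k ->
  (u o0 o2 != 0) || (u o1 o3 != 0) -> n = g.
Proof.
move=> n0 g0 C0.
have Cg : 'C(n + g, g)%:R != 0 :> k by rewrite -bin_sub ?leq_addl // addnK.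
have coefs := (coefD, coefZ, coefXn, coef1, coef_1DX_exp).
case/orP => u0.
- have := congr1 (fun P : {poly k} => P`_g) upper_additive02; rewrite !coefs.
  have gh : (g < n + g)%N by lia.
  rewrite (ltn_eqF gh) (gtn_eqF g0) !mulr0 add0r addr0.
  have [->//|_] := eqVneq g n; rewrite mulr0 => /eqP.
  by rewrite mulf_eq0 (negPf u0) (negPf Cg).
- have := congr1 (fun P : {poly k} => P`_n) upper_additive13; rewrite !coefs.
  have nh : (n < n + g)%N by lia.
  rewrite (ltn_eqF nh) (gtn_eqF n0) !mulr0 add0r addr0.
  have [->//|_] := eqVneq n g; rewrite mulr0 => /eqP.
  by rewrite mulf_eq0 (negPf u0) (negPf C0).
Qed.

End UpperAdditivity.

(** * Classification *)

Section Classification.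
Variables (k : closedFieldType) (p : nat) (hp : p \in [pchar k]).
Implicit Types s t : alg_hom k 2 4.

Let p_prime : prime p := pcharf_prime hp.

Lemma pexp_inj a b : (p ^ a = p ^ b)%N -> a = b.
Proof. exact: expnI (prime_gt1 p_prime) _ _. Qed.

(** IX and I carry their restriction on p explicitly because [sigma_IX] and [sigma_I] are defined
    for every p. *)
Inductive classified s : Prop :=
| Class_IV e1 e2 of (e1 < e2)%N & equivalent (sigma_IV hp (e1, e2)) s
| Class_XV e2 e3 of (e3 <= e2)%N & equivalent (sigma_XV hp (e2, e3)) s
| Class_XXIV e of equivalent (sigma_XXIV hp e) s
| Class_XXVI of equivalent (sigma_XXVI k) s
| Class_V p2 e of equivalent (sigma_V hp p2 e) s
| Class_XI p2 e of equivalent (sigma_XI hp p2 e) s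
| Class_XIX p2 e of equivalent (sigma_XIX hp p2 e) s
| Class_II p3 e of equivalent (sigma_II hp p3 e) s
| Class_VII p3 e of equivalent (sigma_VII hp p3 e) s
| Class_IX e of p != 2%N & equivalent (sigma_IX hp e) s
| Class_I e of (5 <= p)%N & equivalent (sigma_I hp e) s.

Lemma classified_equivalent s t : equivalent s t -> classified t -> classified s.
Proof.
move=> st; have ts := equivalent_sym st.
case=> [e1 e2 h e|e2 e3 h e|e h|h|p2 e h|p2 e h|p2 e h|p3 e h|p3 e h|e h h'|e h h'].
- exact: Class_IV h (equivalent_trans e ts).
- exact: Class_XV h (equivalent_trans e ts).
- exact: Class_XXIV (equivalent_trans h ts).
- exact: Class_XXVI (equivalent_trans h ts).
- exact: Class_V (equivalent_trans h ts).
- exact: Class_XI (equivalent_trans h ts).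
- exact: Class_XIX (equivalent_trans h ts).
- exact: Class_II (equivalent_trans h ts).
- exact: Class_VII (equivalent_trans h ts).
- exact: Class_IX h (equivalent_trans h' ts).
- exact: Class_I h (equivalent_trans h' ts).
Qed.

Lemma equal_weights_entry s m (i j : 'I_4) : has_weights s (weights4 m 0) ->
    weights4 m 0 i = weights4 m 0 j -> i != j ->
  val (s (upper 1)) i j = 0 /\ val (s (lower 1)) i j = 0.
Proof.
move=> sl w ij; have [_ _ ->] := upper_graded sl i j => //.
by have [_ _ ->] := lower_graded sl i j; rewrite // (negPf ij).
Qed.

(** For p^e odd, parity isolates the weight 0 plane. Otherwise p = 2, and the inner binomial
    coefficients of 2^e vanish, so the functional (a1, a2) kills the vector (d1, d2); the form
    depends on which of the two is zero. *)
Lemma classified_zero s e : has_weights s (weights4 (p ^ e) 0) -> classified s.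
Proof.
move=> sl; have q0 := pexp_gt0 hp e.
have [mu0 _] := @equal_weights_entry s _ o1 o2 sl erefl isT.
have [_ nu0] := @equal_weights_entry s _ o2 o1 sl erefl isT.
have [] := normal_form q0 sl; set a1 := val (s (upper 1)) o0 o1; set a2 := val (s (upper 1)) o0 o2.
set d1 := val (s (lower 1)) o1 o0; set d2 := val (s (lower 1)) o2 o0; rewrite mu0 nu0 => yx UE VE.
have [o|/(even_gap q0)[g g0 mE]] := boolP (odd (p ^ e - 0)).
  have [[a10 a20 d10 d20] _] := odd_gap_zero q0 sl o.
  by refine (@Class_XXIV _ e (case_XXIV hp sl yx UE VE _ _ _ _ _ _ _ _)).
have ad : a1 * d1 + a2 * d2 = 0.
  have := rel_middle mE g0 sl erefl; rewrite bin_pexp_mid //; last by lia.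
  rewrite (rel_v31 mE g0 sl) (rel_v32 mE g0 sl) (rel_u13 mE g0 sl) (rel_u23 mE g0 sl).
  by move=> <-; rewrite -/a1 -/a2 -/d1 -/d2; ring: yx.
have [e' eE p2] : exists2 e', (p ^ e = 2 * p ^ e')%N & p = 2%N.
  have p2 : p = 2%N.
    have : (2 %| p ^ e)%N by rewrite mE dvdn_mulr.
    by rewrite Euclid_dvdX // dvdn_prime2 // => /andP[/eqP<-].
  case: e mE {sl q0 UE VE yx ad} => [|e] mE; first by move: mE; rewrite expn0; lia.
  by exists e; rewrite // expnS {1}p2.
have [a0|] := boolP ((a1 != 0) || (a2 != 0)); have [d0|] := boolP ((d1 != 0) || (d2 != 0)).
- by refine (@Class_V _ p2 e' (case_V hp sl yx UE VE p2 eE _ a0 d0 ad _ _)).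
- rewrite negb_or !negbK => /andP[/eqP d10 /eqP d20].
  by refine (@Class_XI _ p2 e' (case_XI hp sl yx UE VE p2 eE _ a0 d10 d20 _ _)).
- rewrite negb_or !negbK => /andP[/eqP a10 /eqP a20].
  by refine (@Class_XIX _ p2 e' (case_XIX hp sl yx UE VE p2 eE _ d0 a10 a20 _ _)).
rewrite !negb_or !negbK => /andP[/eqP d10 /eqP d20] /andP[/eqP a10 /eqP a20].
by refine (@Class_XXIV _ e (case_XXIV hp sl yx UE VE _ _ a10 a20 d10 d20 _ _)).
Qed.

(** The middle coefficient is C(2q, q) = 2 in k, which is the value of (a1, a2) on (d1, d2). *)
Lemma classified_double s e : p != 2%N -> has_weights s (weights4 (2 * p ^ e) 0) -> classified s.
Proof.
move=> p2 sl; have q0 := pexp_gt0 hp e.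
have m0 : (0 < 2 * p ^ e)%N by rewrite muln_gt0.
have [mu0 _] := @equal_weights_entry s _ o1 o2 sl erefl isT.
have [_ nu0] := @equal_weights_entry s _ o2 o1 sl erefl isT.
have [] := normal_form m0 sl; set a1 := val (s (upper 1)) o0 o1; set a2 := val (s (upper 1)) o0 o2.
set d1 := val (s (lower 1)) o1 o0; set d2 := val (s (lower 1)) o2 o0; rewrite mu0 nu0 => yx UE VE.
have mE : (2 * p ^ e = 0 + 2 * p ^ e)%N by [].
have ad : a1 * d1 + a2 * d2 = 2.
  have := rel_middle mE q0 sl erefl.
  rewrite mulnC -[X in 'C(_, X)]muln1 (bin_pexp hp) bin1 => <-.
  rewrite (rel_v31 mE q0 sl) (rel_v32 mE q0 sl) (rel_u13 mE q0 sl) (rel_u23 mE q0 sl).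
  by rewrite -/a1 -/a2 -/d1 -/d2; ring: yx.
by refine (@Class_IX _ e p2 (case_IX hp sl yx UE VE p2 _ _ ad _ _)).
Qed.

(** The inner binomial coefficients of p^e vanish, so a1 d1 = a2 d2 = 0 and the two pairs of weights
    interact in at most one direction. Without interaction the form is XV; interaction forces p = 3
    and p^e = 3 n, and its direction decides between II and VII. *)
Lemma classified_pair s e n : (0 < n < p ^ e)%N -> has_weights s (weights4 (p ^ e) n) ->
  classified s.
Proof.
move=> /andP[n0 nm] sl.
have [] := normal_form nm sl; set a1 := val (s (upper 1)) o0 o1; set a2 := val (s (upper 1)) o0 o2.
set d1 := val (s (lower 1)) o1 o0; set d2 := val (s (lower 1)) o2 o0; set mu := val (s (upper 1)) o1 o2; set nu := val (s (lower 1)) o2 o1.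
set x := val (s (upper 1)) o0 o3; set y := val (s (lower 1)) o3 o0 => yx UE VE.
have y0 : y != 0 by apply: contra_eq_neq yx => ->; rewrite mul0r eq_sym oner_neq0.
have x0 : x != 0 by apply: contra_eq_neq yx => ->; rewrite mulr0 eq_sym oner_neq0.
have even_rel g : (0 < g)%N -> (p ^ e = n + 2 * g)%N -> a1 * d1 = 0 /\ a2 * d2 = 0.
  move=> g0 mE; have := rel_v31u13 mE g0 sl n0; have := rel_v32u23 mE g0 sl n0.
  rewrite !bin_pexp_mid //; [|lia|lia].
  rewrite (rel_v31 mE g0 sl) (rel_v32 mE g0 sl) (rel_u13 mE g0 sl) (rel_u23 mE g0 sl).
  rewrite -/a1 -/a2 -/d1 -/d2 -/x -/y => e1 e2; split.
    by rewrite -e2; ring: yx.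
  by rewrite -e1; ring: yx.
have [ad1 ad2] : a1 * d1 = 0 /\ a2 * d2 = 0.
  have [o|/(even_gap nm)[g g0 mE]] := boolP (odd (p ^ e - n)); last exact: even_rel mE.
  have [[a10 a20 d10 d20] _] := odd_gap_zero nm sl o.
  by rewrite /a1 a10 /a2 a20 !mul0r.
(* [rel22], whose other coefficients are multiples of a2 d2 = 0. It yields mu nu = 1 and makes n a
   power of p. *)
have en : (1 + 'X) ^+ n = 1 + (nu * mu) *: 'X^n :> {poly k}.
  have := rel22 (ltnW nm) sl; rewrite -/mu -/nu -/a2 -/d2.
  have -> : val (s (upper 1)) o2 o3 = d2 * x by rewrite {1}UE mxE.
  have -> : val (s (lower 1)) o3 o2 = y * a2 by rewrite {1}VE mxE.
  rewrite [d2 * a2]mulrC ad2 (_ : d2 * x * (y * a2) = 0); last by ring: ad2.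
  by rewrite !scale0r add0r addr0 mulr1 addrC => <-.
have munu : mu * nu = 1.
  have := congr1 (fun P : {poly k} => P`_n) en.
  rewrite coef_1DX_exp binn coefD coef1 coefZ coefXn eqxx mulr1 (gtn_eqF n0) add0r.
  by rewrite mulrC => <-.
have [e' nE] : exists e', n = (p ^ e')%N.
  apply: (pexp_1DX hp n0) => r /andP[r0 rn].
  have := congr1 (fun P : {poly k} => P`_r) en.
  by rewrite coef_1DX_exp coefD coef1 coefZ coefXn (gtn_eqF r0) (ltn_eqF rn) mulr0 addr0.
have e'e : (e' < e)%N by move: nm; rewrite nE ltn_exp2l // prime_gt1.
have [/and4P[/eqP a10 /eqP a20 /eqP d10 /eqP d20]|nz] :=
    boolP [&& a1 == 0, a2 == 0, d1 == 0 & d2 == 0].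
  apply: (Class_XV (ltnW e'e)).
  by refine (case_XV hp sl yx UE VE _ nE a10 a20 d10 d20 munu).
have ev : ~~ odd (p ^ e - n).
  apply: contra nz => o; have [[a10 a20 d10 d20] _] := odd_gap_zero nm sl o.
  by rewrite /a1 a10 /a2 a20 /d1 d10 /d2 d20 !eqxx.
have [g g0 mE] := even_gap nm ev.
pose c : k := 'C(n + g, n)%:R.
have amu : a1 * mu = a2 * c.
  have := rel_v31u12 mE g0 sl n0; rewrite (rel_v31 mE g0 sl) (rel_v32 mE g0 sl).
  by rewrite -/a1 -/a2 -/mu -/y -/c -!mulrA => /(mulfI y0).
have anu : a2 * nu = a1 * c := rel_u02v21 mE g0 sl n0.
have mud : mu * d2 = d1 * c := rel_u12v20 mE g0 sl n0.
have nud : nu * d1 = d2 * c.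
  have := rel_v21u13 mE g0 sl n0; rewrite (rel_u13 mE g0 sl) (rel_u23 mE g0 sl).
  rewrite -/d1 -/d2 -/nu -/x -/c mulrA => e1; apply: (mulIf x0).
  by rewrite e1; ring.
have mu0 : mu != 0 by apply: contra_eq_neq munu => ->; rewrite mul0r eq_sym oner_neq0.
have nu0 : nu != 0 by apply: contra_eq_neq munu => ->; rewrite mulr0 eq_sym oner_neq0.
have c0 : c != 0.
  apply: contra nz => /eqP c0; move: amu anu mud nud; rewrite c0 !mulr0.
  move=> /eqP + /eqP + /eqP + /eqP; rewrite !mulf_eq0 (negPf mu0) (negPf nu0) ?orbF /=.
  by move=> -> -> -> ->.
have a12 : (a1 == 0) = (a2 == 0).
  by have := congr1 (fun z => z == 0) amu; rewrite !mulf_eq0 (negPf mu0) (negPf c0) !orbF.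
have d12 : (d1 == 0) = (d2 == 0).
  by have := congr1 (fun z => z == 0) nud; rewrite !mulf_eq0 (negPf nu0) (negPf c0) orbF.
(* Some entry is nonzero, hence a2 or d1 is, as a1, a2 vanish together and so do d1, d2. *)
have ng : n = g.
  apply: (upper_additive_gap mE sl n0 g0 c0).
  rewrite (rel_u13 mE g0 sl) -/a2 -/d1 -/x mulf_eq0 (negPf x0) orbF.
  by move: nz; rewrite a12 d12; case: eqP; case: eqP.
have m3 : (p ^ e = 3 * n)%N by lia.
have p3 : p = 3%N.
  have : (3 %| p ^ e)%N by rewrite m3 dvdn_mulr.
  by rewrite Euclid_dvdX // dvdn_prime2 // => /andP[/eqP<-].
(* c = C(2n, n) with n a power of p, hence c = 2, which is -1 in characteristic 3. *)
have cE : c = -1.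
  rewrite /c -ng addnn -mul2n mulnC nE -[X in 'C(_, X)]muln1 (bin_pexp hp) bin1.
  by apply/subr0_eq; rewrite -(eq0_pchar hp p3); ring.
rewrite cE !mulrN1 in amu nud mud.
have [a0|a0] := eqVneq a2 0.
  have a10 : a1 = 0 by apply/eqP; rewrite a12 a0.
  have d20 : d2 != 0 by apply: contra nz => d20; rewrite d12 d20 a12 a0 eqxx.
  have d10 : d1 != 0 by rewrite d12.
  apply: (@Class_VII _ p3 e').
  by refine (case_VII hp sl yx UE VE p3 _ nE d10 d20 a10 a0 nud mud munu); rewrite -nE.
have d20 : d2 = 0 by apply/eqP; move/eqP: ad2; rewrite mulf_eq0 (negPf a0).
have d10 : d1 = 0 by apply/eqP; rewrite d12 d20.
apply: (@Class_II _ p3 e').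
by refine (case_II hp sl yx UE VE p3 _ nE a0 d10 d20 munu amu); rewrite -nE.
Qed.

Theorem classification s : classified s.
Proof.
have [m [n [t [nm st tl]]]] := sorted_weights_exist s; apply: classified_equivalent st _.
have [m0|m0] := posnP m.
  move: tl nm; rewrite m0 leqn0 => tl /eqP n0; rewrite n0 in tl.
  exact/Class_XXVI/case_XXVI.
case: (highest_weight_cases hp m0 nm (weight_binomials nm tl hp m0)).
- move=> [e mE]; rewrite mE in nm tl.
  have [n0|n0] := posnP n; first by rewrite n0 in tl; exact: classified_zero tl.
  move: nm; rewrite leq_eqVlt => /orP[/eqP nE|nm].
    by rewrite nE in tl; apply: Class_XV (leqnn e) _; exact: case_XV_diag.
  by apply: classified_pair tl; rewrite n0.
- by move=> [e [mE nE p2]]; rewrite mE nE in tl; exact: classified_double tl.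
- move=> [e [mE nE p5]]; apply: (@Class_I _ e p5); rewrite mE nE in tl.
  have q0 := pexp_gt0 hp e.
  have ps x : (0 < x < p)%N -> ~~ (p %| x)%N by move=> /andP[? ?]; rewrite gtnNdvd.
  (* Its value in k is 3. *)
  have c3 : 'C(3 * p ^ e, p ^ e)%:R != 0 :> k.
    rewrite mulnC -[X in 'C(_, X)]muln1 (bin_pexp hp) (natr_neq0 hp); apply: ps.
    by rewrite (leq_trans _ p5).
  apply: (simple_unique q0 q0 _ (sigma_I_weights hp e) tl c3); first by lia.
  rewrite addnn -mul2n -bin_sub; last by rewrite leq_mul.
  by rewrite -mulnBl mul1n.
- move=> [e1 [e2 [e12 mE nE]]]; apply: (Class_IV e12); rewrite mE nE in tl.
  have q1 := pexp_gt0 hp e1; have q2 := pexp_gt0 hp e2.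
  have q12 : (p ^ e1 < p ^ e2)%N by rewrite ltn_exp2l // prime_gt1.
  (* Its value is p^(e2 - e1) + 1, that is 1 in k. *)
  have c1 : 'C(p ^ e2 + p ^ e1, p ^ e1)%:R != 0 :> k.
    rewrite -(subnKC (ltnW e12)) expnD -[X in (_ + X)%N]muln1 -mulnDr.
    rewrite -[X in 'C(_, X)]muln1 (bin_pexp hp) bin1 (natr_neq0 hp) dvdn_addr ?dvdn1.
      by rewrite gtn_eqF // prime_gt1.
    by rewrite dvdn_exp // subn_gt0.
  apply: (simple_unique (g := p ^ e1) _ q1 _ (sigma_IV_weights hp e12) tl c1) => //.
  + by rewrite subn_gt0.
  + by lia.
  by rewrite subnK ?(ltnW q12) // -bin_sub ?leq_addr // addKn.
Qed.

End Classification.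

(** * Inequivalence *)

Section Spectrum.
Variable k : closedFieldType.
Implicit Types s t : alg_hom k 2 4.

(* The weights of [s] are a, -a, b and -b, which their first two absolute
   moments determine. *)
Definition spectrum s (a b : nat) := (b <= a)%N /\ exists2 lam, has_weights s lam &
  (\sum_i absz (lam i) = 2 * (a + b))%N /\ (\sum_i absz (lam i) ^ 2 = 2 * (a ^ 2 + b ^ 2))%N.

Lemma spectrum_unique s t a b a' b' : equivalent s t -> spectrum s a b ->
  spectrum t a' b' -> a = a' /\ b = b'.
Proof.
move=> st [ba [lam sl [l1 l2]]] [ba' [mu tm [m1 m2]]].
have [pi piE] := equivalent_weights st sl tm.
have e1 : (a + b = a' + b')%N.
  suff : (2 * (a + b) = 2 * (a' + b'))%N by lia.
  by rewrite -l1 -m1 [RHS](reindex_perm pi); apply: eq_bigr => i _; rewrite piE.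
have e2 : (a ^ 2 + b ^ 2 = a' ^ 2 + b' ^ 2)%N.
  suff : (2 * (a ^ 2 + b ^ 2) = 2 * (a' ^ 2 + b' ^ 2))%N by lia.
  by rewrite -l2 -m2 [RHS](reindex_perm pi); apply: eq_bigr => i _; rewrite piE.
suff : a = a' by move=> aa; split; lia.
have [x [xE aE]] : exists x, [/\ a = (b + x)%N & True]; first by exists (a - b)%N; split; lia.
have [y [yE _]] : exists y, [/\ a' = (b' + y)%N & True]; first by exists (a' - b')%N; split; lia.
suff : x = y by lia.
(* From (a - b)^2 = 2 (a^2 + b^2) - (a + b)^2. *)
have : (x ^ 2 = y ^ 2)%N by nia.
by move/eqP; rewrite eqn_exp2r // => /eqP.
Qed.

Lemma spectrum_weights4 s m n : (n <= m)%N -> has_weights s (weights4 m n) -> spectrum s m n.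
Proof. by move=> nm sl; split => //; exists (weights4 m n); rewrite // !sum4 /weights4 /=; lia. Qed.

End Spectrum.

Section Inequivalence.
Variables (k : closedFieldType) (p : nat) (hp : p \in [pchar k]).
Implicit Types s t : alg_hom k 2 4.

Lemma spectrum_I e : spectrum (sigma_I hp e) (3 * p ^ e) (p ^ e).
Proof. by apply: (spectrum_weights4 _ (sigma_I_weights hp e)); lia. Qed.

Lemma spectrum_IV e1 e2 : (e1 < e2)%N ->
  spectrum (sigma_IV hp (e1, e2)) (p ^ e2 + p ^ e1) (p ^ e2 - p ^ e1).
Proof. by move=> e12; apply: (spectrum_weights4 _ (sigma_IV_weights hp e12)); lia. Qed.

Lemma spectrum_XXVI : spectrum (sigma_XXVI k) 0 0.
Proof. exact: (spectrum_weights4 _ (@sigma_XXVI_weights k)). Qed.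

Lemma spectrum_II p3 e : spectrum (sigma_II hp p3 e) (3 * p ^ e) (p ^ e).
Proof.
split; first lia; eexists; first exact: (sigma_II_weights hp p3 e).
by rewrite !sum4 /=; lia.
Qed.

Lemma spectrum_VII p3 e : spectrum (sigma_VII hp p3 e) (3 * p ^ e) (p ^ e).
Proof.
split; first lia; eexists; first exact: (sigma_VII_weights hp p3 e).
by rewrite !sum4 /=; lia.
Qed.

Lemma spectrum_V p2 e : spectrum (sigma_V hp p2 e) (2 * p ^ e) 0.
Proof.
split => //; eexists; first exact: (sigma_V_weights hp p2 e).
by rewrite !sum4 /=; lia.
Qed.

Lemma spectrum_IX e : spectrum (sigma_IX hp e) (2 * p ^ e) 0.
Proof.
split => //; eexists; first exact: (sigma_IX_weights hp e).
by rewrite !sum4 /=; lia.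
Qed.

Lemma spectrum_XI p2 e : spectrum (sigma_XI hp p2 e) (2 * p ^ e) 0.
Proof.
split => //; eexists; first exact: (sigma_XI_weights hp p2 e).
by rewrite !sum4 /=; lia.
Qed.

Lemma spectrum_XIX p2 e : spectrum (sigma_XIX hp p2 e) (2 * p ^ e) 0.
Proof.
split => //; eexists; first exact: (sigma_XIX_weights hp p2 e).
by rewrite !sum4 /=; lia.
Qed.

Lemma spectrum_XV e2 e3 : (e3 <= e2)%N -> spectrum (sigma_XV hp (e2, e3)) (p ^ e2) (p ^ e3).
Proof.
move=> e32; split; first by rewrite leq_pexp2l // prime_gt0 // (pcharf_prime hp).
by eexists; [exact: (sigma_XV_weights hp e2 e3) | rewrite !sum4 /=; lia].
Qed.

Lemma spectrum_XXIV e : spectrum (sigma_XXIV hp e) (p ^ e) 0.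
Proof.
split => //; eexists; first exact: (sigma_XXIV_weights hp e).
by rewrite !sum4 /=; lia.
Qed.

Local Notation N s x := (val (s (upper x)) - 1%:M).
Local Notation M s x := (val (s (lower x)) - 1%:M).

Lemma equivalent_sub1 s t : equivalent s t -> exists2 P, P \in unitmx &
  forall A, val (t A) - 1%:M = invmx P *m (val (s A) - 1%:M) *m P.
Proof.
move=> [P Pu st]; exists P => // A.
by rewrite mulmxBr mulmxBl mulmx1 mulVmx // st.
Qed.

(** Conjugation acts on products of [N] and [M], so their homogeneity in x depends only on the
    class. In degree 2q this and the next property separate the four families with weights 2q, 0, 0,
    -2q for p = 2: XXIV has both, XI only the left one, XIX only the right one, V neither. *)
Definition left_homogeneous s r := forall x, N s x *m M s 1 = x ^+ r *: (N s 1 *m M s 1).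
Definition right_homogeneous s r := forall x, M s 1 *m N s x = x ^+ r *: (M s 1 *m N s 1).
Definition square_zero s := N s 1 *m N s 1 = 0.
(** Separates II from VII: the only nonzero entry of the product is x^q for II and x^(3q) for VII,
    because the two composition factors occur in opposite order. *)
Definition lower_homogeneous s r :=
  forall x, N s 1 *m N s 1 *m M s x = x ^+ r *: (N s 1 *m N s 1 *m M s 1).

Lemma mulmx_conj (P A B : 'M[k]_4) : P \in unitmx ->
  (invmx P *m A *m P) *m (invmx P *m B *m P) = invmx P *m (A *m B) *m P.
Proof. by move=> Pu; rewrite !mulmxA mulmxK. Qed.

Lemma scalemx_conj (P A : 'M[k]_4) c :
  c *: (invmx P *m A *m P) = invmx P *m (c *: A) *m P.
Proof. by rewrite -scalemxAr -scalemxAl. Qed.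

Lemma left_homogeneous_equivalent s t r : equivalent s t ->
  left_homogeneous s r -> left_homogeneous t r.
Proof.
by move=> /equivalent_sub1[P Pu e] h x; rewrite !e !mulmx_conj // scalemx_conj h.
Qed.

Lemma right_homogeneous_equivalent s t r : equivalent s t ->
  right_homogeneous s r -> right_homogeneous t r.
Proof.
by move=> /equivalent_sub1[P Pu e] h x; rewrite !e !mulmx_conj // scalemx_conj h.
Qed.

Lemma square_zero_equivalent s t : equivalent s t -> square_zero s -> square_zero t.
Proof.
move=> /equivalent_sub1[P Pu e] h.
by rewrite /square_zero !e !mulmx_conj // h mulmx0 mul0mx.
Qed.

Lemma lower_homogeneous_equivalent s t r : equivalent s t ->
  lower_homogeneous s r -> lower_homogeneous t r.
Proof.
by move=> /equivalent_sub1[P Pu e] h x; rewrite !e !mulmx_conj // scalemx_conj h.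
Qed.

Lemma left_homogeneousE s (U : k -> 'M[k]_4) L r :
    (forall x, val (s (upper x)) = U x) -> val (s (lower 1)) = L ->
  left_homogeneous s r <->
  forall x, (U x - 1%:M) *m (L - 1%:M) = x ^+ r *: ((U 1 - 1%:M) *m (L - 1%:M)).
Proof. by move=> UE LE; split=> h x; have := h x; rewrite !UE LE. Qed.

Lemma right_homogeneousE s (U : k -> 'M[k]_4) L r :
    (forall x, val (s (upper x)) = U x) -> val (s (lower 1)) = L ->
  right_homogeneous s r <->
  forall x, (L - 1%:M) *m (U x - 1%:M) = x ^+ r *: ((L - 1%:M) *m (U 1 - 1%:M)).
Proof. by move=> UE LE; split=> h x; have := h x; rewrite !UE LE. Qed.

Lemma lower_homogeneousE s U (L : k -> 'M[k]_4) r :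
    val (s (upper 1)) = U -> (forall x, val (s (lower x)) = L x) ->
  lower_homogeneous s r <-> forall x, (U - 1%:M) *m (U - 1%:M) *m (L x - 1%:M) =
    x ^+ r *: ((U - 1%:M) *m (U - 1%:M) *m (L 1 - 1%:M)).
Proof. by move=> UE LE; split=> h x; have := h x; rewrite !UE !LE. Qed.

Let expr0q e : 0 ^+ (p ^ e) = 0 :> k.
Proof. by case: (p ^ e)%N (pexp_gt0 hp e) => // q _; rewrite exprS mul0r. Qed.
Let expr02q e : 0 ^+ (2 * p ^ e) = 0 :> k.
Proof. by rewrite mulnC exprM expr0q ?expr0n. Qed.
Let expr03q e : 0 ^+ (3 * p ^ e) = 0 :> k.
Proof. by rewrite mulnC exprM expr0q ?expr0n. Qed.

Let simp := (expr0q, expr02q, expr03q, expr1n, mulr0, mul0r, mulr1, mul1r, addr0, add0r).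

Lemma sub1_rows a1 a2 a3 a4 b1 b2 b3 b4 c1 c2 c3 c4 d1 d2 d3 d4 :
  @mx_of_rows k 4 4 [:: [:: a1; a2; a3; a4]; [:: b1; b2; b3; b4];
                      [:: c1; c2; c3; c4]; [:: d1; d2; d3; d4]] - 1%:M =
  @mx_of_rows k 4 4 [:: [:: a1 - 1; a2; a3; a4]; [:: b1; b2 - 1; b3; b4];
                      [:: c1; c2; c3 - 1; c4]; [:: d1; d2; d3; d4 - 1]].
Proof.
by apply/matrixP => i j; elim/ord4_ind: i; elim/ord4_ind: j; rewrite !mxE /= ?subr0.
Qed.

Lemma scale_rows c a1 a2 a3 a4 b1 b2 b3 b4 c1 c2 c3 c4 d1 d2 d3 d4 :
  c *: @mx_of_rows k 4 4 [:: [:: a1; a2; a3; a4]; [:: b1; b2; b3; b4];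
                      [:: c1; c2; c3; c4]; [:: d1; d2; d3; d4]] =
  @mx_of_rows k 4 4 [:: [:: c * a1; c * a2; c * a3; c * a4]; [:: c * b1; c * b2; c * b3; c * b4];
                      [:: c * c1; c * c2; c * c3; c * c4]; [:: c * d1; c * d2; c * d3; c * d4]].
Proof.
by apply/matrixP => i j; elim/ord4_ind: i; elim/ord4_ind: j; rewrite !mxE.
Qed.

Lemma XI_upper p2 e x : val (sigma_XI hp p2 e (upper x)) = mx_of_rows 4 4
  [:: [:: 1; x ^+ (2 * p ^ e); x ^+ (p ^ e); 0]; [:: 0; 1; 0; 0]; [:: 0; 0; 1; 0]; [:: 0; 0; 0; 1]].
Proof. by rewrite mk_alg_homE /form_XI /block_XI block31_rows !mxE /= !simp. Qed.

Lemma XIX_upper p2 e x : val (sigma_XIX hp p2 e (upper x)) = mx_of_rows 4 4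
  [:: [:: 1; x ^+ (2 * p ^ e); 0; 0]; [:: 0; 1; 0; 0]; [:: 0; x ^+ (p ^ e); 1; 0]; [:: 0; 0; 0; 1]].
Proof. by rewrite mk_alg_homE /form_XIX /block_XIX block31_rows !mxE /= !simp. Qed.

Lemma V_upper p2 e x : val (sigma_V hp p2 e (upper x)) = mx_of_rows 4 4
  [:: [:: 1; 0; 0; 0]; [:: x ^+ (p ^ e); 1; x ^+ (2 * p ^ e); 0]; [:: 0; 0; 1; 0];
      [:: 0; 0; x ^+ (p ^ e); 1]].
Proof. by rewrite mk_alg_homE /form_V !mxE /= !simp. Qed.

Lemma XXIV_upper e x : val (sigma_XXIV hp e (upper x)) = mx_of_rows 4 4
  [:: [:: 1; x ^+ (p ^ e); 0; 0]; [:: 0; 1; 0; 0]; [:: 0; 0; 1; 0]; [:: 0; 0; 0; 1]].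
Proof. by rewrite mk_alg_homE /form_XXIV block22_rows !mxE /= !simp. Qed.

Lemma II_lower p3 e x : val (sigma_II hp p3 e (lower x)) = mx_of_rows 4 4
  [:: [:: 1; 0; 0; 0]; [:: x ^+ (3 * p ^ e); 1; x ^+ (2 * p ^ e); 2^-1 * x ^+ (p ^ e)];
      [:: 0; 0; 1; 0]; [:: 0; 0; x ^+ (p ^ e); 1]].
Proof. by rewrite mk_alg_homE /form_II !mxE /= !simp. Qed.

Lemma VII_lower p3 e x : val (sigma_VII hp p3 e (lower x)) = mx_of_rows 4 4
  [:: [:: 1; 0; 2^-1 * x ^+ (p ^ e); 0]; [:: x ^+ (p ^ e); 1; x ^+ (2 * p ^ e); 0];
      [:: 0; 0; 1; 0]; [:: 0; 0; x ^+ (3 * p ^ e); 1]].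
Proof. by rewrite mk_alg_homE /form_VII !mxE /= !simp. Qed.

Ltac rows := rewrite ?sub1_rows ?subrr !mul_rows4 /= ?scale_rows.
Ltac powers x := repeat match goal with |- context [x ^+ ?q] =>
  let X := fresh "X" in move: (x ^+ q) => X end.

Lemma exprq_neq e : ~ (forall x : k, x != 0 -> x ^+ (p ^ e) = x ^+ (2 * p ^ e)).
Proof. by move/expr_inj_forall; have := pexp_gt0 hp e; lia. Qed.

Lemma XI_left p2 e : left_homogeneous (sigma_XI hp p2 e) (2 * p ^ e).
Proof. by apply/(left_homogeneousE _ (XI_upper p2 e) (sigma_XI_lower hp p2 e)) => x; rows; rewrite ?expr1n; powers x; entries4; ring. Qed.

Lemma XI_right p2 e : ~ right_homogeneous (sigma_XI hp p2 e) (2 * p ^ e).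
Proof.
move/(right_homogeneousE _ (XI_upper p2 e) (sigma_XI_lower hp p2 e)) => h; apply: (@exprq_neq e) => x _; have := h x; rows.
by move/(congr1 (fun A : 'M[k]_4 => A o1 o2)); rewrite !mxE /= ?simp.
Qed.

Lemma XIX_right p2 e : right_homogeneous (sigma_XIX hp p2 e) (2 * p ^ e).
Proof. by apply/(right_homogeneousE _ (XIX_upper p2 e) (sigma_XIX_lower hp p2 e)) => x; rows; rewrite ?expr1n; powers x; entries4; ring. Qed.

Lemma XIX_left p2 e : ~ left_homogeneous (sigma_XIX hp p2 e) (2 * p ^ e).
Proof.
move/(left_homogeneousE _ (XIX_upper p2 e) (sigma_XIX_lower hp p2 e)) => h; apply: (@exprq_neq e) => x _; have := h x; rows.
by move/(congr1 (fun A : 'M[k]_4 => A o2 o0)); rewrite !mxE /= ?simp.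
Qed.

Lemma V_left p2 e : ~ left_homogeneous (sigma_V hp p2 e) (2 * p ^ e).
Proof.
move/(left_homogeneousE _ (V_upper p2 e) (sigma_V_lower hp p2 e)) => h; apply: (@exprq_neq e) => x _; have := h x; rows.
by move/(congr1 (fun A : 'M[k]_4 => A o3 o1)); rewrite !mxE /= ?simp.
Qed.

Lemma V_right p2 e : ~ right_homogeneous (sigma_V hp p2 e) (2 * p ^ e).
Proof.
move/(right_homogeneousE _ (V_upper p2 e) (sigma_V_lower hp p2 e)) => h; apply: (@exprq_neq e) => x _; have := h x; rows.
by move/(congr1 (fun A : 'M[k]_4 => A o2 o0)); rewrite !mxE /= ?simp.
Qed.

Lemma XXIV_left e : left_homogeneous (sigma_XXIV hp e) (p ^ e).
Proof. by apply/(left_homogeneousE _ (XXIV_upper e) (sigma_XXIV_lower hp e)) => x; rows; rewrite ?expr1n; powers x; entries4; ring. Qed.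

Lemma XXIV_right e : right_homogeneous (sigma_XXIV hp e) (p ^ e).
Proof. by apply/(right_homogeneousE _ (XXIV_upper e) (sigma_XXIV_lower hp e)) => x; rows; rewrite ?expr1n; powers x; entries4; ring. Qed.

Lemma XV_square_zero e2 e3 : square_zero (sigma_XV hp (e2, e3)).
Proof.
rewrite /square_zero sigma_XV_upper; rows; apply/matrixP => i j.
by elim/ord4_ind: i; elim/ord4_ind: j; rewrite !mxE /= ?simp.
Qed.

Lemma II_square_zero p3 e : ~ square_zero (sigma_II hp p3 e).
Proof.
rewrite /square_zero sigma_II_upper; rows; move/(congr1 (fun A : 'M[k]_4 => A o0 o3)); rewrite !mxE /= ?simp.
by move/eqP; rewrite oner_eq0.
Qed.

Lemma VII_square_zero p3 e : ~ square_zero (sigma_VII hp p3 e).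
Proof.
rewrite /square_zero sigma_VII_upper; rows; move/(congr1 (fun A : 'M[k]_4 => A o0 o3)); rewrite !mxE /= ?simp.
by move/eqP; rewrite oner_eq0.
Qed.

Lemma II_lower_homogeneous p3 e : lower_homogeneous (sigma_II hp p3 e) (p ^ e).
Proof.
apply/(lower_homogeneousE _ (sigma_II_upper hp p3 e) (II_lower p3 e)) => x; rows; rewrite ?expr1n; powers x; entries4; ring.
Qed.

Lemma VII_lower_homogeneous p3 e : ~ lower_homogeneous (sigma_VII hp p3 e) (p ^ e).
Proof.
move/(lower_homogeneousE _ (sigma_VII_upper hp p3 e) (VII_lower p3 e)) => h; have /expr_inj_forall : forall x : k, x != 0 -> x ^+ (3 * p ^ e) = x ^+ (p ^ e).
  move=> x _; have := h x; rows.
  by move/(congr1 (fun A : 'M[k]_4 => A o0 o2)); rewrite !mxE /= ?simp.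
by have := pexp_gt0 hp e; lia.
Qed.

End Inequivalence.

(** * Unions and cardinals *)

Section DisjointUnions.
Variable T : Type.
Implicit Types (A B C : set T) (s : seq (set T)).

(** On an explicit list these fixpoints compute to a finite conjunction, one equation per pair. *)
Fixpoint disjoint_from A s : Prop :=
  if s is B :: s' then A `&` B = set0 /\ disjoint_from A s' else True.

Fixpoint pairwise_disjoint s : Prop :=
  if s is A :: s' then disjoint_from A s' /\ pairwise_disjoint s' else True.

Lemma disjoint_from_nth A s i : disjoint_from A s -> A `&` nth set0 s i = set0.
Proof.
elim: s i => [|B s IH] [|i] //= => [_|_|[]|[_ /IH]] //; exact: setI0.
Qed.

Lemma pairwise_disjoint_nth s i j : pairwise_disjoint s -> (i < j)%N ->
  nth set0 s i `&` nth set0 s j = set0.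
Proof.
elim: s i j => [|A s IH] [|i] [|j] //= => [_ _|_ _|[As _] _|[_ /IH]].
- exact: setI0.
- exact: setI0.
- exact: disjoint_from_nth.
- by move=> h ij; apply: h.
Qed.

Lemma disjoint_unionI A s : foldr setU set0 s = A -> pairwise_disjoint s ->
  disjoint_union A s.
Proof.
move=> <- ps; split.
  rewrite /cover bigcup_mkord -(big_mkord xpredT (nth set0 s)) -(big_nth set0 xpredT id).
  by rewrite unlock.
apply/trivIsetP => i j _ _; rewrite neq_ltn => /orP[ij|ji].
  exact: pairwise_disjoint_nth.
by rewrite setIC; exact: pairwise_disjoint_nth.
Qed.

End DisjointUnions.

Section Counting.
Variable T : pointedType.
Implicit Types A B C : set T.

Definition enumerates (I : Type) A := exists f : I -> T, set_bij [set: I] A f.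

Lemma enumerates_set_type (I : Type) (D : set I) A f : set_bij D A f -> enumerates D A.
Proof.
move=> [fD finj fsurj]; exists (f \o set_val); split.
- by move=> [x Dx] _ /=; apply: fD; exact: set_mem.
- by move=> x y _ _ /= e; apply: val_inj; exact: finj (valP x) (valP y) e.
- move=> a /fsurj[x Dx <-]; exists (SigSub (mem_set Dx)) => //.
Qed.

Lemma enumeratesU (I J : Type) A B : enumerates I A -> enumerates J B ->
  A `&` B = set0 -> enumerates (I + J) (A `|` B).
Proof.
move=> [f [fA finj fsurj]] [g [gB ginj gsurj]] AB.
have nAB x : A x -> B x -> False.
  by move=> Ax Bx; have : (A `&` B) x by []; rewrite AB.
exists (fun z => match z with inl i => f i | inr j => g j end); split.
- by move=> [i|j] _; [left; exact: fA | right; exact: gB].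
- move=> [i|j] [i'|j'] _ _ e.
  + by congr inl; apply: finj; rewrite ?inE.
  + by case: (nAB (f i)); [exact: fA | rewrite e; exact: gB].
  + by case: (nAB (f i')); [exact: fA | rewrite -e; exact: gB].
  + by congr inr; apply: ginj; rewrite ?inE.
- move=> x [/fsurj[i _ <-]|/gsurj[j _ <-]].
  + by exists (inl i).
  + by exists (inr j).
Qed.

Lemma enumerates_card (I : Type) A : enumerates I A -> (A #= [set: I])%card.
Proof. by move=> [f fA]; apply: card_esym; apply/card_set_bijP; exists f. Qed.

End Counting.

Section Families.
Variables (k : fieldType).

Lemma images_disjoint (I J : Type) (D : set I) (E : set J)
    (f : I -> alg_hom k 2 4) (g : J -> alg_hom k 2 4) :
    (forall i j, D i -> E j -> ~ equivalent (f i) (g j)) ->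
  [set alg_hom_class (f i) | i in D] `&` [set alg_hom_class (g j) | j in E] = set0.
Proof.
move=> fg; apply/seteqP; split=> // _ [[i Di <-] [j Ej /eq_alg_hom_class ji]].
exact: fg Di Ej (equivalent_sym ji).
Qed.

Lemma image_bij (I : Type) (D : set I) (f : I -> alg_hom k 2 4) :
    (forall i j, D i -> D j -> equivalent (f i) (f j) -> i = j) ->
  set_bij D [set alg_hom_class (f i) | i in D] (fun i => alg_hom_class (f i)).
Proof.
move=> finj; split.
- by move=> i Di; exists i.
- by move=> i j /set_mem Di /set_mem Dj /eq_alg_hom_class; exact: finj.
- by move=> _ [i Di <-]; exists i.
Qed.

End Families.

(** * The families of classes *)

Section PrimePowers.
Variables (p : nat) (p_prime : prime p).

(** Since f > e1, the power p^(e1 + 1) would divide p^f and p^e2, hence p^e1. *)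
Lemma pexp_sum e1 e2 f : (e1 < e2)%N -> (p ^ e2 + p ^ e1)%N <> (p ^ f)%N.
Proof.
move=> e12 e; have q1 : (0 < p ^ e1)%N by rewrite expn_gt0 prime_gt0.
have fe : (e1 < f)%N.
  by rewrite -(ltn_exp2l _ _ (prime_gt1 p_prime)) -e -[X in (X < _)%N]add0n ltn_add2r expn_gt0 prime_gt0.
have : (p ^ e1.+1 %| p ^ e1)%N.
  by rewrite -(dvdn_addr _ (dvdn_exp2l p e12)) e dvdn_exp2l.
by rewrite dvdn_Pexp2l ?ltnn // prime_gt1.
Qed.

Lemma pexp_multiple r e f : prime r -> (r * p ^ e = p ^ f)%N -> p = r.
Proof.
move=> rp e1; have : (r %| p ^ f)%N by rewrite -e1 dvdn_mulr.
by rewrite Euclid_dvdX // dvdn_prime2 // => /andP[/eqP<-].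
Qed.

End PrimePowers.

Section Classes.
Variables (k : closedFieldType) (p : nat) (hp : p \in [pchar k]).

Let p_prime : prime p := pcharf_prime hp.
Let pq e : (0 < p ^ e)%N := pexp_gt0 hp e.

Ltac spectra S1 S2 E := let ea := fresh "ea" in let eb := fresh "eb" in
  have [ea eb] := spectrum_unique E S1 S2; rewrite /= in ea eb.

Lemma bij_I : set_bij Lambda2 (S_I hp) (cl_I hp).
Proof.
apply: image_bij => e f _ _ E; spectra (spectrum_I hp e) (spectrum_I hp f) E.
exact: (pexp_inj hp).
Qed.

Lemma bij_II p3 : set_bij Lambda2 (S_II hp p3) (cl_II hp p3).
Proof.
apply: image_bij => e f _ _ E; spectra (spectrum_II hp p3 e) (spectrum_II hp p3 f) E.
exact: (pexp_inj hp).
Qed.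

Lemma bij_IV : set_bij Lambda1 (S_IV hp) (cl_IV hp).
Proof.
apply: (image_bij (f := sigma_IV hp)) => -[e1 e2] [f1 f2] /= e12 f12 E.
spectra (spectrum_IV hp e12) (spectrum_IV hp f12) E.
have lt a b : (a < b)%N -> (p ^ a < p ^ b)%N by move=> ab; rewrite ltn_exp2l // prime_gt1.
have /= := lt _ _ e12; have /= := lt _ _ f12 => lf le.
by congr (_, _); apply: (pexp_inj hp); lia.
Qed.

Lemma bij_V p2 : set_bij Lambda2 (S_V hp p2) (cl_V hp p2).
Proof.
apply: image_bij => e f _ _ E; spectra (spectrum_V hp p2 e) (spectrum_V hp p2 f) E.
by apply: (pexp_inj hp); lia.
Qed.

Lemma bij_VII p3 : set_bij Lambda2 (S_VII hp p3) (cl_VII hp p3).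
Proof.
apply: image_bij => e f _ _ E; spectra (spectrum_VII hp p3 e) (spectrum_VII hp p3 f) E.
exact: (pexp_inj hp).
Qed.

Lemma bij_IX : set_bij Lambda2 (S_IX hp) (cl_IX hp).
Proof.
apply: image_bij => e f _ _ E; spectra (spectrum_IX hp e) (spectrum_IX hp f) E.
by apply: (pexp_inj hp); lia.
Qed.

Lemma bij_XI p2 : set_bij Lambda2 (S_XI hp p2) (cl_XI hp p2).
Proof.
apply: image_bij => e f _ _ E; spectra (spectrum_XI hp p2 e) (spectrum_XI hp p2 f) E.
by apply: (pexp_inj hp); lia.
Qed.

Lemma bij_XV : set_bij Lambda3 (S_XV hp) (cl_XV hp).
Proof.
apply: (image_bij (f := sigma_XV hp)) => -[e2 e3] [f2 f3] /= e23 f23 E.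
spectra (spectrum_XV hp e23) (spectrum_XV hp f23) E.
by congr (_, _); exact: (pexp_inj hp).
Qed.

Lemma bij_XIX p2 : set_bij Lambda2 (S_XIX hp p2) (cl_XIX hp p2).
Proof.
apply: image_bij => e f _ _ E; spectra (spectrum_XIX hp p2 e) (spectrum_XIX hp p2 f) E.
by apply: (pexp_inj hp); lia.
Qed.

Lemma bij_XXIV : set_bij Lambda2 (S_XXIV hp) (cl_XXIV hp).
Proof.
apply: image_bij => e f _ _ E; spectra (spectrum_XXIV hp e) (spectrum_XXIV hp f) E.
exact: (pexp_inj hp).
Qed.

Lemma bij_XXVI : set_bij (Lambda4 k) (S_XXVI k) (cl_XXVI k).
Proof. by apply: (image_bij (f := fun=> sigma_XXVI k)) => i j -> ->. Qed.

(** The smaller weight b separates these families from [pos_family], and XXVI, with both weights 0,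
    from both. Only pairs inside one group need an argument of their own. *)
Definition zero_family (S : set (set (alg_hom k 2 4))) := forall C, S C ->
  exists s a, [/\ C = alg_hom_class s, spectrum s a 0 & (0 < a)%N].
Definition pos_family (S : set (set (alg_hom k 2 4))) := forall C, S C ->
  exists s a b, [/\ C = alg_hom_class s, spectrum s a b & (0 < b)%N].

Lemma zero_pos_disjoint S S' : zero_family S -> pos_family S' -> S `&` S' = set0.
Proof.
move=> zS pS; apply/seteqP; split=> // C [/zS[s [a [-> sa _]]] /pS[t [a' [b [st tb b0]]]]].
by have [_ b00] := spectrum_unique ((eq_alg_hom_class _ _).1 st) sa tb; rewrite -b00 in b0.
Qed.

Lemma zero_XXVI_disjoint S : zero_family S -> S `&` S_XXVI k = set0.
Proof.
move=> zS; apply/seteqP; split=> // C [/zS[s [a [-> sa a0]]] [i _ /eq_alg_hom_class E]].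
by have [a00 _] := spectrum_unique E (spectrum_XXVI k) sa; rewrite -a00 in a0.
Qed.

Lemma pos_XXVI_disjoint S : pos_family S -> S `&` S_XXVI k = set0.
Proof.
move=> pS; apply/seteqP; split=> // C [/pS[s [a [b [-> sa b0]]]] [i _ /eq_alg_hom_class E]].
by have [_ b00] := spectrum_unique E (spectrum_XXVI k) sa; rewrite -b00 in b0.
Qed.

Lemma zero_V p2 : zero_family (S_V hp p2).
Proof.
move=> _ [e _ <-]; exists (sigma_V hp p2 e), (2 * p ^ e)%N.
by split; rewrite ?muln_gt0 ?pq //; exact: spectrum_V.
Qed.

Lemma zero_XI p2 : zero_family (S_XI hp p2).
Proof.
move=> _ [e _ <-]; exists (sigma_XI hp p2 e), (2 * p ^ e)%N.
by split; rewrite ?muln_gt0 ?pq //; exact: spectrum_XI.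
Qed.

Lemma zero_XIX p2 : zero_family (S_XIX hp p2).
Proof.
move=> _ [e _ <-]; exists (sigma_XIX hp p2 e), (2 * p ^ e)%N.
by split; rewrite ?muln_gt0 ?pq //; exact: spectrum_XIX.
Qed.

Lemma zero_IX : zero_family (S_IX hp).
Proof.
move=> _ [e _ <-]; exists (sigma_IX hp e), (2 * p ^ e)%N.
by split; rewrite ?muln_gt0 ?pq //; exact: spectrum_IX.
Qed.

Lemma zero_XXIV : zero_family (S_XXIV hp).
Proof.
move=> _ [e _ <-]; exists (sigma_XXIV hp e), (p ^ e)%N.
by split; rewrite ?pq //; exact: spectrum_XXIV.
Qed.

Lemma pos_I : pos_family (S_I hp).
Proof.
move=> _ [e _ <-]; exists (sigma_I hp e), (3 * p ^ e)%N, (p ^ e)%N.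
by split; rewrite ?pq //; exact: spectrum_I.
Qed.

Lemma pos_II p3 : pos_family (S_II hp p3).
Proof.
move=> _ [e _ <-]; exists (sigma_II hp p3 e), (3 * p ^ e)%N, (p ^ e)%N.
by split; rewrite ?pq //; exact: spectrum_II.
Qed.

Lemma pos_VII p3 : pos_family (S_VII hp p3).
Proof.
move=> _ [e _ <-]; exists (sigma_VII hp p3 e), (3 * p ^ e)%N, (p ^ e)%N.
by split; rewrite ?pq //; exact: spectrum_VII.
Qed.

Lemma pos_IV : pos_family (S_IV hp).
Proof.
move=> _ [[e1 e2] /= e12 <-].
exists (sigma_IV hp (e1, e2)), (p ^ e2 + p ^ e1)%N, (p ^ e2 - p ^ e1)%N; split => //.
  exact: spectrum_IV.
by rewrite subn_gt0 ltn_exp2l // prime_gt1.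
Qed.

Lemma pos_XV : pos_family (S_XV hp).
Proof.
move=> _ [[e2 e3] /= e23 <-]; exists (sigma_XV hp (e2, e3)), (p ^ e2)%N, (p ^ e3)%N.
by split; rewrite ?pq //; exact: spectrum_XV.
Qed.

Lemma IV_XV_disjoint : S_IV hp `&` S_XV hp = set0.
Proof.
apply: (images_disjoint (f := sigma_IV hp) (g := sigma_XV hp)) => -[e1 e2] [f2 f3] /= e12 f23 E.
spectra (spectrum_IV hp e12) (spectrum_XV hp f23) E.
exact: (pexp_sum p_prime e12 ea).
Qed.

(* In characteristic 3 the weight 3q is a power of 3, which no p^e2 + p^e1 is. *)
Lemma IV_II_disjoint p3 : S_IV hp `&` S_II hp p3 = set0.
Proof.
apply: (images_disjoint (f := sigma_IV hp)) => -[e1 e2] f /= e12 _ E.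
spectra (spectrum_IV hp e12) (spectrum_II hp p3 f) E.
by apply: (@pexp_sum p p_prime e1 e2 f.+1 e12); rewrite expnS {3}p3.
Qed.

Lemma IV_VII_disjoint p3 : S_IV hp `&` S_VII hp p3 = set0.
Proof.
apply: (images_disjoint (f := sigma_IV hp)) => -[e1 e2] f /= e12 _ E.
spectra (spectrum_IV hp e12) (spectrum_VII hp p3 f) E.
by apply: (@pexp_sum p p_prime e1 e2 f.+1 e12); rewrite expnS {3}p3.
Qed.

Lemma IV_I_disjoint : (5 <= p)%N -> S_IV hp `&` S_I hp = set0.
Proof.
move=> p5; apply: (images_disjoint (f := sigma_IV hp)) => -[e1 e2] f /= e12 _ E.
spectra (spectrum_IV hp e12) (spectrum_I hp f) E.
(* Half the sum of the two weight equalities. *)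
have e2f : (2 * p ^ f = p ^ e2)%N by have := pq f; lia.
by have p2 := @pexp_multiple p p_prime 2 f e2 isT e2f; rewrite p2 in p5.
Qed.

Lemma XV_I_disjoint : (5 <= p)%N -> S_XV hp `&` S_I hp = set0.
Proof.
move=> p5; apply: (images_disjoint (f := sigma_XV hp)) => -[e2 e3] f /= e23 _ E.
spectra (spectrum_XV hp e23) (spectrum_I hp f) E.
by have p3 := @pexp_multiple p p_prime 3 f e2 isT (esym ea); rewrite p3 in p5.
Qed.

(** Weights do not suffice: in characteristic 3 the pair (3q, q) is also that of XV with e2 = e3 +
    1. *)
Lemma XV_II_disjoint p3 : S_XV hp `&` S_II hp p3 = set0.
Proof.
apply: (images_disjoint (f := sigma_XV hp)) => -[e2 e3] f /= e23 _ E.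
exact: (@II_square_zero _ _ hp p3 f (square_zero_equivalent E (XV_square_zero _ _ _))).
Qed.

Lemma XV_VII_disjoint p3 : S_XV hp `&` S_VII hp p3 = set0.
Proof.
apply: (images_disjoint (f := sigma_XV hp)) => -[e2 e3] f /= e23 _ E.
exact: (@VII_square_zero _ _ hp p3 f (square_zero_equivalent E (XV_square_zero _ _ _))).
Qed.

Lemma II_VII_disjoint p3 : S_II hp p3 `&` S_VII hp p3 = set0.
Proof.
apply: images_disjoint => e f _ _ E.
spectra (spectrum_II hp p3 e) (spectrum_VII hp p3 f) E.
have := lower_homogeneous_equivalent E (II_lower_homogeneous hp p3 e).
by rewrite eb; exact: VII_lower_homogeneous.
Qed.

Lemma IX_XXIV_disjoint : p != 2%N -> S_IX hp `&` S_XXIV hp = set0.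
Proof.
move=> p2; apply: images_disjoint => e f _ _ E.
spectra (spectrum_IX hp e) (spectrum_XXIV hp f) E.
by move/eqP: p2; apply; exact: (pexp_multiple p_prime (r := 2) isT ea).
Qed.

Lemma V_XI_disjoint p2 : S_V hp p2 `&` S_XI hp p2 = set0.
Proof.
apply: images_disjoint => e f _ _ E; spectra (spectrum_V hp p2 e) (spectrum_XI hp p2 f) E.
have := left_homogeneous_equivalent (equivalent_sym E) (XI_left hp p2 f).
by rewrite -ea; exact: V_left.
Qed.

Lemma V_XIX_disjoint p2 : S_V hp p2 `&` S_XIX hp p2 = set0.
Proof.
apply: images_disjoint => e f _ _ E; spectra (spectrum_V hp p2 e) (spectrum_XIX hp p2 f) E.
have := right_homogeneous_equivalent (equivalent_sym E) (XIX_right hp p2 f).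
by rewrite -ea; exact: V_right.
Qed.

Lemma V_XXIV_disjoint p2 : S_V hp p2 `&` S_XXIV hp = set0.
Proof.
apply: images_disjoint => e f _ _ E; spectra (spectrum_V hp p2 e) (spectrum_XXIV hp f) E.
have := left_homogeneous_equivalent (equivalent_sym E) (XXIV_left hp f).
by rewrite -ea; exact: V_left.
Qed.

Lemma XI_XIX_disjoint p2 : S_XI hp p2 `&` S_XIX hp p2 = set0.
Proof.
apply: images_disjoint => e f _ _ E; spectra (spectrum_XI hp p2 e) (spectrum_XIX hp p2 f) E.
have := left_homogeneous_equivalent E (XI_left hp p2 e).
by rewrite ea; exact: XIX_left.
Qed.

Lemma XI_XXIV_disjoint p2 : S_XI hp p2 `&` S_XXIV hp = set0.
Proof.
apply: images_disjoint => e f _ _ E; spectra (spectrum_XI hp p2 e) (spectrum_XXIV hp f) E.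
have := right_homogeneous_equivalent (equivalent_sym E) (XXIV_right hp f).
by rewrite -ea; exact: XI_right.
Qed.

Lemma XIX_XXIV_disjoint p2 : S_XIX hp p2 `&` S_XXIV hp = set0.
Proof.
apply: images_disjoint => e f _ _ E; spectra (spectrum_XIX hp p2 e) (spectrum_XXIV hp f) E.
have := left_homogeneous_equivalent (equivalent_sym E) (XXIV_left hp f).
by rewrite -ea; exact: XIX_left.
Qed.

Lemma sub_classes (I : Type) (D : set I) (f : I -> alg_hom k 2 4) :
  [set alg_hom_class (f i) | i in D] `<=` alg_hom_classes k 2 4.
Proof. by move=> _ [i _ <-]; exists (f i). Qed.

Lemma class_in_family (I : Type) (D : set I) (f : I -> alg_hom k 2 4) s i :
  D i -> equivalent (f i) s -> [set alg_hom_class (f i) | i in D] (alg_hom_class s).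
Proof. by move=> Di fs; exists i => //; apply/eq_alg_hom_class. Qed.

End Classes.

(** * Assembling the three cases *)

Section Cardinality.
Variables (T : pointedType) (I1 I2 I3 I4 : Type).
Implicit Types A B C D X : set T.

Lemma card_six A B1 B2 B3 C D X : enumerates I1 A -> enumerates I2 B1 -> enumerates I2 B2 ->
    enumerates I2 B3 -> enumerates I3 C -> enumerates I4 D ->
    pairwise_disjoint [:: A; B1; B2; B3; C; D] ->
    X = A `|` (B1 `|` B2 `|` B3) `|` C `|` D ->
  (X #= [set: I1 + (I2 + I2 + I2) + I3 + I4])%card.
Proof.
move=> eA eB1 eB2 eB3 eC eD /= d ->; apply: enumerates_card.
decompose [and] d; do ![apply: enumeratesU => //]; rewrite !(setIUl, setIUr).
all: by repeat match goal with H : _ `&` _ = set0 |- _ => rewrite ?H; clear H end; rewrite !setU0.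
Qed.

Lemma card_seven A B1 B2 B3 B4 C D X : enumerates I1 A -> enumerates I2 B1 ->
    enumerates I2 B2 -> enumerates I2 B3 -> enumerates I2 B4 -> enumerates I3 C ->
    enumerates I4 D -> pairwise_disjoint [:: A; B1; B2; B3; B4; C; D] ->
    X = A `|` (B1 `|` B2 `|` B3 `|` B4) `|` C `|` D ->
  (X #= [set: I1 + (I2 + I2 + I2 + I2) + I3 + I4])%card.
Proof.
move=> eA eB1 eB2 eB3 eB4 eC eD /= d ->; apply: enumerates_card.
decompose [and] d; do ![apply: enumeratesU => //]; rewrite !(setIUl, setIUr).
all: by repeat match goal with H : _ `&` _ = set0 |- _ => rewrite ?H; clear H end; rewrite !setU0.
Qed.

End Cardinality.

Section Assembly.
Variables (k : closedFieldType) (p : nat) (hp : p \in [pchar k]).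

Ltac family := match goal with
  | |- zero_family (S_V _ _) => exact: zero_V
  | |- zero_family (S_XI _ _) => exact: zero_XI
  | |- zero_family (S_XIX _ _) => exact: zero_XIX
  | |- zero_family (S_IX _) => exact: zero_IX
  | |- zero_family (S_XXIV _) => exact: zero_XXIV
  | |- pos_family (S_I _) => exact: pos_I
  | |- pos_family (S_II _ _) => exact: pos_II
  | |- pos_family (S_VII _ _) => exact: pos_VII
  | |- pos_family (S_IV _) => exact: pos_IV
  | |- pos_family (S_XV _) => exact: pos_XV
  end.

Ltac disjointness := match goal with
  | |- True => exact: I
  | |- _ `&` S_XXVI _ = set0 =>
      first [apply: zero_XXVI_disjoint; family | apply: pos_XXVI_disjoint; family]
  | H : ?A `&` ?B = set0 |- ?A `&` ?B = set0 => exact: H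
  | H : ?A `&` ?B = set0 |- ?B `&` ?A = set0 => rewrite setIC; exact: H
  | |- ?A `&` ?B = set0 => first [apply: zero_pos_disjoint; family
      | rewrite setIC; apply: zero_pos_disjoint; family]
  end.

Lemma disjoint_two (p2 : p = 2%N) : pairwise_disjoint
  [:: S_IV hp; S_V hp p2; S_XI hp p2; S_XIX hp p2; S_XXIV hp; S_XV hp; S_XXVI k].
Proof.
have := IV_XV_disjoint hp; have := V_XI_disjoint hp p2; have := V_XIX_disjoint hp p2.
have := V_XXIV_disjoint hp p2; have := XI_XIX_disjoint hp p2.
have := XI_XXIV_disjoint hp p2; have := XIX_XXIV_disjoint hp p2 => *.
by rewrite /=; do ![apply: conj]; disjointness.
Qed.

Lemma disjoint_three (p3 : p = 3%N) : pairwise_disjoint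
  [:: S_IV hp; S_II hp p3; S_VII hp p3; S_IX hp; S_XXIV hp; S_XV hp; S_XXVI k].
Proof.
have p2 : p != 2%N by rewrite p3.
have := IV_XV_disjoint hp; have := IV_II_disjoint hp p3; have := IV_VII_disjoint hp p3.
have := XV_II_disjoint hp p3; have := XV_VII_disjoint hp p3; have := II_VII_disjoint hp p3.
have := IX_XXIV_disjoint hp p2 => *.
by rewrite /=; do ![apply: conj]; disjointness.
Qed.

Lemma disjoint_five (p5 : (5 <= p)%N) : pairwise_disjoint
  [:: S_IV hp; S_I hp; S_IX hp; S_XXIV hp; S_XV hp; S_XXVI k].
Proof.
have p2 : p != 2%N by apply: contraTneq p5 => ->.
have := IV_XV_disjoint hp; have := IV_I_disjoint hp p5.
have := XV_I_disjoint hp p5; have := IX_XXIV_disjoint hp p2 => *.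
by rewrite /=; do ![apply: conj]; disjointness.
Qed.

Lemma XXVI_sub : S_XXVI k `<=` alg_hom_classes k 2 4.
Proof. by move=> _ [i _ <-]; exists (sigma_XXVI k). Qed.

Lemma classes_two (p2 : p = 2%N) : alg_hom_classes k 2 4 =
  S_IV hp `|` (S_V hp p2 `|` S_XI hp p2 `|` S_XIX hp p2 `|` S_XXIV hp) `|` S_XV hp `|` S_XXVI k.
Proof.
apply/seteqP; split=> [_ [s _ <-]|].
  case: (classification hp s) => [e1 e2 h e|e2 e3 h e|e h|h|p2' e h|p2' e h|p2' e h|p3 e h
      |p3 e h|e h h'|e h h'].
  - by left; left; left; refine (class_in_family (f := sigma_IV hp) _ e).
  - by left; right; refine (class_in_family (f := sigma_XV hp) _ e).
  - by left; left; right; right; refine (class_in_family _ h).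
  - by right; refine (class_in_family (D := Lambda4 k) (f := fun=> sigma_XXVI k) (i := 1%:M) _ h).
  - by left; left; right; left; left; left; rewrite (Prop_irrelevance p2 p2'); refine (class_in_family _ h).
  - by left; left; right; left; left; right; rewrite (Prop_irrelevance p2 p2'); refine (class_in_family _ h).
  - by left; left; right; left; right; rewrite (Prop_irrelevance p2 p2'); refine (class_in_family _ h).
  - by exfalso; have := p2; rewrite p3.
  - by exfalso; have := p2; rewrite p3.
  - by exfalso; have := h; rewrite p2.
  - by exfalso; have := h; rewrite p2.
by do ![rewrite subUset; split]; (exact: XXVI_sub || exact: sub_classes).
Qed.

Lemma classes_three (p3 : p = 3%N) : alg_hom_classes k 2 4 =
  S_IV hp `|` (S_II hp p3 `|` S_VII hp p3 `|` S_IX hp `|` S_XXIV hp) `|` S_XV hp `|` S_XXVI k.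
Proof.
apply/seteqP; split=> [_ [s _ <-]|].
  case: (classification hp s) => [e1 e2 h e|e2 e3 h e|e h|h|p2 e h|p2 e h|p2 e h|p3' e h
      |p3' e h|e h h'|e h h'].
  - by left; left; left; refine (class_in_family (f := sigma_IV hp) _ e).
  - by left; right; refine (class_in_family (f := sigma_XV hp) _ e).
  - by left; left; right; right; refine (class_in_family _ h).
  - by right; refine (class_in_family (D := Lambda4 k) (f := fun=> sigma_XXVI k) (i := 1%:M) _ h).
  - by exfalso; have := p2; rewrite p3.
  - by exfalso; have := p2; rewrite p3.
  - by exfalso; have := p2; rewrite p3.
  - by left; left; right; left; left; left; rewrite (Prop_irrelevance p3 p3'); refine (class_in_family _ h).
  - by left; left; right; left; left; right; rewrite (Prop_irrelevance p3 p3'); refine (class_in_family _ h).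
  - by left; left; right; left; right; refine (class_in_family _ h').
  - by exfalso; have := h; rewrite p3.
by do ![rewrite subUset; split]; (exact: XXVI_sub || exact: sub_classes).
Qed.

Lemma classes_five (p5 : (5 <= p)%N) : alg_hom_classes k 2 4 =
  S_IV hp `|` (S_I hp `|` S_IX hp `|` S_XXIV hp) `|` S_XV hp `|` S_XXVI k.
Proof.
apply/seteqP; split=> [_ [s _ <-]|].
  case: (classification hp s) => [e1 e2 h e|e2 e3 h e|e h|h|p2 e h|p2 e h|p2 e h|p3 e h
      |p3 e h|e h h'|e h h'].
  - by left; left; left; refine (class_in_family (f := sigma_IV hp) _ e).
  - by left; right; refine (class_in_family (f := sigma_XV hp) _ e).
  - by left; left; right; right; refine (class_in_family _ h).
  - by right; refine (class_in_family (D := Lambda4 k) (f := fun=> sigma_XXVI k) (i := 1%:M) _ h).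
  - by exfalso; have := p5; rewrite p2.
  - by exfalso; have := p5; rewrite p2.
  - by exfalso; have := p5; rewrite p2.
  - by exfalso; have := p5; rewrite p3.
  - by exfalso; have := p5; rewrite p3.
  - by left; left; right; left; right; refine (class_in_family _ h').
  - by left; left; right; left; left; refine (class_in_family _ h').
by do ![rewrite subUset; split]; (exact: XXVI_sub || exact: sub_classes).
Qed.

End Assembly.

Section Reordering.
Variable T : Type.
Implicit Types A B C D X : set T.

Ltac reorder := move=> X /= d ->; apply: disjoint_unionI => /=;
  [apply/seteqP; split=> x; rewrite /setU /set0 /=; tauto
  | match goal with d : _ /\ _ |- _ => decompose [and] d end; do ![apply: conj]; match goal with
    | |- True => exact: I
    | H : ?A `&` ?B = set0 |- ?A `&` ?B = set0 => exact: H
    | H : ?A `&` ?B = set0 |- ?B `&` ?A = set0 => rewrite setIC; exact: H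
    end].

(** The cardinality statement groups the families with parameters in [Lambda2], while the union
    lists all families in numerical order; one disjointness proof serves both. *)
Lemma reorder_two A B1 B2 B3 B4 C D : forall X,
    pairwise_disjoint [:: A; B1; B2; B3; B4; C; D] ->
    X = A `|` (B1 `|` B2 `|` B3 `|` B4) `|` C `|` D ->
  disjoint_union X [:: A; B1; B2; C; B3; B4; D].
Proof. reorder. Qed.

Lemma reorder_three A B1 B2 B3 B4 C D : forall X,
    pairwise_disjoint [:: A; B1; B2; B3; B4; C; D] ->
    X = A `|` (B1 `|` B2 `|` B3 `|` B4) `|` C `|` D ->
  disjoint_union X [:: B1; A; B2; B3; C; B4; D].
Proof. reorder. Qed.

Lemma reorder_five A B1 B2 B3 C D : forall X,
    pairwise_disjoint [:: A; B1; B2; B3; C; D] ->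
    X = A `|` (B1 `|` B2 `|` B3) `|` C `|` D ->
  disjoint_union X [:: B1; A; B2; C; B3; D].
Proof. reorder. Qed.

End Reordering.

Theorem theorem6p26 (k : closedFieldType) (p : nat) (hp : p \in [pchar k]) :
  [/\ forall p2 : p = 2%N,
   [/\ disjoint_union (alg_hom_classes k 2 4)
        [:: S_IV hp; S_V hp p2; S_XI hp p2; S_XV hp; S_XIX hp p2;
            S_XXIV hp; S_XXVI k],
       (set_bij Lambda1 (S_IV hp) (cl_IV hp) /\
        set_bij Lambda2 (S_V hp p2) (cl_V hp p2) /\
        set_bij Lambda2 (S_XI hp p2) (cl_XI hp p2) /\
        set_bij Lambda3 (S_XV hp) (cl_XV hp) /\
        set_bij Lambda2 (S_XIX hp p2) (cl_XIX hp p2) /\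
        set_bij Lambda2 (S_XXIV hp) (cl_XXIV hp) /\
        set_bij (Lambda4 k) (S_XXVI k) (cl_XXVI k))
     & (alg_hom_classes k 2 4 #=
         [set: Lambda1 + (Lambda2 + Lambda2 + Lambda2 + Lambda2) + Lambda3
               + Lambda4 k])%card],
   forall p3 : p = 3%N,
   [/\ disjoint_union (alg_hom_classes k 2 4)
        [:: S_II hp p3; S_IV hp; S_VII hp p3; S_IX hp; S_XV hp;
            S_XXIV hp; S_XXVI k],
       (set_bij Lambda2 (S_II hp p3) (cl_II hp p3) /\
        set_bij Lambda1 (S_IV hp) (cl_IV hp) /\
        set_bij Lambda2 (S_VII hp p3) (cl_VII hp p3) /\
        set_bij Lambda2 (S_IX hp) (cl_IX hp) /\
        set_bij Lambda3 (S_XV hp) (cl_XV hp) /\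
        set_bij Lambda2 (S_XXIV hp) (cl_XXIV hp) /\
        set_bij (Lambda4 k) (S_XXVI k) (cl_XXVI k))
     & (alg_hom_classes k 2 4 #=
         [set: Lambda1 + (Lambda2 + Lambda2 + Lambda2 + Lambda2) + Lambda3
               + Lambda4 k])%card]
  & (5 <= p)%N ->
   [/\ disjoint_union (alg_hom_classes k 2 4)
        [:: S_I hp; S_IV hp; S_IX hp; S_XV hp;
            S_XXIV hp; S_XXVI k],
       (set_bij Lambda2 (S_I hp) (cl_I hp) /\
        set_bij Lambda1 (S_IV hp) (cl_IV hp) /\
        set_bij Lambda2 (S_IX hp) (cl_IX hp) /\
        set_bij Lambda3 (S_XV hp) (cl_XV hp) /\
        set_bij Lambda2 (S_XXIV hp) (cl_XXIV hp) /\
        set_bij (Lambda4 k) (S_XXVI k) (cl_XXVI k))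
     & (alg_hom_classes k 2 4 #=
         [set: Lambda1 + (Lambda2 + Lambda2 + Lambda2) + Lambda3
               + Lambda4 k])%card]].
Proof.
have bI := bij_I hp; have bIV := bij_IV hp; have bIX := bij_IX hp; have bXV := bij_XV hp.
have bXXIV := bij_XXIV hp; have bXXVI := bij_XXVI k.
split=> [p2|p3|p5].
- have bV := bij_V hp p2; have bXI := bij_XI hp p2; have bXIX := bij_XIX hp p2.
  split.
  + exact: reorder_two (disjoint_two hp p2) (classes_two hp p2).
  + by do ![apply: conj].
  + exact: (card_seven (enumerates_set_type bIV) (enumerates_set_type bV)
      (enumerates_set_type bXI) (enumerates_set_type bXIX) (enumerates_set_type bXXIV)
      (enumerates_set_type bXV) (enumerates_set_type bXXVI) (disjoint_two hp p2)
      (classes_two hp p2)).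
- have bII := bij_II hp p3; have bVII := bij_VII hp p3.
  split.
  + exact: reorder_three (disjoint_three hp p3) (classes_three hp p3).
  + by do ![apply: conj].
  + exact: (card_seven (enumerates_set_type bIV) (enumerates_set_type bII)
      (enumerates_set_type bVII) (enumerates_set_type bIX) (enumerates_set_type bXXIV)
      (enumerates_set_type bXV) (enumerates_set_type bXXVI) (disjoint_three hp p3)
      (classes_three hp p3)).
- split.
  + exact: reorder_five (disjoint_five hp p5) (classes_five hp p5).
  + by do ![apply: conj].
  + exact: (card_six (enumerates_set_type bIV) (enumerates_set_type bI)
      (enumerates_set_type bIX) (enumerates_set_type bXXIV) (enumerates_set_type bXV)
      (enumerates_set_type bXXVI) (disjoint_five hp p5) (classes_five hp p5)).
Qed.
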